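(* Let $d\ge 2$. Fix any TSP heuristic, any branching strategy, and a lower bound heuristic $\mathrm{LB}$ which is either $\mathrm{TF}_g$ (for some fixed $g\ge 3$) or $\mathrm{HK}$. Then, almost surely, the pruned branch-and-bound tree obtained when branch and bound is used to solve the TSP on $\mathcal{X}_n$ has $e^{\Omega(n/\log^6 n)}$ leaves; that is, there is a constant $c>0$ such that almost surely, for all sufficiently large $n$, the pruned branch-and-bound tree for $\mathcal{X}_n$ has at least $e^{cn/\log^6 n}$ leaves.
   Context: Let $x_1,x_2,\dots$ be independent uniformly random points of $[0,1]^d$ and $\mathcal{X}_n=\{x_1,\dots,x_n\}$; edge weights are Euclidean distances. Lower bounds. For edge sets $I,O$ on $\mathcal{X}_n$, $\mathrm{TF}_g(\mathcal{X}_n\mid I,O)$ is the minimum total length of a 2-factor of $\mathcal{X}_n$ (a collection of vertex-disjoint cycles covering all points), all of whose cycles have at least $g$ vertices, that contains all edges in $I$ and no edge in $O$. $\mathrm{HK}(\mathcal{X}_n\mid I,O)$ is the optimal value of the Held-Karp LP on $V=\mathcal{X}_n$ with the additional constraints $x_e=1$ for $e\in I$ and $x_e=0$ for $e\in O$; the Held-Karp LP is: minimize $\sum_{\{i,j\}\subseteq V}c_{\{ij\}}x_{\{ij\}}$ ($c_{\{ij\}}$ the Euclidean distance) subject to $\sum_{j\neq i}x_{\{ij\}}=2$ for all $i$, $\sum_{\{i,j\}\subseteq S}x_{\{ij\}}\le|S|-1$ for all $\emptyset\neq S\subsetneq V$, and $0\le x_{\{ij\}}\le1$. (The value is $+\infty$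 if infeasible.) Branching strategy. A branching strategy is any method that produces, from an input weighted graph (here the complete graph on $\mathcal{X}_n$), a rooted tree (the unpruned branch-and-bound tree) whose vertices $v$ are labeled with sets $I_v,O_v$ of edges (required inclusions and exclusions), with $I=O=\emptyset$ at the root. Writing $\Lambda_v$ for the set of TSP tours (Hamiltonian cycles on $\mathcal{X}_n$) containing all edges of $I_v$ and avoiding all edges of $O_v$ (so for the root it is the set of all tours), it is required that: (1) if $v$ is a child of $u$, then $I_v\supseteq I_u$ and $O_v\supseteq O_u$; (2) if $v_1,\dots,v_k$ are the children of $u$ then $\Lambda_u=\bigcup_{i=1}^k\Lambda_{v_i}$; (3) every leaf $v$ of the unpruned tree satisfies $|\Lambda_v|=1$. Branch and bound. A TSP heuristic is any method finding (not necessarily optimal) tours subject to the constraints $I_v,O_v$. Starting from the root, at each vertex $v$ reached, the heuristic is used to find a tour in $\Lambda_v$; $B$ denotes the length of the shortest tour found so far. Let $b_v=\mathrm{LB}(\mathcal{X}_n\mid I_v,O_v)$. If $b_v\ge B$, the tree is pruned below $v$, so that $v$ becomes a leaf of the pruned tree; otherwise one branches to all the children of $v$ given by the branching strategy. The process terminates when every leaf $v$ of the pruned branch-and-bound tree satisfies $b_v\ge B$ (certifying that the best tour found is optimal). *)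

(* Defs.v *)
From HB Require Import structures.
From mathcomp Require Import all_boot all_order all_algebra finmap.
From mathcomp Require Import all_classical all_reals all_analysis.

Set Implicit Arguments.
Unset Strict Implicit.
Unset Printing Implicit Defensive.

Import Order.TTheory GRing.Theory Num.Theory.

Local Open Scope classical_set_scope.
Local Open Scope ring_scope.

Section RandomPoints.
Context {disp : measure_display} {T : measurableType disp} {R : realType}.
Variable P : probability T R.

Definition mutually_independent {disp' : measure_display}
    {T' : measurableType disp'} (X : nat -> {RV P >-> T'}) : Prop :=
  forall (J : {fset nat}) (A : nat -> set T'),
    (forall j, measurable (A j)) ->
    P (\bigcap_(j in [set` J]) (X j @^-1` A j)) =
    (\prod_(j <- J) P (X j @^-1` A j))%E.

(* The uniform law on [0,1]^d is the d-fold product of the uniform law on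
   [0,1]; it is determined by its values on measurable rectangles. *)
Definition uniform_on_cube (d : nat) (X : {RV P >-> d.-tuple R}) : Prop :=
  forall A : 'I_d -> set R, (forall k, measurable (A k)) ->
    distribution P X [set x | forall k, A k (tnth x k)] =
    (\prod_(k < d) uniform_prob (@ltr01 R) (A k))%E.

End RandomPoints.

(* The edges of the complete graph on 'I_n: the unordered pair {i, j} is
   represented by the ordered pair (i, j) with i < j. *)
Definition edge (n : nat) : finType := {p : 'I_n * 'I_n | (p.1 < p.2)%N}.

Section Graphs.
Variable n : nat.
Implicit Types (e : edge n) (c : seq 'I_n) (F I O : {set edge n}).

Definition src e : 'I_n := (val e).1.
Definition tgt e : 'I_n := (val e).2.

Definition is_cycle c : bool := uniq c && (2 < size c)%N.

(* [next c i] is [i] itself when [i] is not on the cycle [c]. *)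
Definition cycle_edges c : {set edge n} :=
  [set e | (next c (src e) == tgt e) || (next c (tgt e) == src e)]%SET.

Definition two_factor (g : nat) F : Prop :=
  exists cs : seq (seq 'I_n),
    [/\ all (fun c => is_cycle c && (g <= size c)%N) cs,
        uniq (flatten cs),
        (forall i, i \in flatten cs)
      & F = (\bigcup_(c <- cs) cycle_edges c)%SET].

Definition is_tour F : bool :=
  [exists c : n.-tuple 'I_n, is_cycle c && (F == cycle_edges c)].

Definition respects I O F : bool := (I \subset F) && [disjoint O & F].

Definition tours I O : {set {set edge n}} :=
  [set F | is_tour F && respects I O F]%SET.

End Graphs.

Section LowerBounds.
Variables (R : realType) (n : nat) (w : edge n -> R).
Implicit Types (I O F : {set edge n}).

Definition total_weight F : R := \sum_(e in F) w e.

(* Minima are taken as infima in \bar R, hence are +oo when infeasible. *)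
Definition TF (g : nat) I O : \bar R :=
  ereal_inf [set (total_weight F)%:E | F in
    [set F | two_factor g F /\ respects I O F]].

Definition HK_feasible I O (x : edge n -> R) : Prop :=
  [/\ forall i : 'I_n, \sum_(e : edge n | (src e == i) || (tgt e == i)) x e = 2,
      forall S : {set 'I_n}, S != finset.set0 -> S != finset.setT ->
        \sum_(e : edge n | (src e \in S) && (tgt e \in S)) x e <= #|S|%:R - 1,
      forall e, 0 <= x e <= 1,
      forall e, e \in I -> x e = 1
    & forall e, e \in O -> x e = 0].

Definition HK I O : \bar R :=
  ereal_inf [set (\sum_(e : edge n) w e * x e)%:E | x in HK_feasible I O].

End LowerBounds.

(* A lower bound LB(w | I, O) for the TSP on the complete graph with edge
   weights w. *)
Definition lower_bound (R : realType) : Type :=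
  forall n : nat, (edge n -> R) -> {set edge n} -> {set edge n} -> \bar R.

Definition LB_TF (R : realType) (g : nat) : lower_bound R :=
  fun n w I O => TF w g I O.

Definition LB_HK (R : realType) : lower_bound R := fun n w I O => HK w I O.

Record labeled_tree (n : nat) := LabeledTree {
  vertex : finType;
  root : vertex;
  parent : vertex -> option vertex;
  incl : vertex -> {set edge n};
  excl : vertex -> {set edge n} }.

Section BranchingTree.
Variables (n : nat) (t : labeled_tree n).

Definition children (u : vertex t) : {set vertex t} :=
  [set v | parent v == Some u]%SET.

Definition rooted_tree : Prop :=
  (forall v : vertex t, (parent v == None) = (v == root t)) /\
  (forall v : vertex t, connect (fun x y => parent x == Some y) v (root t)).

Definition vertex_tours (v : vertex t) : {set {set edge n}} :=
  tours (incl v) (excl v).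

Definition branching_tree : Prop :=
  [/\ rooted_tree,
      incl (root t) = finset.set0 /\ excl (root t) = finset.set0,
      forall u v : vertex t, v \in children u ->
        incl u \subset incl v /\ excl u \subset excl v,
      forall u : vertex t, children u != finset.set0 ->
        vertex_tours u = (\bigcup_(v in children u) vertex_tours v)%SET
    & forall u : vertex t, children u = finset.set0 -> #|vertex_tours u| = 1%N].

End BranchingTree.

(* There is no tour on fewer than three vertices, so that no branching tree
   exists: strategies are unconstrained there. *)
Definition branching_strategy (R : realType)
    (S : forall n : nat, (edge n -> R) -> labeled_tree n) : Prop :=
  forall (n : nat) (w : edge n -> R), (2 < n)%N -> branching_tree (S n w).

Definition tsp_heuristic (R : realType)
    (H : forall n : nat,
       (edge n -> R) -> {set edge n} -> {set edge n} -> {set edge n}) : Prop :=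
  forall (n : nat) (w : edge n -> R) (I O : {set edge n}),
    tours I O != finset.set0 -> H n w I O \in tours I O.

Section BranchAndBound.
Variables (R : realType) (n : nat) (w : edge n -> R) (t : labeled_tree n).
Variable H : {set edge n} -> {set edge n} -> {set edge n}.
Variable LB : {set edge n} -> {set edge n} -> \bar R.
Implicit Types (D E : {set vertex t}) (v : vertex t).

Definition vertex_bound v : \bar R := LB (incl v) (excl v).

(* The number B, once the heuristic has been run at the vertices of E. *)
Definition incumbent E : \bar R :=
  \big[Order.min/+oo%E]_(v in E) (total_weight w (H (incl v) (excl v)))%:E.

Definition leaves D : {set vertex t} :=
  [set v in D | [disjoint children v & D]]%SET.

(* [bb_state D E]: some run of branch and bound has generated the subtree D
   and has reached (running the heuristic there) the vertices of E.  The order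
   in which vertices are reached and branched on is arbitrary, so depth-first,
   breadth-first, best-first, etc. searches are all covered. *)
Inductive bb_state : {set vertex t} -> {set vertex t} -> Prop :=
| bb_start : bb_state [set root t]%SET finset.set0
| bb_reach D E v : bb_state D E -> v \in D -> bb_state D (v |: E)%SET
| bb_branch D E v : bb_state D E -> v \in E -> v \in leaves D ->
    (vertex_bound v < incumbent E)%E -> bb_state (D :|: children v)%SET E.

(* D is the pruned tree of a terminated run.  A leaf of the unpruned tree has
   no child to branch to, so it may remain a leaf whatever its bound is. *)
Definition pruned_tree D : Prop :=
  bb_state D D /\
  forall v, v \in leaves D ->
    (incumbent D <= vertex_bound v)%E \/ children v = finset.set0.

End BranchAndBound.

Section Euclidean.
Variables (R : realType) (d : nat).

Definition euclidean_dist (x y : d.-tuple R) : R :=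
  Num.sqrt (\sum_(k < d) (tnth x k - tnth y k) ^+ 2).

Definition euclidean_weight (x : nat -> d.-tuple R) (n : nat) : edge n -> R :=
  fun e => euclidean_dist (x (src e)) (x (tgt e)).

End Euclidean.

(* Main.v *)
(* A 2-opt exchange argument controls an optimal tour near a gadget, a group of
   5m points, far from all others, that form five lobes of m points at the
   vertices of a pentagon.  Since the gadget is isolated, an optimal tour
   enters and leaves it at most twice, so that one of its lobes is only joined
   to other lobes; since the lobes are separated, the tour runs through that
   lobe just once, as u, r_1, ..., r_m, v with u and v in the gadget.  Both lower
   bounds gain some gamma > 0 there: a 2-factor may close r_1, ..., r_m into a
   cycle and join u to v, and the Held-Karp LP may replace the run by a
   half-integral prism on the lobe (m = 6).

   Permuting u, r_1, ..., r_m in each of k gadgets gives (m+1)!^k tours.  If the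
   constraints (I, O) of a node do not touch a gadget, the gain is available
   there; if they do, they rule out at least one of the (m+1)! arrangements.
   A node whose lower bound reaches the length of the optimal tour must thus
   constrain a positive fraction of the gadgets, and is compatible with at most
   an e^{-ck} fraction of these tours.  As the leaves cover all tours, there
   are at least e^{ck} of them.

   Finally, among about n cells of the cube, linearly many contain a gadget: in
   expectation by counting labels of the points in a fine grid, and almost
   surely for large n by the method of bounded differences and Borel-Cantelli.
   The bound obtained is e^{cn}, from which the statement follows. *)

Require Import Defs.
From Stdlib Require Import BinInt BinNat Nnat.
From HB Require Import structures.
From mathcomp Require Import all_boot all_order all_algebra finmap.
From mathcomp Require Import fingroup perm.
From mathcomp Require Import all_classical all_reals all_analysis.
From mathcomp Require Import zify ring lra.

Set Implicit Arguments.
Unset Strict Implicit.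
Unset Printing Implicit Defensive.

Import Order.TTheory GRing.Theory Num.Theory.
Local Open Scope ring_scope.

(** * Tours as cyclic permutations *)

(** A leaf need not admit the optimal tour [s], so its bound cannot be compared with [s] directly.
    It is compared with an arrangement of [s] that it does admit, after the order of [s] has been
    restored in every free gadget: this tour exceeds the optimum by at most [2 (m+1) Delta] per
    constrained gadget, while the relaxation gains [gamma] per free one. The fraction of gadgets to
    be constrained thus depends on [gamma / Delta] only, which does not change when the cells shrink
    with [n].

    There are five lobes because two entering and two leaving edges meet at most four. A pentagon
    suits because its diagonals are shorter than twice its sides: replacing two edges between lobes
    by one such edge and one inside a lobe is then always a gain. This one inequality excludes a
    second entry into a lobe, and pays for the cycle that a 2-factor closes there.

    Tours are permutations with a single cycle, so that an arrangement is a conjugation, which can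
    never disconnect the tour. *)

Section PermEdges.
Variable n : nat.
Implicit Types (s : {perm 'I_n}) (x y : 'I_n) (c : seq 'I_n).

Definition pedges s : {set edge n} :=
  [set e | (s (src e) == tgt e) || (s (tgt e) == src e)]%SET.

Definition one_cycle s : Prop := forall x y, fconnect s x y.

Lemma edge_neq (e : edge n) : src e != tgt e.
Proof. by case: e => -[i j] /= lij; rewrite /src /tgt /= -val_eqE neq_ltn lij. Qed.

Lemma edge_ends x y : x != y -> exists e : edge n,
  (src e = x /\ tgt e = y) \/ (src e = y /\ tgt e = x).
Proof.
rewrite -val_eqE neq_ltn => /orP[] h.
- by exists (Sub (x, y) h : edge n); left.
- by exists (Sub (y, x) h : edge n); right.
Qed.

Lemma one_cycle_size s c x :
  one_cycle s -> fcycle s c -> x \in c -> (n <= size c)%N.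
Proof.
move=> hs fc xc; rewrite -[X in (X <= _)%N](card_ord n).
apply: leq_trans (card_size c).
by apply/subset_leq_card/fintype.subsetP => y _; rewrite -(fconnect_cycle fc xc) hs.
Qed.

Lemma one_cycle_neq s x : (1 < n)%N -> one_cycle s -> s x != x.
Proof.
move=> n1 hs; apply/eqP => sx.
have := @one_cycle_size s [:: x] x hs; rewrite /= sx !inE eqxx /= => /(_ isT isT).
by rewrite leqNgt n1.
Qed.

Lemma one_cycle_neq2 s x : (2 < n)%N -> one_cycle s -> s (s x) != x.
Proof.
move=> n2 hs; apply/eqP => sx.
have := @one_cycle_size s [:: x; s x] x hs.
rewrite /= sx !inE !eqxx /= => /(_ isT isT).
by rewrite leqNgt n2.
Qed.

Lemma one_cycle_order s x : one_cycle s -> fingraph.order s x = n.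
Proof.
by move=> hs; rewrite /fingraph.order -[RHS](card_ord n); apply: eq_card => y; rewrite !inE hs.
Qed.

Section ListPerm.
Variable c : seq 'I_n.
Hypothesis Uc : uniq c.

Definition next_perm : {perm 'I_n} := perm (can_inj (prev_next Uc)).

Lemma next_permE x : next_perm x = next c x.
Proof. by rewrite permE. Qed.

Lemma next_perm_edges : pedges next_perm = cycle_edges c.
Proof. by apply/setP => e; rewrite !inE !next_permE. Qed.

Lemma next_perm_cycle : (forall x, x \in c) -> one_cycle next_perm.
Proof.
move=> cT x y; have h := cycle_next Uc.
have fc : fcycle next_perm c.
  rewrite (eq_cycle (e' := frel (next c))) // => a b /=.
  by rewrite next_permE.
by rewrite (fconnect_cycle fc (cT x)) cT.
Qed.

End ListPerm.

Lemma uniq_full c : uniq c -> size c = n -> forall x, x \in c.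
Proof.
move=> Uc sc x.
have [] // := @uniq_min_size _ c (enum 'I_n) Uc.
- by move=> y _; rewrite mem_enum.
- by rewrite -cardT card_ord sc.
by move=> _ ->; rewrite mem_enum.
Qed.

Lemma tour_perm F : (2 < n)%N -> is_tour F ->
  exists2 s, one_cycle s & F = pedges s.
Proof.
move=> n2 /existsP[c /andP[/andP[Uc _] /eqP ->]].
exists (next_perm Uc); last by rewrite next_perm_edges.
by apply: next_perm_cycle => x; apply: uniq_full => //; rewrite size_tuple.
Qed.

Lemma perm_tour s : (2 < n)%N -> one_cycle s -> is_tour (pedges s).
Proof.
move=> n2 hs; pose x0 := Ordinal (ltnW (ltnW n2)).
have so : size (orbit s x0) == n by rewrite size_orbit one_cycle_order.
apply/existsP; exists (Tuple so); rewrite /is_cycle /= orbit_uniq (eqP so) n2 /=.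
apply/eqP/setP => e; rewrite !inE.
have nE x : next (orbit s x0) x = s x.
  have h := cycle_orbit (@perm_inj _ s) x0.
  have xo : x \in orbit s x0 by rewrite -fconnect_orbit hs.
  by have /eqP := next_cycle h xo.
by rewrite !nE.
Qed.

Lemma one_cycle_conj s t : one_cycle s -> one_cycle (s ^ t)%g.
Proof.
move=> hs x y.
have itE k z : iter k (s ^ t)%g (t z) = t (iter k s z).
  by elim: k => //= k ->; rewrite permJ.
have := iter_findex (hs ((t^-1)%g x) ((t^-1)%g y)).
move/(congr1 t); rewrite -itE !permKV => <-; exact: fconnect_iter.
Qed.

End PermEdges.

Section Weights.
Variables (R : realType) (n : nat) (dd : 'I_n -> 'I_n -> R).
Hypothesis dsym : forall x y, dd x y = dd y x.

(** Passes from edges, stored as pairs [i < j], to ordered pairs; the doubling avoids a division. *)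
Lemma sum_edge_sym (G : 'I_n -> 'I_n -> R) : (forall i j, G i j = G j i) ->
  (\sum_(e : edge n) G (src e) (tgt e)) *+ 2 =
  \sum_(i < n) \sum_(j < n | j != i) G i j.
Proof.
move=> Gs.
have E : \sum_(e : edge n) G (src e) (tgt e) =
         \sum_(i < n) \sum_(j < n | (i < j)%N) G i j.
  rewrite pair_big_dep /=.
  by rewrite -(big_sub (fun p : 'I_n * 'I_n => (p.1 < p.2)%N) (fun p => G p.1 p.2)).
rewrite mulr2n {2}E (exchange_big_dep predT) //= E -big_split /=.
apply: eq_bigr => i _; rewrite [RHS](bigID (fun j : 'I_n => (i < j)%N)) /=.
congr (_ + _); first by apply: eq_bigl => j; rewrite -val_eqE /=; case: ltngtP.
under eq_bigr do rewrite Gs.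
by apply: eq_bigl => j; rewrite -val_eqE /=; case: ltngtP.
Qed.

Definition edge_weight : edge n -> R := fun e => dd (src e) (tgt e).

(** The second hypothesis excludes 2-cycles, whose single edge would be counted twice on the
    right. *)
Lemma total_weight_pedges (s : {perm 'I_n}) :
  (forall x, s x != x) -> (forall x, s (s x) != x) ->
  total_weight edge_weight (pedges s) = \sum_x dd x (s x).
Proof.
move=> s1 s2; apply: (@mulIf _ 2%:R); first by rewrite pnatr_eq0.
rewrite !mulr_natr /total_weight big_mkcond /=.
pose G i j := dd i j * ((s i == j)%:R + (s j == i)%:R).
transitivity ((\sum_(e : edge n) G (src e) (tgt e)) *+ 2).
  congr (_ *+ 2); apply: eq_bigr => e _; rewrite !inE /G /edge_weight.
  case: eqP => [<-|_] /=; first by rewrite (negbTE (s2 _)) addr0 mulr1.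
  by case: eqP => _; rewrite add0r ?mulr1 ?mulr0.
rewrite sum_edge_sym; last by move=> i j; rewrite /G dsym addrC.
rewrite (eq_bigr (fun i => \sum_(j < n | j != i) dd i j * (s i == j)%:R +
  \sum_(j < n | j != i) dd i j * (s j == i)%:R)); last first.
  by move=> i _; rewrite -big_split; apply: eq_bigr => j _; rewrite /G mulrDr.
rewrite big_split /= mulr2n; congr (_ + _).
  apply: eq_bigr => i _; rewrite (bigD1 (s i)) //= eqxx mulr1 big1 ?addr0 //.
  by move=> j /andP[_ ji]; rewrite eq_sym (negbTE ji) mulr0.
rewrite (exchange_big_dep predT) //=.
apply: eq_bigr => i _; rewrite (bigD1 (s i)) /=; last by rewrite eq_sym.
rewrite eqxx mulr1 big1 ?addr0 1?dsym //.
by move=> j /andP[_ ji]; rewrite eq_sym (negbTE ji) mulr0.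
Qed.

Fixpoint plen (x : 'I_n) (p : seq 'I_n) : R :=
  if p is y :: q then dd x y + plen y q else 0.

Lemma plen_cat x p q : plen x (p ++ q) = plen x p + plen (last x p) q.
Proof. by elim: p x => [|y p IH] x /=; rewrite ?add0r // IH addrA. Qed.

Lemma plen_rev x p : plen (last x p) (rev (belast x p)) = plen x p.
Proof.
elim: p x => [|y p IH] x //=.
rewrite rev_cons -cats1 plen_cat IH /= addr0 addrC dsym; congr (dd _ _ + _).
by case: p {IH} => //= z p; rewrite rev_cons last_rcons.
Qed.

Lemma plen_nth x p : plen x p = \sum_(i < size p) dd (nth x (x :: p) i) (nth x p i).
Proof.
elim: p x => [|y p IH] x /=; first by rewrite big_ord0.
rewrite big_ord_recl /= IH; congr (_ + _); apply: eq_bigr => i _.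
by rewrite /= !(set_nth_default x y) //= ltnS ltnW.
Qed.

Lemma sum_next (x0 : 'I_n) (p : seq 'I_n) : uniq (x0 :: p) -> (forall x, x \in x0 :: p) ->
  \sum_x dd x (next (x0 :: p) x) = plen (last x0 p) (x0 :: p).
Proof.
move=> Uc cT.
transitivity (\sum_(x <- x0 :: p) dd x (next (x0 :: p) x)).
  rewrite -big_enum /=; apply: perm_big; apply: uniq_perm => //; first exact: enum_uniq.
  by move=> x; rewrite mem_enum cT.
have nE i : (i <= size p)%N ->
    next (x0 :: p) (nth x0 (x0 :: p) i) = nth x0 p i.
  by move=> ip; rewrite next_nth cT (index_uniq _ _ Uc).
move: (next _) nE => nx nE.
rewrite (big_nth x0) big_mkord /= big_ord_recr nE // addrC /=.
rewrite [nth x0 p (size p)]nth_default //; congr (_ + _).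
  rewrite plen_nth; apply: eq_bigr => i _.
  by rewrite nE // ltnW.
by congr (dd _ _); exact: (nth_last x0 (x0 :: p)).
Qed.

(* 2-opt: reversing the stretch from [s x] to [y] replaces the edges
   [x, s x] and [y, s y] by [x, y] and [s x, s y]. *)
Lemma two_opt (s : {perm 'I_n}) x y : one_cycle s -> x != y ->
  exists2 t : {perm 'I_n}, one_cycle t &
    \sum_z dd z (t z) + (dd x (s x) + dd y (s y)) =
    \sum_z dd z (s z) + (dd x y + dd (s x) (s y)).
Proof.
move=> hs xy.
set c := orbit s (s x).
have Uc : uniq c := orbit_uniq _ _.
have cT z : z \in c by rewrite -fconnect_orbit hs.
have fc : fcycle s c := cycle_orbit (@perm_inj _ s) (s x).
have cE z : next c z = s z by have /eqP := next_cycle fc (cT z).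
have [p cp] : exists p, c = s x :: p.
  by rewrite /c /orbit -orderSpred /=; eexists.
move: fc; rewrite cp /= rcons_path => /andP[pp /eqP/perm_inj lx].
have yc : y \in s x :: p by rewrite -cp.
case/splitPl: yc cp pp lx => p1 [|z p2] ly cp; rewrite last_cat.
  by rewrite /= ly => _ yx; rewrite yx eqxx in xy.
rewrite cat_path ly /= => /and3P[_ /eqP zE _] lx.
rewrite -zE in cp lx *.
pose c' := rev (s x :: p1) ++ s y :: p2.
have pc : perm_eq c' c by rewrite cp -cat_cons perm_cat2r perm_rev.
have Uc' : uniq c' by rewrite (perm_uniq pc).
have cT' w : w \in c' by rewrite (perm_mem pc).
exists (next_perm Uc'); first exact: next_perm_cycle.
under eq_bigr do rewrite next_permE.
under [X in _ = X + _]eq_bigr do rewrite -cE.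
have c'E : c' = y :: rev (belast (s x) p1) ++ s y :: p2.
  by rewrite /c' lastI rev_rcons ly.
have lx' : last (s x) p1 = y by [].
move: Uc' cT'; rewrite c'E => Uc' cT'.
move: Uc cT; rewrite cp => Uc cT.
rewrite !sum_next //= !plen_cat !last_cat /= lx ly.
have -> : last y (rev (belast (s x) p1)) = s x.
  by case: (p1) ly => [|a q] //= _; rewrite rev_cons last_rcons.
by have := plen_rev (s x) p1; rewrite ly => ->; ring.
Qed.

End Weights.

Section DisjointPerms.
Variables (T G : finType) (B : G -> {set T}).
Hypothesis Bdisj : forall j k x, x \in B j -> x \in B k -> j = k.
Implicit Types sg : {ffun G -> {perm T}}.

Definition perm_cube := family (fun j => [set p | perm_on (B j) p]%SET).
Definition perm_prod sg : {perm T} := (\prod_j sg j)%g.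

Lemma perm_cubeP sg : reflect (forall j, perm_on (B j) (sg j)) (sg \in perm_cube).
Proof.
apply: (iffP familyP) => h j; first by have := h j; rewrite inE.
by rewrite inE.
Qed.

Variable sg : {ffun G -> {perm T}}.
Hypothesis sgB : sg \in perm_cube.

Lemma perm_prod_in j x : x \in B j -> perm_prod sg x = sg j x.
Proof.
have sgj := perm_cubeP _ sgB.
move=> xj; rewrite /perm_prod.
have E r : uniq r -> forall y, y \in B j ->
    (\prod_(k <- r) sg k)%g y = if j \in r then sg j y else y.
  elim: r => [|k r IH] /=; first by move=> _ y _; rewrite big_nil perm1.
  move=> /andP[kr Ur] y yj; rewrite big_cons permM inE.
  have [jk|jk] /= := eqVneq j k.
    by subst k; rewrite IH ?perm_closed // (negbTE kr).
  rewrite (out_perm (sgj k)) ?IH //.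
  by apply/negP => yk; rewrite (Bdisj yj yk) eqxx in jk.
by rewrite E // ?index_enum_uniq // mem_index_enum.
Qed.

Lemma perm_prod_out x : (forall j, x \notin B j) -> perm_prod sg x = x.
Proof.
have sgj := perm_cubeP _ sgB.
move=> xj; rewrite /perm_prod; elim: (index_enum _) => [|k r IH].
  by rewrite big_nil perm1.
by rewrite big_cons permM (out_perm (sgj k)).
Qed.

Lemma perm_prod_mem j x : (perm_prod sg x \in B j) = (x \in B j).
Proof.
have sgj := perm_cubeP _ sgB.
have [k xk|xn] := pickP (fun k => x \in B k).
  rewrite (perm_prod_in xk); apply/idP/idP => h.
    have ky : sg k x \in B k by rewrite perm_closed.
    by rewrite (Bdisj h ky).
  by rewrite (Bdisj h xk) perm_closed.
by rewrite perm_prod_out // => i; rewrite xn.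
Qed.

End DisjointPerms.

Lemma perm_two (T : finType) (B : {set T}) p q a b :
  p \in B -> q \in B -> a \in B -> b \in B -> p != q -> a != b ->
  exists t : {perm T}, [/\ perm_on B t, t p = a & t q = b].
Proof.
move=> pB qB aB bB pq ab.
have tB x y : x \in B -> y \in B -> perm_on B (tperm x y).
  move=> xB yB; apply/fintype.subsetP => z; rewrite inE.
  by case: tpermP => [->|->|]; rewrite ?eqxx.
exists (tperm p a * tperm (tperm p a q) b)%g; split.
- apply: perm_onM; apply: tB => //.
  by case: tpermP.
- rewrite permM tpermL tpermD // 1?eq_sym //.
  by rewrite -[X in X != _](tpermL p a) (inj_eq perm_inj).
- by rewrite permM tpermL.
Qed.

Section Run.
Variables (n : nat) (s : {perm 'I_n}).
Hypothesis hs : one_cycle s.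

Lemma one_cycle_iter x i : (i < n)%N -> iter i s x = x -> i = 0%N.
Proof.
move=> lin ix; have := @findex_iter _ s x i.
by rewrite one_cycle_order // ix findex0 => /(_ lin).
Qed.

Lemma iter_full x : iter n s x = x.
Proof. by have := @iter_order _ s (@perm_inj _ s) x; rewrite one_cycle_order. Qed.

(** Follow the tour from [u] until it first leaves [L], after [j - 1] points. A later return would
    be a second entry, so these points are all of [L]. *)
Lemma unique_entry_run (L : {set 'I_n}) x0 z0 :
  x0 \in L -> z0 \notin L ->
  (forall x y, x \notin L -> y \notin L -> s x \in L -> s y \in L -> x = y) ->
  exists u, [/\ u \notin L, L = [set x in traject s (s u) #|L|]%SET
              & s (iter #|L| s u) \notin L].
Proof.
move=> x0L z0L uni.
have [u uL suL] : exists2 u, u \notin L & s u \in L.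
  have := iter_findex (hs z0 x0); move: (findex _ _ _) => k kE.
  have : exists k, iter k s z0 \in L by exists k; rewrite kE.
  case/ex_minnP => -[|i] iL imin; first by rewrite iL in z0L.
  exists (iter i s z0) => //; apply/negP => h.
  by have := imin _ h; rewrite ltnn.
have n0 : (0 < n)%N by case: (n) u {uL suL} => // -[].
have : exists j, (0 < j)%N && (iter j s u \notin L).
  by exists n; rewrite iter_full n0.
case/ex_minnP => j /andP[j0 jL] jmin.
have jn : (j <= n)%N by apply: jmin; rewrite n0 iter_full.
have below i : (0 < i < j)%N -> iter i s u \in L.
  case/andP=> i0 ij; apply/negPn/negP => h.
  by have := jmin i; rewrite i0 h => /(_ isT); rewrite leqNgt ij.
have above i : (j <= i < n)%N -> iter i s u \notin L.
  elim: i => [|i IH]; first by rewrite leqn0 => /andP[/eqP j00]; rewrite j00 in j0.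
  rewrite leq_eqVlt => /andP[/orP[/eqP <- //|ji] lin].
  apply/negP => h; have iL : iter i s u \notin L by apply: IH; rewrite -ltnS ji ltnW.
  have := uni _ _ iL uL h suL => /(one_cycle_iter (ltnW lin)) i0.
  by move: ji j0; rewrite i0; case: (j).
have LE : L =i traject s (s u) j.-1.
  move=> x; apply/idP/trajectP => [xL|[i ij ->]]; last first.
    by rewrite -iterSr below //= -ltn_predRL.
  have := iter_findex (hs u x); have := findex_max (hs u x).
  rewrite one_cycle_order //; case: (findex _ _ _) => [|i] lin iE.
    by rewrite -iE /= (negbTE uL) in xL.
  exists i; last by rewrite -iterSr.
  rewrite ltn_predRL ltnNge; apply/negP => ji.
  by have := above i.+1; rewrite ji lin iE xL => /(_ isT).
have UL : uniq (traject s (s u) j.-1).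
  rewrite -(take_traject _ _ (n := n)) ?take_uniq //.
    by have := orbit_uniq s (s u); rewrite /orbit one_cycle_order.
  by rewrite (leq_trans (leq_pred _)).
have cL : #|L| = j.-1 by rewrite (eq_card LE) (card_uniqP UL) size_traject.
exists u; split=> //; rewrite cL.
  by apply/setP => x; rewrite inE LE.
by rewrite -iterS prednK.
Qed.

End Run.

(** * Rearranging a tour inside gadgets *)

Section TourCube.
Variables (n m : nat) (s : {perm 'I_n}) (G : finType).
Variables (u : G -> 'I_n) (S : G -> {set 'I_n}).
Hypotheses (m2 : (2 < m)%N) (mn : (m.+2 < n)%N) (hs : one_cycle s).
Hypothesis Sdisj : forall j k x, x \in S j -> x \in S k -> j = k.

Definition pos j i := iter i s (u j).
Hypothesis posS : forall j i, (i <= m.+1)%N -> pos j i \in S j.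

Definition lobe j : {set 'I_n} := [set x in traject s (s (u j)) m]%SET.
(** The block contains the entry [u j] besides the lobe. If [u j] stayed in place, no arrangement
    would use the edge from [u j] to the exit; excluding this edge would then spoil the gain of the
    2-factor without ruling out any arrangement. *)
Definition block j : {set 'I_n} := [set x in traject s (u j) m.+1]%SET.

Lemma lobeP j x : reflect (exists2 i, (i < m)%N & x = pos j i.+1) (x \in lobe j).
Proof.
rewrite inE; apply: (iffP trajectP) => -[i im ->]; exists i => //.
  by rewrite /pos iterSr.
by rewrite /pos iterSr.
Qed.

Lemma blockP j x : reflect (exists2 i, (i <= m)%N & x = pos j i) (x \in block j).
Proof. by rewrite inE; apply: (iffP trajectP) => -[i im ->]; exists i. Qed.

Lemma pos_block j i : (i <= m)%N -> pos j i \in block j.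
Proof. by move=> im; apply/blockP; exists i. Qed.

Lemma block_lobe j : block j = (u j |: lobe j)%SET.
Proof. by apply/setP => x; rewrite !inE. Qed.

Lemma sub_blockS j x : x \in block j -> x \in S j.
Proof. by case/blockP => i im ->; rewrite posS // ltnW. Qed.

Lemma block_disj j k x : x \in block j -> x \in block k -> j = k.
Proof. by move=> /sub_blockS xj /sub_blockS; exact: Sdisj. Qed.

Lemma pos_inj j i i' : (i < n)%N -> (i' < n)%N -> pos j i = pos j i' -> i = i'.
Proof.
move=> lin li'n E; have oE := one_cycle_order (u j) hs.
rewrite -(@findex_iter _ s (u j) i) ?oE // -(@findex_iter _ s (u j) i') ?oE //.
by congr (findex _ _ _).
Qed.

Lemma posSE j i : s (pos j i) = pos j i.+1. Proof. by []. Qed.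

Lemma pos_eq j i i' : (i < n)%N -> (i' < n)%N -> (pos j i == pos j i') = (i == i').
Proof. by move=> h h'; apply/eqP/eqP => [/pos_inj ->|->]. Qed.

Lemma card_block j : #|block j| = m.+1.
Proof.
rewrite cardsE; have /card_uniqP -> : uniq (traject s (u j) m.+1).
  rewrite -(take_traject _ _ (n := n)) ?take_uniq //.
    by have := orbit_uniq s (u j); rewrite /orbit one_cycle_order.
  by rewrite ltnW // ltnW.
by rewrite size_traject.
Qed.

Lemma enter_block j x : x \notin block j -> s x \in block j -> s x = u j.
Proof.
move=> xB /blockP[[|i] im E]; first by rewrite E.
move: E; rewrite -posSE => /perm_inj E.
by rewrite E pos_block // ltnW in xB.
Qed.

Lemma exit_block j x : x \in block j -> s x \notin block j -> s x = pos j m.+1.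
Proof.
case/blockP => i im ->; rewrite posSE => h.
have [->//|im'] := eqVneq i m.
by rewrite pos_block // ltn_neqAle im' im in h.
Qed.

Definition pre j := (s^-1)%g (u j).

Lemma s_pre j : s (pre j) = u j. Proof. exact: permKV. Qed.

Lemma exit_out j k : pos j m.+1 \notin block k.
Proof.
apply/negP => h; have jk := Sdisj (posS j (leqnn _)) (sub_blockS h).
move: h; rewrite -jk => /blockP[i im] /eqP.
by rewrite pos_eq; lia.
Qed.

Lemma pre_out j k : pre j \notin block k.
Proof.
apply/negP => h.
have uk : s (pre j) \in block k.
  apply/negPn/negP => h2; have := exit_block h h2; rewrite s_pre => uE.
  have jk : j = k.
    by apply: (@Sdisj _ _ (u j)); [exact: (@posS j 0)|rewrite uE posS].
  by move/eqP: uE; rewrite jk -[u k]/(pos k 0) pos_eq; lia.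
have jk : j = k.
  by move: uk; rewrite s_pre => /sub_blockS; apply: Sdisj; exact: (@posS j 0).
move: h; rewrite -jk => /blockP[i im] /(congr1 s).
by rewrite s_pre posSE -[u j]/(pos j 0) => /eqP; rewrite pos_eq; lia.
Qed.

Definition touches j (e : edge n) := (src e \in block j) || (tgt e \in block j).

(** In every arrangement, the tour edges at the block lead to the block itself, to [pre j] or to the
    exit. Conversely, each edge from the block to the hull occurs in some arrangement, see
    [hull_state]. An edge from the block to elsewhere occurs in none, so excluding it is
    harmless. *)
Definition hull j : {set 'I_n} := (block j :|: [set pre j; pos j m.+1])%SET.

Definition in_hull j (e : edge n) :=
  (src e \in block j) && (tgt e \in hull j) ||
  (tgt e \in block j) && (src e \in hull j).

(* If [j] is not free, then [I] and [O] rule out at least one of the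
   [(m.+1)`!] arrangements of its block, see [not_free_state]. *)
Definition free (I O : {set edge n}) j :=
  [forall e in I, ~~ touches j e] && [forall e in O, ~~ in_hull j e].

Notation cube := (perm_cube block).
Notation tour_of sg := (pedges (s ^ perm_prod sg)%g).

Lemma mem_conj (t : {perm 'I_n}) (e : edge n) x y :
  (src e = t x /\ tgt e = t y) \/ (src e = t y /\ tgt e = t x) ->
  (e \in pedges (s ^ t)%g) = (s x == y) || (s y == x).
Proof.
rewrite inE; case=> -[-> ->]; rewrite !permJ !(inj_eq perm_inj) //.
by rewrite orbC.
Qed.

Lemma touchesP j e : touches j e -> exists a b,
  [/\ a \in block j, b != a & (src e = a /\ tgt e = b) \/ (src e = b /\ tgt e = a)].
Proof.
have := edge_neq e; rewrite /touches => ne /orP[] h.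
  by exists (src e), (tgt e); split; [|rewrite eq_sym|left].
by exists (tgt e), (src e); split; [| |right].
Qed.

(** The end [a] in the block is put at position 1. If [b] is in the block too, it goes to position
    3, which is not adjacent; otherwise the neighbours of [a], at positions 0 and 2, lie in the
    block and so differ from [b]. *)
Lemma avoid_state j e : touches j e -> exists t, perm_on (block j) t /\
  forall sg, sg \in cube -> sg j = t -> e \notin tour_of sg.
Proof.
case/touchesP => a [b [aB ba eab]].
have p1 : pos j 1 \in block j by apply: pos_block; lia.
have p3 : pos j 3 \in block j by apply: pos_block.
have p13 : pos j 1 != pos j 3 by rewrite pos_eq //; lia.
have [b' b'B [b'a bb']] :
    exists2 b', b' \in block j & b' != a /\ (b \in block j -> b' = b).
  have [bB|bB] := boolP (b \in block j); first by exists b.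
  have [<-|h] := eqVneq (pos j 1) a; last by exists (pos j 1).
  by exists (pos j 3); rewrite // eq_sym.
have [t [tB t1 t3]] := perm_two p1 p3 aB b'B p13 ltac:(by rewrite eq_sym).
exists t; split=> // sg sgc sgj.
pose pi := perm_prod sg; pose c := (pi^-1)%g b.
have pa : pi (pos j 1) = a by rewrite /pi (perm_prod_in block_disj sgc p1) sgj.
have pb : pi c = b by rewrite permKV.
have cE : c \in block j -> c = pos j 3.
  rewrite -(perm_prod_mem block_disj sgc) -/pi pb => bB.
  apply: (@perm_inj _ pi); rewrite pb -(bb' bB) -t3 -sgj.
  by rewrite /pi (perm_prod_in block_disj sgc p3).
rewrite (@mem_conj pi e (pos j 1) c) ?pa ?pb //.
apply/norP; split; apply/eqP => h.
- have cB : c \in block j by rewrite -h posSE pos_block //; clear -m2; lia.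
  by move/eqP: h; rewrite (cE cB) posSE pos_eq; clear -m2 mn; lia.
- have c0 : c = pos j 0 by apply: (@perm_inj _ s); rewrite h.
  have cB : c \in block j by rewrite c0 pos_block.
  by move: c0; rewrite (cE cB) => /eqP; rewrite pos_eq; clear -m2 mn; lia.
Qed.

(** Two points of the block are put at positions 0 and 1. If [b] is [pre j] or the exit, [a] is put
    next to it, at position 0 or [m]. *)
Lemma hull_state j e : in_hull j e -> exists t, perm_on (block j) t /\
  forall sg, sg \in cube -> sg j = t -> e \in tour_of sg.
Proof.
move=> eh.
have [a [b [aB bH ba eab]]] : exists a b, [/\ a \in block j, b \in hull j, b != a &
    (src e = a /\ tgt e = b) \/ (src e = b /\ tgt e = a)].
  have := edge_neq e; case/orP: eh => /andP[h1 h2] ne.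
    by exists (src e), (tgt e); split; rewrite // 1?eq_sym //; left.
  by exists (tgt e), (src e); split; rewrite //; right.
have tB x : x \in block j -> perm_on (block j) (tperm x a).
  move=> xB; apply/fintype.subsetP => z; rewrite inE.
  by case: tpermP => [->|->|]; rewrite ?eqxx.
have p0 : pos j 0 \in block j by exact: pos_block.
have pm : pos j m \in block j by exact: pos_block.
case/finset.setUP: bH => [bB|/finset.set2P[] bE].
- have p1 : pos j 1 \in block j by apply: pos_block; lia.
  have p01 : pos j 0 != pos j 1 by rewrite pos_eq //; lia.
  have [t [tB' t0 t1]] := perm_two p0 p1 aB bB p01 ltac:(by rewrite eq_sym).
  exists t; split=> // sg sgc sgj.
  rewrite (@mem_conj _ e (pos j 0) (pos j 1)) ?posSE ?eqxx //.
  by rewrite !(perm_prod_in block_disj sgc (j := j)) // sgj t0 t1.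
- exists (tperm (pos j 0) a); split=> [|sg sgc sgj]; first exact: tB.
  rewrite (@mem_conj _ e (pos j 0) (pre j)) ?s_pre ?eqxx ?orbT //.
  rewrite (perm_prod_in block_disj sgc p0) sgj tpermL.
  by rewrite (perm_prod_out sgc (pre_out j)) -bE.
- exists (tperm (pos j m) a); split=> [|sg sgc sgj]; first exact: tB.
  rewrite (@mem_conj _ e (pos j m) (pos j m.+1)) ?posSE ?eqxx //.
  rewrite (perm_prod_in block_disj sgc pm) sgj tpermL.
  by rewrite (perm_prod_out sgc (exit_out j)) -bE.
Qed.

Lemma not_free_state I O j : ~~ free I O j -> exists t, perm_on (block j) t /\
  forall sg, sg \in cube -> sg j = t -> ~~ respects I O (tour_of sg).
Proof.
rewrite negb_and => /orP[] /forallPn[e]; rewrite negb_imply negbK => /andP[eIO h].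
  have [t [tB th]] := avoid_state h; exists t; split=> // sg sgc sgj.
  apply/negP => /andP[/fintype.subsetP /(_ e eIO)]; by rewrite (negbTE (th _ sgc sgj)).
have [t [tB th]] := hull_state h; exists t; split=> // sg sgc sgj.
apply/negP => /andP[_ /disjointFr] /(_ e eIO); by rewrite (th _ sgc sgj).
Qed.

(** Edges of [I] touch no free block, hence are left alone. If the new tour uses an edge of [O],
    either this edge has an end in a free block and lies in its hull, which freeness forbids, or the
    old tour uses it as well. *)
Lemma free_change I O sg sg' : sg \in cube -> sg' \in cube ->
  (forall j, ~~ free I O j -> sg' j = sg j) ->
  respects I O (tour_of sg) -> respects I O (tour_of sg').
Proof.
move=> sgc sgc' E /andP[/fintype.subsetP Isg Osg].
set pi := perm_prod sg in Isg Osg; set pi' := perm_prod sg'.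
have same x : (forall j, free I O j -> x \notin block j) -> pi' x = pi x.
  move=> h; have [j xj|xn] := pickP (fun j => x \in block j).
    have nf : ~~ free I O j by apply/negP => /h; rewrite xj.
    rewrite /pi /pi' (perm_prod_in block_disj sgc xj).
    by rewrite (perm_prod_in block_disj sgc' xj) E.
  have xo j : x \notin block j by rewrite xn.
  by rewrite /pi /pi' (perm_prod_out sgc xo) (perm_prod_out sgc' xo).
have ends (t : {perm 'I_n}) (e : edge n) : exists x y,
    src e = t x /\ tgt e = t y.
  by exists ((t^-1)%g (src e)), ((t^-1)%g (tgt e)); rewrite !permKV.
apply/andP; split.
- apply/fintype.subsetP => e eI; have [x [y [ex ey]]] := ends pi e.
  have eF := Isg e eI; move: (eF).
  rewrite (@mem_conj pi e x y); last by left.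
  have out z : (z = x \/ z = y) -> pi' z = pi z.
    move=> zxy; apply: same => j /andP[/forall_inP /(_ e eI) + _].
    rewrite /touches ex ey !(perm_prod_mem block_disj sgc) => /norP[hx hy].
    by case: zxy => ->.
  by rewrite (@mem_conj pi' e x y) // ex ey !out; [left| right| left].
- rewrite disjoint_subset; apply/fintype.subsetP => e eO; rewrite inE.
  apply/negP => eF.
  have [x [y [ex ey exy]]] : exists x y, [/\ s x = y, x != y &
      (src e = pi' x /\ tgt e = pi' y) \/ (src e = pi' y /\ tgt e = pi' x)].
    have [x [y [ex ey]]] := ends pi' e; move: (eF).
    have xy : x != y by apply: contraNneq (edge_neq e) => xy; rewrite ex ey xy.
    rewrite (@mem_conj pi' e x y); last by left.
    case/orP => /eqP h; first by exists x, y; split => //; left.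
    by exists y, x; split; rewrite // 1?eq_sym //; right.
  have [j fj|nfj] := pickP (fun j => free I O j && ((x \in block j) || (y \in block j))).
    case/andP: fj => /andP[_ /forall_inP /(_ e eO) hj] xyB.
    have inh z : z \in block j -> pi' z \in block j.
      by rewrite (perm_prod_mem block_disj sgc').
    have h : (pi' x \in block j) && (pi' y \in hull j) ||
             (pi' y \in block j) && (pi' x \in hull j).
      rewrite !(perm_prod_mem block_disj sgc').
      have [xB|xB] := boolP (x \in block j) => /=.
        have [yB|yB] := boolP (y \in block j) => /=.
          by rewrite finset.in_setU inh.
        rewrite orbF -ex; rewrite -ex in yB; rewrite (exit_block xB yB).
        rewrite (perm_prod_out sgc' (exit_out j)).
        by rewrite !finset.inE eqxx !orbT.
      move: xyB; rewrite (negbTE xB) /= => yB; rewrite yB /=.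
      have yu : s x = u j by apply: enter_block; rewrite ?ex.
      have -> : x = pre j by apply: (@perm_inj _ s); rewrite s_pre.
      rewrite (perm_prod_out sgc' (pre_out j)).
      by rewrite !finset.inE eqxx !orbT.
    case: exy => -[e1 e2]; move: hj; rewrite /in_hull e1 e2.
      by rewrite h.
    by rewrite orbC h.
  have eF' : e \in pedges (s ^ pi)%g.
    have sx z : (z = x \/ z = y) -> pi' z = pi z.
      move=> zxy; apply: same => j fj; have := nfj j; rewrite fj /= => /negbT.
      by case/norP; case: zxy => ->.
    rewrite (@mem_conj pi e x y) ?ex ?eqxx // -!sx; [by []| right| left] => //.
  by have := disjointFr Osg eO; rewrite eF'.
Qed.

End TourCube.

(** * Branch-and-bound trees *)

Section Branching.
Variables (n : nat) (t : labeled_tree n).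
Hypothesis ht : branching_tree t.

Lemma childE (a v : vertex t) : (v \in children a) = (parent v == Some a).
Proof. by rewrite inE. Qed.

Lemma child_unique (a b v : vertex t) :
  v \in children a -> v \in children b -> a = b.
Proof. by rewrite !inE => /eqP -> /eqP [->]. Qed.

Definition ancestor (v : vertex t) : vertex t := odflt (Defs.root t) (parent v).

Lemma ancestor_root v : exists k, iter k ancestor v == Defs.root t.
Proof.
case: ht => [[hroot hcon]] _ _ _ _.
have /connectP[p pp ->] := hcon v.
elim: p v pp => [|a p IH] v /=; first by exists 0%N; rewrite /=.
case/andP => /eqP va /IH[k kE]; exists k.+1.
by rewrite iterSr /ancestor va.
Qed.

Definition depth v := ex_minn (ancestor_root v).

Lemma depth_child a v : v \in children a -> (depth a < depth v)%N.
Proof.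
case: ht => [[hroot _]] _ _ _ _.
rewrite inE => /eqP va; rewrite /depth; case: ex_minnP => k kE kmin.
case: ex_minnP => -[|i] iE imin.
  by move: iE => /= vr; have := hroot v; rewrite va vr.
rewrite ltnS; apply: kmin.
by move: iE; rewrite iterSr {2}/ancestor va.
Qed.

(** A deepest vertex without tours is no leaf of the unpruned tree, since leaves have exactly one
    tour; and its children would be deeper vertices without tours. Hence the heuristic returns a
    tour at every vertex. *)
Lemma vertex_tours_neq0 (v : vertex t) : vertex_tours v != finset.set0.
Proof.
case: ht => _ _ _ hcov hleaf.
apply/negP => /eqP v0.
case: (@arg_maxnP _ v (fun v => vertex_tours v == finset.set0) depth).
  exact/eqP.
move=> a /eqP a0 amax.
have [c0|[c cc]] := set_0Vmem (children a).
  by have := hleaf a c0; rewrite a0 cards0.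
have /(_ _) c0 := hcov a.
have cs : vertex_tours c \subset vertex_tours a.
  by rewrite c0 ?(finset.bigcup_sup c) //; apply/set0Pn; exists c.
have /amax : vertex_tours c == finset.set0 by rewrite a0 finset.subset0 in cs.
by rewrite /= leqNgt depth_child.
Qed.

Variables (R : realType) (w : edge n -> R).
Variables (H : {set edge n} -> {set edge n} -> {set edge n}).
Variable LB : {set edge n} -> {set edge n} -> \bar R.
Hypothesis hH : forall I O, tours I O != finset.set0 -> H I O \in tours I O.

Lemma incumbent_ge (E : {set vertex t}) (b : R) :
  (forall F, is_tour F -> b <= total_weight w F) ->
  (b%:E <= incumbent w H E)%E.
Proof.
move=> hb; rewrite /incumbent.
elim/big_ind: _ => [|x y bx by_|v _]; first exact: leey.
  by rewrite le_min bx by_.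
rewrite lee_fin hb //.
by have := hH (vertex_tours_neq0 v); rewrite inE => /andP[].
Qed.

Lemma bb_state_parent D E : @bb_state R n w t H LB D E ->
  forall v a, v \in D -> v \in children a -> a \in D.
Proof.
case: ht => [[hroot _]] _ _ _ _.
elim=> [v a|D' E' v0 _ IH _|D' E' v0 _ IH v0E v0D _ v a].
- rewrite finset.in_set1 => /eqP -> ra.
  have := hroot (Defs.root t); rewrite eqxx => /eqP r0.
  by move: ra; rewrite childE r0.
- exact: IH.
- rewrite !finset.in_setU => /orP[vD va|vv0 va]; first by rewrite (IH v).
  by rewrite (child_unique va vv0); move: v0D; rewrite inE => /andP[->].
Qed.

(** Branching replaces a leaf by its children, whose tours cover those of the leaf; the other leaves
    stay leaves, since a vertex has a single parent. *)
Lemma leaves_cover D E : @bb_state R n w t H LB D E ->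
  forall F, F \in tours finset.set0 finset.set0 ->
  exists2 v, v \in leaves D & F \in vertex_tours v.
Proof.
case: (ht) => [[hroot _]] [I0 O0] _ hcov _ hbb F hF.
elim: hbb => [|//|D' E' v hD' IH vE vl _].
  exists (Defs.root t); last by rewrite /vertex_tours I0 O0.
  rewrite inE finset.set11 /= disjoint_sym disjoints1 childE.
  by have := hroot (Defs.root t); rewrite eqxx => /eqP ->.
(* Branching at a leaf of the unpruned tree adds nothing. *)
have [c0|[c1 cc1]] := set_0Vmem (children v).
  by rewrite c0 finset.setU0.
have vD : v \in D' by move: vl; rewrite inE => /andP[].
have cD : [disjoint children v & D'] by move: vl; rewrite inE => /andP[].
case: IH => a; rewrite inE => /andP[aD aDc] Fa.
have [av|av] := eqVneq a v; last first.
  exists a => //; rewrite inE finset.in_setU aD /=.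
  rewrite disjoint_subset; apply/fintype.subsetP => x xa.
  rewrite inE finset.in_setU (disjointFr aDc xa) /=; apply/negP => xv.
  by rewrite (child_unique xa xv) eqxx in av.
move: Fa; rewrite av hcov; last by apply/set0Pn; exists c1.
case/bigcupP => c cc Fc; exists c => //.
have cD' : c \notin D' by rewrite (disjointFr cD cc).
rewrite inE finset.in_setU cc orbT /= disjoint_subset.
apply/fintype.subsetP => x xc; rewrite inE finset.in_setU.
apply/norP; split; apply/negP => h.
  by rewrite (bb_state_parent hD' h xc) in cD'.
by rewrite (child_unique xc h) vD in cD'.
Qed.

End Branching.

(** * Counting arrangements and leaves *)

Section CubeCount.
Variables (n m : nat) (s : {perm 'I_n}) (G : finType).
Variables (u : G -> 'I_n) (S : G -> {set 'I_n}).
Hypotheses (m2 : (2 < m)%N) (mn : (m.+2 < n)%N) (hs : one_cycle s).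
Hypothesis Sdisj : forall j k x, x \in S j -> x \in S k -> j = k.
Hypothesis posS : forall j i, (i <= m.+1)%N -> pos s u j i \in S j.
Variable R : realType.

Notation B := (block m s u).
Notation cube := (perm_cube B).
Notation tour_of sg := (pedges (s ^ perm_prod sg)%g).
Notation free := (free m s u).
Let Bdisj := block_disj Sdisj posS.
Let M := (m.+1)`!.

Definition unfree I O : {set G} := [set j | ~~ free I O j]%SET.

Lemma card_family_prod (A : G -> {set {perm 'I_n}}) :
  #|family A| = (\prod_j #|A j|)%N.
Proof. by rewrite card_family /image_mem foldrE big_map big_enum. Qed.

Lemma card_sym_block j : #|[set p | perm_on (B j) p]%SET| = M.
Proof.
by rewrite cardsE (card_perm (B j)) (card_block u mn hs).
Qed.

Lemma card_cube : #|cube| = (M ^ #|G|)%N.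
Proof.
rewrite card_family_prod (eq_bigr (fun=> M)) ?prod_nat_const //.
by move=> j _; rewrite card_sym_block.
Qed.

(** Each constrained gadget loses at least one of its [M] arrangements, which is a factor
    [1 - 1/M <= exp (- 1/M)]. *)
Lemma card_cube_respects I O :
  #|[set sg in cube | respects I O (tour_of sg)]%SET|%:R <=
  (M ^ #|G|)%:R * expR (- (#|unfree I O|%:R / M%:R)) :> R.
Proof.
have M0 : 0 < M%:R :> R by rewrite ltr0n fact_gt0.
have /fin_all_exists[bad badP] : forall j : G, exists t : {perm 'I_n},
    ~~ free I O j -> perm_on (B j) t /\ forall sg, sg \in cube -> sg j = t ->
      ~~ respects I O (tour_of sg).
  move=> j; have [fj|nfj] := boolP (free I O j); first by exists 1%g.
  by have [t ht] := not_free_state m2 mn hs Sdisj posS nfj; exists t.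
pose A j : {set {perm 'I_n}} := if free I O j then [set p | perm_on (B j) p]%SET
  else ([set p | perm_on (B j) p] :\ bad j)%SET.
have sub : [set sg in cube | respects I O (tour_of sg)]%SET \subset family A.
  apply/fintype.subsetP => sg; rewrite inE => /andP[sgc sgr].
  apply/familyP => j; rewrite /A; case: ifPn => [_|nfj].
    by have /familyP := sgc; apply.
  rewrite finset.in_setD1; have /familyP/(_ j) -> := sgc; rewrite andbT.
  apply/negP => /eqP h; have [_ /(_ sg sgc h)] := badP j nfj.
  by rewrite sgr.
apply: le_trans (_ : #|family A|%:R <= _); first by rewrite ler_nat subset_leq_card.
rewrite card_family_prod natr_prod.
have -> : (M ^ #|G|)%:R * expR (- (#|unfree I O|%:R / M%:R)) =
    \prod_j (M%:R * expR (- ((~~ free I O j)%:R / M%:R))) :> R.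
  rewrite big_split /= prodr_const natrX; congr (_ * _).
  rewrite -expR_sum; congr expR.
  rewrite sumrN -mulr_suml; congr (- (_ / _)).
  rewrite -natr_sum; congr (_%:R).
  by rewrite -sum1_card big_mkcond /=; apply: eq_bigr => j _; rewrite inE; case: (~~ _).
apply: ler_prod => j _; rewrite ler0n /= /A; case: ifPn => [_|nfj] /=.
  by rewrite mul0r oppr0 expR0 mulr1 card_sym_block.
have [bB _] := badP j nfj.
have := cardsD1 (bad j) [set p | perm_on (B j) p]%SET.
rewrite card_sym_block inE bB add1n => ME.
have -> : #|([set p | perm_on (B j) p] :\ bad j)%SET|%:R = M%:R - 1 :> R.
  by rewrite ME -natr1 addrK.
have := expR_ge1Dx (- (1%:R / M%:R) : R).
move=> h; apply: le_trans (_ : M%:R * (1 - 1 / M%:R) <= _); last by rewrite ler_pM2l.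
by rewrite mulrBr mulr1 mulrCA divff ?gt_eqF // mulr1.
Qed.

End CubeCount.

Section LeafCount.
Variables (n m : nat) (s : {perm 'I_n}) (G : finType).
Variables (u : G -> 'I_n) (S : G -> {set 'I_n}).
Hypotheses (m2 : (2 < m)%N) (mn : (m.+2 < n)%N) (hs : one_cycle s).
Hypothesis Sdisj : forall j k x, x \in S j -> x \in S k -> j = k.
Hypothesis posS : forall j i, (i <= m.+1)%N -> pos s u j i \in S j.
Variables (R : realType) (dd : 'I_n -> 'I_n -> R) (Delta gamma : R).
Hypothesis dsym : forall x y, dd x y = dd y x.
Hypothesis dtri : forall x y z, dd x z <= dd x y + dd y z.
Hypothesis dxx : forall x, dd x x = 0.
Hypothesis diamS : forall j x y, x \in S j -> y \in S j -> dd x y <= Delta.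
Hypothesis sopt : forall t, one_cycle t ->
  \sum_x dd x (s x) <= \sum_x dd x (t x).
Hypotheses (D0 : 0 <= Delta) (g0 : 0 < gamma).

Notation B := (block m s u).
Notation cube := (perm_cube B).
Notation tour_of sg := (pedges (s ^ perm_prod sg)%g).
Notation free := (free m s u).
Notation unfree := (unfree m s u).
Notation M := (m.+1)`!.
Let Bdisj := block_disj Sdisj posS.

(** All that is needed of a lower bound: at a node admitting the tour [t], it stays below the length
    of [t] by [gamma] for each free gadget that [t] crosses in the order of [s]. *)
Variable LB : {set edge n} -> {set edge n} -> \bar R.
Hypothesis hLB : forall I O t (J : {set G}), one_cycle t ->
  (forall j i, j \in J -> (i <= m.+1)%N -> iter i t (u j) = pos s u j i) ->
  (forall j, j \in J -> free I O j) ->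
  respects I O (pedges t) ->
  (LB I O <= (\sum_x dd x (t x) - gamma * #|J|%:R)%:E)%E.

Let n2 : (2 < n)%N. Proof. lia. Qed.

(** The edge from [x] to [s x] becomes the edge between their images; by the triangle inequality, it
    grows by at most the displacements of its two ends. Only points of the blocks in [N] move, each
    by at most [Delta], and each is an end of two edges. *)
Lemma cost_conj sg (N : {set G}) : sg \in cube -> (forall j, j \notin N -> sg j = 1%g) ->
  \sum_x dd x ((s ^ perm_prod sg)%g x) <=
  \sum_x dd x (s x) + #|N|%:R * ((m.+1)%:R * Delta *+ 2).
Proof.
move=> sgc sgN; set pi := perm_prod sg.
rewrite (reindex_inj (@perm_inj _ pi)) /=.
have : \sum_x dd x (pi x) <= #|N|%:R * ((m.+1)%:R * Delta).
  have pix x : x \notin (\bigcup_(j in N) B j)%SET -> pi x = x.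
    move=> xN; have [j xj|xn] := pickP (fun j => x \in B j).
      rewrite /pi (perm_prod_in Bdisj sgc xj) sgN ?perm1 //.
      by apply: contra xN => jN; apply/bigcupP; exists j.
    by rewrite /pi (perm_prod_out sgc) // => j; rewrite xn.
  rewrite (bigID (mem (\bigcup_(j in N) B j)%SET)) /= [X in _ + X]big1 ?addr0; last first.
    by move=> x /pix ->; rewrite dxx.
  apply: le_trans (_ : \sum_(x in (\bigcup_(j in N) B j)%SET) Delta <= _).
    apply: ler_sum => x /bigcupP[j jN xj].
    apply: (@diamS j); apply: (sub_blockS posS) => //.
    by rewrite /pi (perm_prod_mem Bdisj sgc).
  rewrite sumr_const -[X in X <= _]mulr_natl mulrA; apply: ler_wpM2r => //.
  rewrite -natrM ler_nat.
  apply: leq_trans (_ : \sum_(j in N) m.+1 <= _)%N; last by rewrite sum_nat_const.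
  elim/big_rec2: _ => [|j k A jN Ak]; first by rewrite cards0.
  apply: leq_trans (leq_card_setU _ _) _; rewrite (card_block u mn hs).
  by rewrite leq_add2l.
move=> h.
apply: le_trans (_ : \sum_x (dd x (pi x) + dd x (s x) + dd (s x) (pi (s x))) <= _).
  apply: ler_sum => x _; rewrite permJ.
  apply: le_trans (dtri _ (s x) _) _; rewrite lerD2r.
  by rewrite [dd x (pi x)]dsym; exact: dtri.
have E : \sum_x dd (s x) (pi (s x)) = \sum_x dd x (pi x).
  by rewrite [RHS](reindex_inj (@perm_inj _ s)).
rewrite !big_split /= E.
rewrite mulr2n mulrDr; lra.
Qed.

Let pow_sg (sg : {ffun G -> {perm 'I_n}}) j p : {ffun G -> {perm 'I_n}} :=
  [ffun k => if k == j then p else sg k].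

Lemma tours_of I O (sg : {ffun G -> {perm 'I_n}}) :
  (tour_of sg \in tours I O) = respects I O (tour_of sg).
Proof. by rewrite inE perm_tour //; exact: one_cycle_conj. Qed.

(** Let [N] be the set of constrained gadgets. The tour of [sg1], which is arranged as in [sg] on
    [N] and as in [s] elsewhere, still respects the node. So the bound is at most [OPT + 2 (m+1)
    Delta #|N| - gamma (#|G| - #|N|)]; as it is at least [OPT], the claim follows. *)
Lemma leaf_unfree (t : labeled_tree n) (v : vertex t) sg :
  branching_tree t -> sg \in cube -> tour_of sg \in vertex_tours v ->
  ((\sum_x dd x (s x))%:E <= LB (Defs.incl v) (Defs.excl v))%E \/ children v = finset.set0 ->
  gamma * #|G|%:R <=
  (#|unfree (Defs.incl v) (Defs.excl v)|)%:R * ((m.+1)%:R * Delta *+ 2 + gamma).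
Proof.
move=> ht sgc; rewrite /vertex_tours tours_of => sgr hv.
set I := Defs.incl v in sgr hv *; set O := Defs.excl v in sgr hv *.
set N := unfree I O.
have NG : (#|N| <= #|G|)%N by rewrite max_card.
case: hv => [hv|hv]; last first.
  (* A leaf of the unpruned tree admits one tour only. A free gadget could be arranged both with and
     without the edge from [pre j] to [u j], giving two tours; hence no gadget is free. *)
  have -> : #|N| = #|G|.
    apply/eqP; rewrite eqn_leq NG /=; apply/subset_leq_card/fintype.subsetP => j _.
    rewrite inE; apply/negP => fj.
    have pu : pre s u j != u j.
      by rewrite -{1}(s_pre s u j) eq_sym one_cycle_neq // ltnW.
    have [e eE] := edge_ends pu.
    have te : touches m s u j e.
      have uB : u j \in B j by exact: (@pos_block _ _ _ _ u j 0).
      by rewrite /touches; case: eE => -[-> ->]; rewrite uB ?orbT.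
    have [p [pB ep]] := avoid_state m2 mn hs Sdisj posS te.
    have powc q : perm_on (B j) q -> pow_sg sg j q \in cube.
      move=> qB; apply/perm_cubeP => k; rewrite ffunE; case: eqP => [->//|_].
      by have /perm_cubeP := sgc; apply.
    have powr q : perm_on (B j) q -> tour_of (pow_sg sg j q) \in vertex_tours v.
      move=> qB; rewrite /vertex_tours tours_of.
      apply: (free_change m2 mn hs Sdisj posS sgc (powc q qB) _ sgr) => k nfk.
      by rewrite ffunE; case: eqP => // kj; rewrite kj fj in nfk.
    have [F FE] : exists F, vertex_tours v = [set F]%SET.
      by case: ht => _ _ _ _ /(_ v hv) /eqP/cards1P.
    have := powr _ (perm_on1 _); have := powr _ pB; rewrite FE !finset.in_set1.
    move=> /eqP Fp /eqP F1.
    have := ep _ (powc _ pB); rewrite ffunE eqxx Fp -F1 => /(_ erefl).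
    rewrite (@mem_conj _ _ _ _ (pre s u j) (u j)) ?s_pre ?eqxx //.
    rewrite (perm_prod_out (powc _ (perm_on1 _))); last first.
      exact: pre_out m2 mn hs Sdisj posS j.
    rewrite (perm_prod_in Bdisj (powc _ (perm_on1 _)) (j := j)).
      by rewrite ffunE eqxx perm1.
    exact: (@pos_block _ _ _ _ u j 0).
  rewrite mulrDr addrC [gamma * _]mulrC lerDl mulr_ge0 // mulrn_wge0 // mulr_ge0 //.
pose sg1 : {ffun G -> {perm 'I_n}} := [ffun j => if j \in N then sg j else 1%g].
have sg1c : sg1 \in cube.
  apply/perm_cubeP => k; rewrite ffunE; case: ifP => _; last exact: perm_on1.
  by have /perm_cubeP := sgc; apply.
have sg1r : respects I O (tour_of sg1).
  apply: (free_change m2 mn hs Sdisj posS sgc sg1c _ sgr) => k nfk.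
  by rewrite ffunE inE nfk.
have J_free j : j \in (~: N)%SET -> free I O j by rewrite finset.in_setC inE negbK.
have run j i : j \in (~: N)%SET -> (i <= m.+1)%N ->
    iter i (s ^ perm_prod sg1)%g (u j) = pos s u j i.
  move=> jN im.
  have fixB x : x \in B j -> perm_prod sg1 x = x.
    move=> xB; rewrite (perm_prod_in Bdisj sg1c xB) ffunE.
    by move: jN; rewrite finset.in_setC => /negbTE ->; rewrite perm1.
  have fixp k : (k <= m.+1)%N -> perm_prod sg1 (pos s u j k) = pos s u j k.
    rewrite leq_eqVlt => /orP[/eqP ->|km]; last by rewrite fixB // pos_block.
    by rewrite (perm_prod_out sg1c) // => l; exact: (exit_out m2 mn hs Sdisj posS).
  elim: i im => [|i IH] im; first by rewrite /pos /=.
  rewrite iterS (IH (ltnW im)).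
  have := permJ s (perm_prod sg1) (pos s u j i).
  by rewrite (fixp i (ltnW im)) => ->; exact: (fixp i.+1 im).
have h1 := hLB (one_cycle_conj _ hs) run J_free sg1r.
have h2 : \sum_x dd x ((s ^ perm_prod sg1)%g x) <=
  \sum_x dd x (s x) + #|N|%:R * ((m.+1)%:R * Delta *+ 2).
  by apply: cost_conj => // j /negbTE jN; rewrite ffunE jN.
have := le_trans hv h1; rewrite lee_fin => h3.
have : #|(~: N)%SET|%:R = #|G|%:R - #|N|%:R :> R.
  by rewrite cardsCs finset.setCK natrB // subset_leq_card.
move=> E; rewrite E in h3; nra.
Qed.

(** Arrangements are counted rather than tours, so that it does not matter whether distinct
    arrangements give distinct tours. *)
Theorem leaves_ge (t : labeled_tree n)
    (H : {set edge n} -> {set edge n} -> {set edge n}) (D : {set vertex t}) :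
  branching_tree t ->
  (forall I O, tours I O != finset.set0 -> H I O \in tours I O) ->
  pruned_tree (edge_weight dd) H LB D ->
  expR (gamma / ((m.+1)%:R * Delta *+ 2 + gamma) / M%:R * #|G|%:R) <= #|leaves D|%:R.
Proof.
move=> ht hH [hD hDl].
have M0 : 0 < M%:R :> R by rewrite ltr0n fact_gt0.
set K := (m.+1)%:R * Delta *+ 2 + gamma.
have K0 : 0 < K by rewrite ltr_wpDl // mulrn_wge0 // mulr_ge0.
have opt F : is_tour F -> \sum_x dd x (s x) <= total_weight (edge_weight dd) F.
  case/(tour_perm n2) => q hq ->.
  by rewrite total_weight_pedges //; [exact: sopt|move=> x; exact: one_cycle_neq (ltnW n2) hq|move=> x; exact: one_cycle_neq2].
have binc := incumbent_ge ht hH D opt.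
set a := gamma / K / M%:R * #|G|%:R.
have count v : v \in leaves D ->
    #|[set sg in cube | tour_of sg \in vertex_tours v]%SET|%:R <=
    (M ^ #|G|)%:R * expR (- a) :> R.
  move=> vl; set C := finset _.
  have [->|[sg]] := set_0Vmem C; first by rewrite cards0 mulr_ge0 ?expR_ge0.
  rewrite inE => /andP[sgc sgv].
  have hv : ((\sum_x dd x (s x))%:E <= LB (Defs.incl v) (Defs.excl v))%E \/ children v = finset.set0.
    by case: (hDl v vl) => [h|->]; [left; exact: le_trans binc h|right].
  have hN := leaf_unfree ht sgc sgv hv.
  have -> : C = [set sg in cube | respects (Defs.incl v) (Defs.excl v) (tour_of sg)]%SET.
    apply/setP => sg'; rewrite [LHS]inE [RHS]inE; congr (_ && _); exact: tours_of.
  apply: le_trans (card_cube_respects m2 mn hs Sdisj posS R _ _) _.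
  rewrite ler_wpM2l // ler_expR lerN2 /a mulrAC ler_pM2r ?invr_gt0 //.
  by rewrite mulrAC ler_pdivrMr.
have tot : (M ^ #|G|)%:R <= #|leaves D|%:R * ((M ^ #|G|)%:R * expR (- a)) :> R.
  rewrite -(card_cube u mn hs).
  apply: le_trans (_ : \sum_(v in leaves D)
      #|[set sg in cube | tour_of sg \in vertex_tours v]%SET|%:R <= _); last first.
    rewrite mulr_natl -sumr_const; apply: ler_sum => v vl.
    by rewrite (card_cube u mn hs); exact: count.
  rewrite -natr_sum ler_nat.
  apply: leq_trans (_ : #|(\bigcup_(v in leaves D)
     [set sg in cube | tour_of sg \in vertex_tours v])%SET| <= _)%N.
    apply/subset_leq_card/fintype.subsetP => sg sgc.
    have ts : tour_of sg \in tours finset.set0 finset.set0.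
      rewrite tours_of /respects finset.sub0set /=.
      by rewrite disjoint_subset; apply/fintype.subsetP => e; rewrite inE.
    have [v vl hv] := leaves_cover ht hD ts.
    by apply/bigcupP; exists v => //; rewrite inE sgc.
  elim/big_rec2: _ => [|v k A vl Ak]; first by rewrite cards0.
  by apply: leq_trans (leq_card_setU _ _) _; rewrite leq_add2l.
have MG : 0 < (M ^ #|G|)%:R :> R by rewrite ltr0n expn_gt0 fact_gt0.
move: tot; rewrite mulrCA -[X in X <= _]mulr1 ler_pM2l //.
by rewrite -ler_pdivrMr ?expR_gt0 // expRN invrK mul1r.
Qed.

End LeafCount.

Lemma in_bigcup_seq (I : eqType) (T : finType) (r : seq I) (F : I -> {set T}) e :
  (e \in (\bigcup_(i <- r) F i)%SET) = has (fun i => e \in F i) r.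
Proof.
elim: r => [|i r IH] /=; first by rewrite big_nil finset.in_set0.
by rewrite big_cons finset.in_setU IH.
Qed.

Lemma iter_perm_inj (T : finType) (t : {perm T}) k : injective (iter k t).
Proof. by elim: k => //= k IH x y /perm_inj /IH. Qed.

Section OrbitFactor.
Variables (n g : nat) (q : {perm 'I_n}).
Hypothesis qg : forall x, (maxn 3 g <= fingraph.order q x)%N.

Lemma next_orbit x y : next (orbit q x) y = if y \in orbit q x then q y else y.
Proof.
case: ifP => yx; last by rewrite next_nth yx.
have fc : fcycle q (orbit q x) := cycle_orbit (@perm_inj _ q) x.
by have /eqP -> := next_cycle fc yx.
Qed.

Lemma orbits_two_factor : two_factor g (pedges q).
Proof.
pose rs := [seq x <- enum 'I_n | froots q x].
have csym := fconnect_sym (@perm_inj _ q).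
exists [seq orbit q x | x <- rs]; split.
- apply/allP => c /mapP[x _ ->]; rewrite /is_cycle orbit_uniq size_orbit /=.
  by have := qg x; rewrite geq_max.
- have : uniq rs by rewrite filter_uniq // enum_uniq.
  have : all (froots q) rs by apply/allP => x; rewrite mem_filter => /andP[].
  elim: rs => //= r rs IH /andP[rr ars] /andP[rrs Urs].
  rewrite cat_uniq orbit_uniq IH // andbT /=.
  apply/hasPn => y /flattenP[c /mapP[r' r'rs ->]].
  rewrite -!fconnect_orbit => r'y; apply/negP => ry.
  have : fconnect q r r' by rewrite (connect_trans ry) // csym.
  have /allP/(_ r' r'rs) := ars; rewrite -(root_connect csym).
  move=> /eqP -> /eqP; move/eqP: rr => -> rE.
  by rewrite rE r'rs in rrs.
- move=> x; apply/flattenP; exists (orbit q (fingraph.root (frel q) x)).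
    apply/mapP; exists (fingraph.root (frel q) x) => //.
    by rewrite mem_filter mem_enum andbT; exact: roots_root.
  by rewrite -fconnect_orbit csym connect_root.
- apply/setP => e; rewrite big_map inE.
  apply/idP/idP => [h|].
    have [x [xr [xs xt]]] : exists x, x \in rs /\ (src e \in orbit q x /\ tgt e \in orbit q x).
      exists (fingraph.root (frel q) (src e)); rewrite mem_filter mem_enum andbT roots_root //.
      split=> //; rewrite -!fconnect_orbit csym connect_root; split=> //.
      rewrite csym; apply: connect_trans (_ : fconnect q (tgt e) (src e)) (connect_root _ _).
      by case/orP: h => /eqP <-; rewrite ?fconnect1 // csym fconnect1.
    by rewrite in_bigcup_seq; apply/hasP; exists x; rewrite // inE !next_orbit xs xt.
  rewrite in_bigcup_seq => /hasP[x _]; rewrite inE !next_orbit.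
  have ne := edge_neq e.
  case: ifP => _; case: ifP => _ //; first by rewrite [tgt e == _]eq_sym (negbTE ne) orbF => ->.
  - by rewrite (negbTE ne) /= => ->; rewrite orbT.
  - by rewrite (negbTE ne) eq_sym (negbTE ne).
Qed.

End OrbitFactor.

(** * Gain of the relaxations *)

Section TwoFactorBound.
Variables (n m g : nat) (s : {perm 'I_n}) (G : finType).
Variables (u : G -> 'I_n) (S : G -> {set 'I_n}).
Hypotheses (m2 : (2 < m)%N) (mn : (m.+2 < n)%N) (hs : one_cycle s).
Hypothesis gm : (g <= m)%N.
Hypothesis Sdisj : forall j k x, x \in S j -> x \in S k -> j = k.
Hypothesis posS : forall j i, (i <= m.+1)%N -> pos s u j i \in S j.
Hypothesis cardS : forall j, (2 * m <= #|S j|)%N.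
Variables (R : realType) (dd : 'I_n -> 'I_n -> R) (gamma : R).
Hypothesis dsym : forall x y, dd x y = dd y x.
Hypothesis gain : forall j,
  dd (u j) (pos s u j m.+1) + dd (pos s u j m) (pos s u j 1) + gamma <=
  dd (u j) (pos s u j 1) + dd (pos s u j m) (pos s u j m.+1).

Variables (I O : {set edge n}) (t : {perm 'I_n}) (J : {set G}).
Hypothesis ht : one_cycle t.
Hypothesis run : forall j i, j \in J -> (i <= m.+1)%N ->
  iter i t (u j) = pos s u j i.
Hypothesis Jfree : forall j, j \in J -> free m s u I O j.
Hypothesis tIO : respects I O (pedges t).

Notation B := (block m s u).
Notation L := (lobe m s u).
Notation p := (pos s u).
Let Bdisj := block_disj Sdisj posS.

Lemma t_pos j i : j \in J -> (i <= m)%N -> t (p j i) = p j i.+1.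
Proof. by move=> jJ im; rewrite -!run // ltnW. Qed.

(* The transposition of the first point of the run with its exit closes the
   run through the lobe into a cycle of its own. *)
Definition swaps : {ffun G -> {perm 'I_n}} :=
  [ffun j => if j \in J then tperm (p j 1) (p j m.+1) else 1%g].

Definition cut : {perm 'I_n} := (t * perm_prod swaps)%g.

(** The exit lies outside the block, so the supports of the swaps are kept disjoint by the sets
    [S j] and not by the blocks. *)
Lemma swaps_cube : swaps \in perm_cube S.
Proof.
apply/perm_cubeP => j; rewrite ffunE; case: ifP => _; last exact: perm_on1.
apply/fintype.subsetP => z; rewrite inE.
by case: tpermP => [->|->|]; rewrite ?eqxx // posS.
Qed.

Lemma cutE x : (forall j, j \in J -> x \notin B j) -> cut x = t x.
Proof.
move=> xB; rewrite permM.
have [j xj|xn] := pickP (fun j => t x \in S j); last first.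
  by rewrite (perm_prod_out swaps_cube) // => j; rewrite xn.
rewrite (perm_prod_in Sdisj swaps_cube xj) ffunE; case: ifPn => jJ; last by rewrite perm1.
rewrite tpermD //; apply/eqP => h.
  have := xB _ jJ; move: h; rewrite -(@t_pos j 0) // => /perm_inj <-.
  by rewrite pos_block.
have := xB _ jJ; move: h; rewrite -(@t_pos j m) // => /perm_inj <-.
by rewrite pos_block.
Qed.

Lemma cut_pos j i : j \in J -> (0 < i < m)%N -> cut (p j i) = p j i.+1.
Proof.
move=> jJ /andP[i0 im]; rewrite permM t_pos // 1?ltnW //.
rewrite (perm_prod_in Sdisj swaps_cube (posS j (ltnW _))) // ffunE jJ.
by rewrite tpermD // pos_eq //; lia.
Qed.

Lemma cut_u j : j \in J -> cut (u j) = p j m.+1.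
Proof.
move=> jJ; rewrite permM -[u j]/(p j 0) t_pos //.
by rewrite (perm_prod_in Sdisj swaps_cube (posS j _)) // ffunE jJ tpermL.
Qed.

Lemma cut_last j : j \in J -> cut (p j m) = p j 1.
Proof.
move=> jJ; rewrite permM t_pos //.
by rewrite (perm_prod_in Sdisj swaps_cube (posS j _)) // ffunE jJ tpermR.
Qed.

Lemma cut_hull j x : j \in J -> x \in B j -> cut x \in hull m s u j.
Proof.
move=> jJ /blockP[i im ->]; rewrite /hull.
have [->|i0] := posnP i; first by rewrite cut_u // !finset.inE eqxx !orbT.
move: im; rewrite leq_eqVlt => /orP[/eqP ->|im].
  by rewrite cut_last // finset.in_setU pos_block //; lia.
by rewrite cut_pos ?i0 // finset.in_setU pos_block.
Qed.

Lemma cut_respects : respects I O (pedges cut).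
Proof.
case/andP: tIO => /fintype.subsetP It Ot; apply/andP; split.
  apply/fintype.subsetP => e eI; have := It e eI; rewrite !inE.
  have nb x : x = src e \/ x = tgt e -> cut x = t x.
    move=> xe; apply: cutE => j /Jfree/andP[/forall_inP/(_ e eI) + _].
    by rewrite /touches => /norP[]; case: xe => ->.
  by rewrite !nb; [|right|left].
rewrite disjoint_subset; apply/fintype.subsetP => e eO; rewrite inE.
apply/negP => ec.
have [x xe] : exists x, (src e = x /\ tgt e = cut x) \/ (src e = cut x /\ tgt e = x).
  move: ec; rewrite inE => /orP[] /eqP h.
    by exists (src e); left.
  by exists (tgt e); right.
have [j /andP[jJ xj]|nj] := pickP (fun j => (j \in J) && (x \in B j)).
  have /andP[_ /forall_inP/(_ e eO)] := Jfree jJ.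
  have ch := cut_hull jJ xj.
  by rewrite /in_hull; case: xe => -[-> ->]; rewrite xj ch ?orbT.
have et : e \in pedges t.
  rewrite inE; have cx : cut x = t x.
    by apply: cutE => j jJ; have := nj j; rewrite jJ /= => ->.
  by case: xe => -[-> ->]; rewrite cx eqxx ?orbT.
by rewrite (disjointFr Ot eO) in et.
Qed.

Definition cut_lobes : {set 'I_n} := (\bigcup_(j in J) L j)%SET.

Lemma notin_cut_lobes j x : j \in J -> x \notin cut_lobes -> x \notin L j.
Proof. by move=> jJ; apply: contra => xL; apply/bigcupP; exists j. Qed.

Lemma lobe_posE j i : (i < n)%N -> (p j i \in L j) = (0 < i <= m)%N.
Proof.
move=> lin; apply/lobeP/idP => [[k km /eqP]|/andP[i0 im]].
  by rewrite pos_eq //; lia.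
by exists i.-1; rewrite ?prednK.
Qed.

(** Follow [t] from [x] to [y]. Whenever [t] crosses a cut lobe, [cut] jumps from [u j] straight to
    the exit, so the points outside the cut lobes stay on one cycle. *)
Lemma cut_connect_out x y : x \notin cut_lobes -> y \notin cut_lobes -> fconnect cut x y.
Proof.
move=> xL yL; have := iter_findex (ht x y); move: (findex _ _ _) => k kE.
rewrite -kE in yL *; elim/ltn_ind: k {y kE} yL => -[_ _|k IH]; first exact: connect0.
rewrite iterS; set y := iter k t x => tyL.
have [yL|yL] := boolP (y \in cut_lobes); last first.
  apply: connect_trans (IH k _ yL) _ => //.
  have -> : t y = cut y; last exact: fconnect1.
  have [j /andP[jJ yj]|nj] := pickP (fun j => (j \in J) && (y \in B j)); last first.
    by rewrite cutE // => j jJ; have := nj j; rewrite jJ /= => ->.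
  have /negP := notin_cut_lobes jJ yL; have := yj; rewrite block_lobe finset.in_setU1.
  case/orP => [/eqP yu|//] _; exfalso.
  have /negP := notin_cut_lobes jJ tyL; apply.
  by rewrite yu -[u j]/(p j 0) t_pos // lobe_posE //; lia.
case/bigcupP: yL => j jJ /lobeP[i im yE].
have := notin_cut_lobes jJ tyL; rewrite yE t_pos // lobe_posE; last lia.
move=> tL; have im' : i.+1 = m by lia.
have tiE l : (l <= m)%N -> t (p j l) = p j l.+1 by exact: t_pos.
have [km|km] := ltnP k m.
  (* Fewer than [m] steps led to the last point of the lobe, so the start would lie inside the
     lobe. *)
  have xE : x = p j (m - k).
    apply: (@iter_perm_inj _ t k).
    rewrite -/y yE im' -[in RHS](run jJ (i := m - k)); last lia.
    by rewrite -iterD subnKC ?run // ltnW.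
  have /negP[] := notin_cut_lobes jJ xL.
  by rewrite xE lobe_posE; lia.
have uE : iter (k - m) t x = u j.
  apply: (@iter_perm_inj _ t m).
  by rewrite -iterD subnKC // -/y yE im' run.
have uL : u j \notin cut_lobes.
  apply/negP => /bigcupP[j' j'J uj'].
  have jj : j = j'.
    apply: (@Sdisj _ _ (u j)); first exact: (@posS j 0).
    by case/lobeP: uj' => l lm ->; rewrite posS // ltnS ltnW.
  by move: uj'; rewrite -jj -[u j]/(p j 0) lobe_posE //; lia.
have lk : (k - m < k.+1)%N by lia.
have h : fconnect cut x (u j) by rewrite -uE; apply: IH; rewrite ?uE.
by apply: connect_trans h _; rewrite im' -cut_u // fconnect1.
Qed.

(** A cycle of [cut] is a cut lobe, with [m] points, or contains all points outside the cut lobes.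
    At least [2 m - m] of these are left in any [S j] with [j] in [J], which is what [cardS] is
    for. *)
Lemma cut_order x : (m <= fingraph.order cut x)%N.
Proof.
have [xL|xL] := boolP (x \in cut_lobes).
  case/bigcupP: xL => j jJ xj.
  have h1 i : (0 < i <= m)%N -> fconnect cut (p j 1) (p j i).
    elim: i => // -[|i] IH im; first exact: connect0.
    have im' : (0 < i.+1 < m)%N by lia.
    have h : (0 < i.+1 <= m)%N by lia.
    by apply: connect_trans (IH h) _; rewrite -(cut_pos jJ im') fconnect1.
  have cL : #|L j| = m.
    have := card_block u mn hs j; rewrite block_lobe cardsU1.
    rewrite -[u j]/(p j 0) lobe_posE; last lia.
    by rewrite add1n => -[].
  rewrite -cL; apply/subset_leq_card/fintype.subsetP => y yj; rewrite inE.
  case/lobeP: xj => i im ->; case/lobeP: yj => i' im' ->.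
  by apply: connect_trans (h1 i'.+1 _) => //; rewrite fconnect_sym ?h1 //; exact: perm_inj.
have big : (m <= #|~: cut_lobes|)%N.
  have [J0|[j jJ]] := set_0Vmem J.
    by rewrite /cut_lobes J0 big_set0 finset.setC0 cardsT card_ord; lia.
  apply: leq_trans (_ : #|S j :\: L j| <= _)%N.
    have := cardsID (L j) (S j); have := cardS j.
    have : (#|S j :&: L j| <= m)%N.
      apply: leq_trans (subset_leq_card (finset.subsetIr _ _)) _.
      by rewrite cardsE (leq_trans (card_size _)) // size_traject.
    lia.
  apply/subset_leq_card/fintype.subsetP => y /finset.setDP[yS yL].
  rewrite finset.in_setC; apply/negP => /bigcupP[k kJ yk].
  have jk : j = k.
    apply: Sdisj yS _; case/lobeP: yk => i im ->; apply: posS; lia.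
  by rewrite jk yk in yL.
apply: leq_trans big _.
by apply/subset_leq_card/fintype.subsetP => y; rewrite finset.in_setC inE => /(cut_connect_out xL).
Qed.

Lemma cut_cost : \sum_x dd x (cut x) <= \sum_x dd x (t x) - gamma * #|J|%:R.
Proof.
rewrite -subr_ge0 addrAC -sumrB.
have -> : \sum_x (dd x (t x) - dd x (cut x)) =
  \sum_(j in J) \sum_(x in B j) (dd x (t x) - dd x (cut x)).
  rewrite (bigID (mem (\bigcup_(j in J) B j)%SET)) /= [X in _ + X]big1 ?addr0; last first.
    move=> x xB; rewrite cutE ?subrr // => j jJ.
    by apply: contra xB => xB; apply/bigcupP; exists j.
  pose F j := if j \in J then B j else finset.set0.
  have -> : (\bigcup_(j in J) B j = \bigcup_j F j)%SET.
    by rewrite big_mkcond.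
  rewrite partition_disjoint_bigcup.
    rewrite [RHS]big_mkcond /=; apply: eq_bigr => j _; rewrite /F.
    by case: ifP => _ //; rewrite big_set0.
  move=> j k jk; rewrite disjoint_subset; apply/fintype.subsetP => x.
  rewrite /F inE; case: ifP => _; case: ifP => _; rewrite ?finset.in_set0 // => xj.
  by apply/negP => xk; rewrite (Bdisj xj xk) eqxx in jk.
rewrite subr_ge0 mulr_natr -sumr_const; apply: ler_sum => j jJ.
have uB : u j \in B j by exact: (@pos_block _ _ _ _ u j 0).
rewrite (bigD1 (u j)) //= (bigD1 (p j m)) /=; last first.
  by rewrite pos_block //= -[u j]/(p j 0) pos_eq //; lia.
rewrite big1 ?addr0; last first.
  move=> x /andP[/andP[/blockP[i im ->]]].
  rewrite -[u j]/(p j 0) !pos_eq //; try lia.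
  by move=> i0 im'; rewrite cut_pos ?t_pos ?subrr //; lia.
rewrite cut_u // cut_last // (t_pos jJ (leqnn m)).
have -> : t (u j) = p j 1 by rewrite -[u j]/(p j 0) t_pos.
have := gain j; lra.
Qed.

Theorem TF_le_cut :
  (TF (edge_weight dd) g I O <= (\sum_x dd x (t x) - gamma * #|J|%:R)%:E)%E.
Proof.
have co x : (maxn 3 g <= fingraph.order cut x)%N.
  by apply: leq_trans (cut_order x); rewrite geq_max m2.
have c3 x : (2 < fingraph.order cut x)%N by have := co x; rewrite geq_max => /andP[].
have c1 x : cut x != x.
  apply/eqP => cx; have := @order_le_cycle _ cut [:: x] _ x.
  by rewrite /= cx !inE !eqxx => /(_ isT isT); have := c3 x; lia.
have c2 x : cut (cut x) != x.
  apply/eqP => cx; have := @order_le_cycle _ cut [:: x; cut x] _ x.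
  by rewrite /= cx !inE !eqxx => /(_ isT isT); have := c3 x; lia.
apply: le_trans (_ : (total_weight (edge_weight dd) (pedges cut))%:E <= _)%E.
  apply: ereal_inf_lbound; exists (pedges cut) => //.
  by split; [exact: orbits_two_factor | exact: cut_respects].
by rewrite lee_fin total_weight_pedges // cut_cost.
Qed.

End TwoFactorBound.

(** * The subtour polytope in matrix form, and gluing of its points *)

Section SymmetricHK.
Variables (R : realType) (n : nat).
Implicit Types (X Y : 'I_n -> 'I_n -> R) (A B W : {set 'I_n}).

Definition msum X A B : R := \sum_(a in A) \sum_(b in B) X a b.

(** [msum X A A] counts each edge inside [A] twice, hence the doubled right-hand side. The bounds
    [x_e <= 1] are the subtour inequalities of pairs, see [hk_sym_feasible]. *)
Definition hk_sym X : Prop :=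
  [/\ forall a b, X a b = X b a, forall a, X a a = 0, forall a b, 0 <= X a b,
      forall a, \sum_b X a b = 2
    & forall A, A != finset.set0 -> A != finset.setT ->
        msum X A A <= (#|A|%:R - 1) *+ 2].

Lemma hk_sym_feasible X (I O : {set edge n}) : (2 < n)%N -> hk_sym X ->
  (forall e, e \in I -> X (src e) (tgt e) = 1) ->
  (forall e, e \in O -> X (src e) (tgt e) = 0) ->
  HK_feasible I O (fun e => X (src e) (tgt e)).
Proof.
move=> n2 [Xs Xd X0 Xdeg Xsub] XI XO.
have half (a b : R) : a *+ 2 = b *+ 2 -> a = b.
  by rewrite !mulr2n => h; lra.
split=> //.
- move=> i; apply: half; rewrite big_mkcond /=.
  pose F a b := if (a == i) || (b == i) then X a b else 0.
  rewrite (sum_edge_sym (G := F)); last by move=> a b; rewrite /F orbC Xs.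
  rewrite (bigD1 i) //= mulr2n -{1}(Xdeg i) -(Xdeg i); congr (_ + _).
    rewrite [RHS](bigD1 i) //= Xd add0r.
    by apply: eq_bigr => b _; rewrite /F eqxx.
  rewrite [RHS](bigD1 i) //= Xd add0r.
  apply: eq_bigr => a ai; rewrite (bigD1 i) 1?eq_sym //= big1 ?addr0.
    by rewrite /F eqxx orbT Xs.
  by move=> b /andP[_ bi]; rewrite /F (negbTE ai) (negbTE bi).
- move=> A A0 AT; rewrite -(ler_pMn2r (n := 2)) //.
  apply: le_trans (Xsub A A0 AT); rewrite big_mkcond /=.
  pose F a b := if (a \in A) && (b \in A) then X a b else 0.
  rewrite (sum_edge_sym (G := F)); last by move=> a b; rewrite /F andbC Xs.
  rewrite /msum [leRHS]big_mkcond /=; apply: ler_sum => a _.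
  rewrite /F; case: (a \in A) => /=; last by rewrite big1.
  rewrite [leRHS](bigID (fun b => b != a)) /= [X in _ + X]big1 ?addr0.
    rewrite -big_mkcondr /=.
    by rewrite le_eqVlt; apply/orP; left; apply/eqP/eq_bigl => b; rewrite andbC.
  by move=> b /andP[_ /negPn/eqP ->].
- move=> e; rewrite X0 /=.
  set a := src e; set b := tgt e; have ab : a != b := edge_neq e.
  have := Xsub [set a; b]%SET.
  have c2 : #|[set a; b]%SET| = 2%N by rewrite cards2 ab.
  have -> : [set a; b]%SET != finset.set0 by rewrite -card_gt0 c2.
  have -> : [set a; b]%SET != finset.setT.
    by apply/eqP => h; move: c2; rewrite h cardsT card_ord; lia.
  move=> /(_ isT isT); rewrite c2 /msum.
  rewrite !big_setU1 ?finset.in_set1 //= !big_set1 !big_setU1 ?finset.in_set1 //= !big_set1.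
  by rewrite !Xd [X b a]Xs; lra.
Qed.

Lemma hk_sym_cost (dd : 'I_n -> 'I_n -> R) X I O :
  (forall x y, dd x y = dd y x) -> (forall x, dd x x = 0) ->
  hk_sym X -> HK_feasible I O (fun e => X (src e) (tgt e)) ->
  (HK (edge_weight dd) I O <= ((\sum_a \sum_b dd a b * X a b) / 2)%:E)%E.
Proof.
move=> ds dx [Xs _ _ _ _] hX.
apply: le_trans (_ : (\sum_(e : edge n) dd (src e) (tgt e) * X (src e) (tgt e))%:E <= _)%E.
  by apply: ereal_inf_lbound; exists (fun e : edge n => X (src e) (tgt e)).
rewrite lee_fin ler_pdivlMr // mulr_natr (sum_edge_sym (G := fun a b => dd a b * X a b)).
  rewrite le_eqVlt; apply/orP; left; apply/eqP; apply: eq_bigr => a _.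
  by rewrite [RHS](bigD1 a) //= dx mul0r add0r.
by move=> a b; rewrite ds Xs.
Qed.

Definition perm_adj (t : {perm 'I_n}) a b : R := (t a == b)%:R + (t b == a)%:R.

Lemma sum_indic (F : 'I_n -> R) (x : 'I_n) : \sum_a F a * (x == a)%:R = F x.
Proof.
rewrite (bigD1 x) //= eqxx mulr1 big1 ?addr0 // => a ax.
by rewrite eq_sym (negbTE ax) mulr0.
Qed.

(** For the subtour inequality: a proper non-empty set closed under [t] would contradict the single
    cycle, so some point of [A] is mapped out of [A]. *)
Lemma perm_adj_hk t : (2 < n)%N -> one_cycle t -> hk_sym (perm_adj t).
Proof.
move=> n2 ht.
have t1 x : t x != x by apply: one_cycle_neq => //; exact: ltnW.
have E (t' : {perm 'I_n}) A : \sum_(a in A) \sum_(b in A) (t' a == b)%:R =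
    #|[set a in A | t' a \in A]%SET|%:R :> R.
  rewrite -sum1_card natr_sum big_mkcond [RHS]big_mkcond /=.
  apply: eq_bigr => a _; rewrite !inE; case: (a \in A) => //=.
  have [aA|aA] := boolP (t' a \in A).
    rewrite (bigD1 (t' a)) //= eqxx big1 ?addr0 // => b /andP[_ ba].
    by rewrite eq_sym (negbTE ba).
  by rewrite big1 // => b bA; case: eqP aA => // ->; rewrite bA.
split.
- by move=> a b; rewrite /perm_adj addrC.
- by move=> a; rewrite /perm_adj (negbTE (t1 a)) addr0.
- by move=> a b; rewrite addr_ge0 ?ler0n.
- move=> a; rewrite big_split /=.
  rewrite (bigD1 (t a)) //= eqxx big1 => [|b]; last by rewrite eq_sym => /negbTE ->.
  rewrite (bigD1 ((t^-1)%g a)) //= permKV eqxx big1 ?addr0 // => b.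
  by case: (t b =P a) => // <-; rewrite permK eqxx.
- move=> A A0 AT.
  have -> : msum (perm_adj t) A A = #|[set a in A | t a \in A]%SET|%:R *+ 2.
    rewrite /msum; under eq_bigr do rewrite big_split /=.
    by rewrite big_split /= exchange_big /= -E mulr2n exchange_big.
  rewrite ler_pMn2r // -(natrB _ (n := 1)); last by rewrite card_gt0.
  rewrite ler_nat subn1 -ltnS prednK ?card_gt0 //.
  apply: proper_card; rewrite properE.
  have sub : [set a in A | t a \in A]%SET \subset A.
    by apply/fintype.subsetP => a; rewrite inE => /andP[].
  rewrite sub; apply/negP => /fintype.subsetP h.
  have closed a : a \in A -> t a \in A by move=> /h; rewrite inE => /andP[].
  have [a0 a0A] : exists a, a \in A by apply/set0Pn.
  move/eqP: AT; apply; apply/setP => b; rewrite finset.in_setT.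
  have := iter_findex (ht a0 b); move: (findex _ _ _) => k <-.
  by elim: k => //= k IH; exact: closed.
Qed.

Section Glue.
Variables (X Y : 'I_n -> 'I_n -> R) (W : {set 'I_n}) (u v : 'I_n).
Hypothesis hX : hk_sym X.
Hypotheses (Ysym : forall a b, Y a b = Y b a) (Yd : forall a, Y a a = 0).
Hypothesis Y0 : forall a b, 0 <= Y a b.
Hypothesis YX : forall a b, a \notin W -> b \notin W -> Y a b = X a b.
Hypotheses (uW : u \notin W) (vW : v \notin W) (uv : u != v).
Hypothesis Xout : forall a b, a \in W -> b \notin W -> b != u -> b != v -> X a b = 0.
Hypothesis Yout : forall a b, a \in W -> b \notin W -> b != u -> b != v -> Y a b = 0.
Hypotheses (Xu : \sum_(a in W) X a u = 1) (Xv : \sum_(a in W) X a v = 1).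
Hypotheses (Yu : \sum_(a in W) Y a u = 1) (Yv : \sum_(a in W) Y a v = 1).
Hypothesis Ydeg : forall a, a \in W -> \sum_b Y a b = 2.
Hypothesis Ysub : forall A, A != finset.set0 -> A \subset W ->
  msum Y A A <= (#|A|%:R - 1) *+ 2.

Lemma msum_split Z A B C :
  msum Z A C = msum Z (A :&: B) C + msum Z (A :\: B) C.
Proof. by rewrite /msum (big_setID B). Qed.

Lemma msumC Z A B : (forall a b, Z a b = Z b a) -> msum Z A B = msum Z B A.
Proof.
by move=> Zs; rewrite /msum exchange_big /=; apply: eq_bigr => a _; apply: eq_bigr => b _.
Qed.

(* The set function [S |-> 2|S| - Y(S,S)] is a cut function; the two tight
   boundary edges let it be glued from the pieces inside and outside [W]. *)
Lemma glue_hk : hk_sym Y.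
Proof.
case: hX => Xs Xd X0 Xdeg Xsub.
have rowout (Z : 'I_n -> 'I_n -> R) a (B : {set 'I_n}) : (forall b, b \notin W -> b != u -> b != v -> Z a b = 0) ->
    (B :&: W)%SET = finset.set0 -> \sum_(b in B) Z a b =
    (u \in B)%:R * Z a u + (v \in B)%:R * Z a v.
  move=> Z0 BW; have nW b : b \in B -> b \notin W.
    by move=> bB; apply/negP => bW; have := finset.in_set0 b; rewrite -BW finset.in_setI bB bW.
  rewrite big_mkcond (bigD1 u) //= (bigD1 v) 1?eq_sym //= big1 ?addr0; last first.
    by move=> b /andP[bu bv]; case: ifP => // /nW bW; exact: Z0.
  by congr (_ + _); case: (_ \in B); rewrite ?mul1r ?mul0r.
have Wc : ((~: W) :&: W = finset.set0)%SET by rewrite finset.setIC finset.setICr.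
have degW (Z : 'I_n -> 'I_n -> R) a : a \in W -> (forall b, b \notin W -> b != u -> b != v -> Z a b = 0) ->
    \sum_b Z a b = \sum_(b in W) Z a b + Z a u + Z a v.
  move=> aW Z0; rewrite (bigID (mem W)) /= -addrA; congr (_ + _).
  rewrite (eq_bigl (mem (~: W)%SET)); last by move=> b; rewrite !inE.
  by rewrite (rowout Z a) // !finset.in_setC uW vW !mul1r.
have swap (Z : 'I_n -> 'I_n -> R) w : (forall a b, Z a b = Z b a) ->
    \sum_(b in W) Z w b = \sum_(b in W) Z b w.
  by move=> Zs; apply: eq_bigr.
split=> //.
- move=> a; have [aW|aW] := boolP (a \in W); first exact: Ydeg.
  rewrite -(Xdeg a) (bigID (mem W)) [RHS](bigID (mem W)) /=; congr (_ + _); last first.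
    by apply: eq_bigr => b bW; exact: YX.
  have [->|au] := eqVneq a u.
    by rewrite (swap Y) // (swap X) // Yu Xu.
  have [->|av] := eqVneq a v.
    by rewrite (swap Y) // (swap X) // Yv Xv.
  rewrite (swap Y) // (swap X) // !big1 // => b bW; first exact: Xout.
  exact: Yout.
move=> S S0 ST.
set A := (S :&: W)%SET; set B := (S :\: W)%SET.
have BW : (B :&: W)%SET = finset.set0.
  by apply/setP => b; rewrite !inE; case: (b \in W); rewrite ?andbF.
have AW : A \subset W by exact: finset.subsetIr.
have cS : #|S|%:R = #|A|%:R + #|B|%:R :> R by rewrite -(cardsID W S) natrD.
have split4 (Z : 'I_n -> 'I_n -> R) : (forall a b, Z a b = Z b a) ->
    msum Z S S = msum Z A A + msum Z A B *+ 2 + msum Z B B.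
  move=> Zs; rewrite (msum_split Z S W) (msumC A S Zs) (msumC B S Zs).
  rewrite !(msum_split Z S W) -/A -/B (msumC B A Zs); ring.
have YBB : msum Y B B = msum X B B.
  have nW b : b \in B -> b \notin W by rewrite !inE => /andP[].
  by apply: eq_bigr => a aB; apply: eq_bigr => b bB; rewrite YX ?nW.
have YAB : msum Y A B = (u \in B)%:R * (\sum_(a in A) Y a u) + (v \in B)%:R * (\sum_(a in A) Y a v).
  rewrite /msum !mulr_sumr -big_split /=; apply: eq_bigr => a aA.
  by apply: rowout => // b bW bu bv; apply: Yout => //; exact: (fintype.subsetP AW).
have Ale1 w : \sum_(a in W) Y a w = 1 -> \sum_(a in A) Y a w <= 1.
  move=> <-; rewrite [leRHS](big_setID A) /= (finset.setIidPr AW) lerDl.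
  by apply: sumr_ge0.
have A0s w : 0 <= \sum_(a in A) Y a w by apply: sumr_ge0.
have [a0 a0W] : exists a, a \in W.
  apply/set0Pn; apply: contra_eq_neq Xu => ->.
  by rewrite big_set0 eq_sym oner_eq0.
have BT : B != finset.setT.
  by apply/eqP => BT; have := finset.in_setT a0; rewrite -BT finset.in_setD a0W.
have hB : B != finset.set0 -> msum X B B <= (#|B|%:R - 1) *+ 2.
  by move=> B0; exact: Xsub.
have hA := Ysub _ AW.
rewrite (split4 Y Ysym) YBB cS.
have [A0|A0] := eqVneq A finset.set0.
  have B0 : B != finset.set0.
    apply: contraNneq S0 => B0; rewrite -(finset.setID S W) -/A -/B A0 B0.
    by rewrite finset.setU0.
  by rewrite {1 2}/msum A0 !big_set0 cards0 mul0rn !add0r; exact: hB.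
have [B0|B0] := eqVneq B finset.set0.
  rewrite YAB B0 !finset.in_set0 !mul0r addr0 mul0rn addr0 cards0 addr0.
  by rewrite [X in _ + X](_ : _ = 0) ?addr0 ?hA // /msum big_set0.
move/(_ B0): hB => hB; move/(_ A0): hA => hA.
have yu1 := Ale1 u Yu; have yv1 := Ale1 v Yv; have yu0 := A0s u; have yv0 := A0s v.
have [/andP[uB vB]|uvB] := boolP ((u \in B) && (v \in B)); last first.
  have : msum Y A B <= 1.
    rewrite YAB; case: (u \in B) (v \in B) uvB => -[] //= _;
    rewrite ?mul1r ?mul0r ?addr0 ?add0r //; lra.
  by move: hA hB; rewrite !mulr2n; lra.
rewrite uB vB !mul1r in YAB.
pose C := (W :\: S)%SET.
have WA : (W :&: S)%SET = A by rewrite finset.setIC.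
have CW : C \subset W by exact: finset.subsetDl.
have sumdeg (Z : 'I_n -> 'I_n -> R) (E : {set 'I_n}) : E \subset W ->
    (forall a b, Z a b = Z b a) ->
    (forall a b, a \in W -> b \notin W -> b != u -> b != v -> Z a b = 0) ->
    (forall a, a \in W -> \sum_b Z a b = 2) ->
    msum Z E A + msum Z E C + \sum_(a in E) Z a u + \sum_(a in E) Z a v = #|E|%:R *+ 2.
  move=> EW Zs Zout Zdeg.
  have -> : msum Z E A + msum Z E C = msum Z E W.
    by rewrite !(msumC E _ Zs) (msum_split Z W S) WA.
  rewrite -!big_split /= -sumr_const -sumrMnl; apply: eq_bigr => a aE.
  have aW := fintype.subsetP EW a aE.
  by rewrite -degW ?Zdeg // => b bW bu bv; exact: Zout.
have uvAC (Z : 'I_n -> 'I_n -> R) w : \sum_(a in W) Z a w = 1 ->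
    \sum_(a in A) Z a w + \sum_(a in C) Z a w = 1.
  by move=> <-; rewrite [RHS](big_setID S) WA.
(* If [S] contains [W], [u] and [v], the degrees give [Y] and [X] the same total on [S]. *)
have [C0|C0] := eqVneq C finset.set0.
  have AE : A = W.
    by rewrite -[RHS](finset.setID W S) WA -/C C0 finset.setU0.
  have XAB : msum X A B = \sum_(a in W) X a u + \sum_(a in W) X a v.
    rewrite /msum AE -big_split /=; apply: eq_bigr => a aW.
    by rewrite (rowout X) // ?uB ?vB ?mul1r // => b bW bu bv; exact: Xout.
  have := sumdeg X A AW Xs Xout (fun a _ => Xdeg a).
  have := sumdeg Y A AW Ysym Yout Ydeg.
  have Z0 (Z : 'I_n -> 'I_n -> R) : msum Z A C = 0.
    by rewrite /msum C0 big1 // => a _; rewrite big_set0.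
  rewrite !Z0 YAB.
  have := Xsub S S0 ST; rewrite (split4 X Xs) XAB cS AE Xu Xv Yu Yv !mulr2n; lra.
(* Here [S] meets [W] without covering it. By the degrees in [W], the inequality for [C = W - S]
   turns into [Y(A,A) <= 2 #|A| - 2 Y(A,B)], which offsets the boundary term. *)
have := sumdeg Y A AW Ysym Yout Ydeg.
have := sumdeg Y C CW Ysym Yout Ydeg.
rewrite (msumC C A Ysym) YAB.
have := Ysub C0 CW; have := uvAC Y u Yu; have := uvAC Y v Yv.
rewrite !mulr2n; lra.
Qed.

End Glue.

End SymmetricHK.

Local Arguments pos : simpl never.

Section HeldKarpBound.
Variables (n m : nat) (s : {perm 'I_n}) (G : finType).
Variables (u : G -> 'I_n) (S : G -> {set 'I_n}).
Hypotheses (m2 : (2 < m)%N) (mn : (m.+2 < n)%N) (hs : one_cycle s).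
Hypothesis Sdisj : forall j k x, x \in S j -> x \in S k -> j = k.
Hypothesis posS : forall j i, (i <= m.+1)%N -> pos s u j i \in S j.
Variables (R : realType) (dd : 'I_n -> 'I_n -> R) (gamma : R).
Hypothesis dsym : forall x y, dd x y = dd y x.
Hypothesis dxx : forall x, dd x x = 0.

Notation B := (block m s u).
Notation L := (lobe m s u).
Notation p := (pos s u).

(** [y j] is a fractional solution on the lobe that leaves one unit of degree at [ea j] and one at
    [eb j], where the edges to the outside are attached. *)
Variables (y : G -> 'I_n -> 'I_n -> R) (ea eb : G -> 'I_n).
Hypothesis ysym : forall j a b, y j a b = y j b a.
Hypothesis yd : forall j a, y j a a = 0.
Hypothesis y0 : forall j a b, 0 <= y j a b.
Hypotheses (eaL : forall j, ea j \in L j) (ebL : forall j, eb j \in L j).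
Hypothesis ydeg : forall j a, a \in L j ->
  \sum_(b in L j) y j a b + (a == ea j)%:R + (a == eb j)%:R = 2.
Hypothesis ysub : forall j A, A != finset.set0 -> A \subset L j ->
  msum (y j) A A <= (#|A|%:R - 1) *+ 2.
Hypothesis gain : forall j,
  dd (u j) (ea j) + dd (eb j) (p j m.+1) +
  (\sum_(a in L j) \sum_(b in L j) dd a b * y j a b) / 2 + gamma <=
  \sum_(i < m.+1) dd (p j i) (p j i.+1).

Variables (I O : {set edge n}) (t : {perm 'I_n}) (J : {set G}).
Hypothesis ht : one_cycle t.
Hypothesis run : forall j i, j \in J -> (i <= m.+1)%N ->
  iter i t (u j) = pos s u j i.
Hypothesis Jfree : forall j, j \in J -> free m s u I O j.
Hypothesis tIO : respects I O (pedges t).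

Let X0 := perm_adj R t.

Lemma t_pos_hk j i : j \in J -> (i <= m)%N -> t (p j i) = p j i.+1.
Proof. by move=> jJ im; rewrite -!run // ltnW. Qed.

Lemma lobe_mem j i : (i < n)%N -> (p j i \in L j) = (0 < i <= m)%N.
Proof.
move=> lin; apply/lobeP/idP => [[k km /eqP]|/andP[i0 im]].
  by rewrite pos_eq //; lia.
by exists i.-1; rewrite ?prednK.
Qed.

Lemma u_lobe j : u j \notin L j.
Proof. by rewrite -[u j]/(p j 0) lobe_mem //; lia. Qed.

Lemma exit_lobe j : p j m.+1 \notin L j.
Proof. by rewrite lobe_mem; lia. Qed.

Lemma u_exit j : u j != p j m.+1.
Proof. by rewrite -[u j]/(p j 0) pos_eq //; lia. Qed.

Lemma lobeS j a : a \in L j -> a \in S j.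
Proof. by case/lobeP => i im ->; apply: posS; lia. Qed.

Lemma lobe_block j a : a \in L j -> a \in B j.
Proof. by rewrite block_lobe finset.in_setU1 => ->; rewrite orbT. Qed.

Lemma uS j : u j \in S j. Proof. exact: (@posS j 0). Qed.

Lemma sum_lobe j (F : 'I_n -> R) : \sum_(a in L j) F a = \sum_(i < m) F (p j i.+1).
Proof.
have Ui : injective (fun i : 'I_m => p j i.+1).
  move=> i k /eqP; rewrite pos_eq //; try by have := ltn_ord i; have := ltn_ord k; lia.
  by move=> /eqP [] /val_inj.
have -> : L j = [set p j (val i).+1 | i : 'I_m]%SET.
  apply/setP => a; apply/lobeP/imsetP => [[i im ->]|[i _ ->]].
    by exists (Ordinal im).
  by exists (val i); rewrite ?ltn_ord.
by rewrite big_imset //= => i k _ _; exact: Ui.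
Qed.

Lemma adj_row j a b : j \in J -> a \in L j -> b \notin L j -> b != u j -> b != p j m.+1 ->
  X0 a b = 0.
Proof.
move=> jJ /lobeP[i im ->] bL bu bv; rewrite /X0 /perm_adj t_pos_hk //.
have -> : p j i.+2 == b = false.
  apply/eqP => bE; move: bL bv; rewrite -bE lobe_mem ?pos_eq //; lia.
case: eqP; rewrite ?addr0 // -[p j i.+1](@t_pos_hk j i) // 1?ltnW // => /perm_inj bE.
move: bL bu; rewrite bE; case: i {bE} im => [|i] im; first by rewrite /= eqxx.
by rewrite lobe_mem //; lia.
Qed.

Lemma adj_lobe_u j : j \in J -> \sum_(a in L j) X0 a (u j) = 1.
Proof.
move=> jJ; rewrite sum_lobe.
have m0 : (0 < m)%N by lia.
rewrite (bigD1 (Ordinal m0)) //= big1 ?addr0 => [|i].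
  rewrite /X0 /perm_adj -[u j]/(p j 0) !t_pos_hk // ?pos_eq //; try lia.
  by rewrite add0r.
rewrite -val_eqE /= => i0; have im := ltn_ord i.
have i1 : (1 == i.+1)%N = false by lia.
by rewrite /X0 /perm_adj -[u j]/(p j 0) !t_pos_hk // !pos_eq ?i1 ?addr0 //; lia.
Qed.

Lemma adj_lobe_exit j : j \in J -> \sum_(a in L j) X0 a (p j m.+1) = 1.
Proof.
move=> jJ; rewrite sum_lobe.
have m0 : (m.-1 < m)%N by lia.
have tx i : (i < m)%N -> (t (p j m.+1) == p j i.+1) = false.
  move=> im; rewrite -(@t_pos_hk j i) //; last lia.
  by rewrite (inj_eq perm_inj) pos_eq //; lia.
rewrite (bigD1 (Ordinal m0)) //= big1 ?addr0 => [|i].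
  rewrite /X0 /perm_adj prednK; last by lia.
  by rewrite t_pos_hk // eqxx -[X in _ == p j X](prednK (n := m)) ?tx ?addr0 //; lia.
rewrite -val_eqE /= => i0; have im := ltn_ord i.
have i1 : (i.+2 == m.+1)%N = false by lia.
by rewrite /X0 /perm_adj t_pos_hk // tx // pos_eq ?i1 ?addr0 //; lia.
Qed.

(* The run through lobe [j] is replaced by [y j], joined to the rest by the
   edges [u j, ea j] and [p j m.+1, eb j]. *)
Definition upd (X : 'I_n -> 'I_n -> R) j a b : R :=
  if (a \in L j) && (b \in L j) then y j a b
  else if a \in L j then
    ((b == u j) && (a == ea j))%:R + ((b == p j m.+1) && (a == eb j))%:R
  else if b \in L j then
    ((a == u j) && (b == ea j))%:R + ((a == p j m.+1) && (b == eb j))%:R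
  else X a b.

Definition upds (js : seq G) := foldr (fun j X => upd X j) X0 js.

Lemma upd_sym X j a b : (forall a b, X a b = X b a) -> upd X j a b = upd X j b a.
Proof.
by move=> Xs; rewrite /upd; case: (a \in L j); case: (b \in L j) => //=; exact: ysym.
Qed.

Lemma upd_row X j a b : a \in L j -> b \notin L j ->
  upd X j a b = ((b == u j) && (a == ea j))%:R + ((b == p j m.+1) && (a == eb j))%:R.
Proof. by move=> aL bL; rewrite /upd aL (negbTE bL). Qed.

Lemma upd_other X j k a b : j != k -> a \in L k -> b \in L j -> upd X j a b = 0.
Proof.
move=> jk aL bL; have aS := lobeS aL.
have nS c : c \in S j -> (a == c) = false.
  by move=> cS; apply/eqP => ac; rewrite ac in aS; rewrite (Sdisj cS aS) eqxx in jk.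
have aj : a \in L j = false by apply/negP => /lobeS /nS; rewrite eqxx.
by rewrite /upd aj bL /= !nS ?uS ?posS // addr0.
Qed.

Lemma upds_out js a b : (forall j, j \in js -> a \notin L j) ->
  (forall j, j \in js -> b \notin L j) -> upds js a b = X0 a b.
Proof.
elim: js => //= j js IH ha hb.
rewrite {1}/upd (negbTE (ha j _)) ?mem_head // (negbTE (hb j _)) ?mem_head //=.
by apply: IH => k kjs; [apply: ha|apply: hb]; rewrite inE kjs orbT.
Qed.

Lemma upds_row js j a b : j \in J -> j \notin js -> a \in L j ->
  upds js a b = X0 a b.
Proof.
move=> jJ; elim: js => //= k js IH; rewrite inE => /norP[jk jjs] aL.
have ak : a \in L k = false.
  apply/negP => /lobeS aS; move: jk; rewrite (Sdisj (lobeS aL) aS) eqxx //.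
have [bL|bL] := boolP (b \in L k); last first.
  by rewrite /upd ak (negbTE bL) /= IH.
rewrite (@upd_other _ _ j) 1?eq_sym // (@adj_row j) //.
- by apply/negP => /lobeS bS; move: jk; rewrite (Sdisj (lobeS bL) bS) eqxx.
- by apply/eqP => bu; move: jk; rewrite (Sdisj (lobeS bL) (j := k) (k := j)) ?eqxx // bu uS.
- by apply/eqP => bu; move: jk; rewrite (Sdisj (lobeS bL) (j := k) (k := j)) ?eqxx // bu posS.
Qed.

Lemma upds_in js j a b : uniq js -> {subset js <= J} -> j \in js -> a \in L j ->
  b \notin hull m s u j -> upds js a b = 0.
Proof.
elim: js => //= k js IH /andP[kjs Ujs] sJ jk aL bH.
have bL : b \notin L j.
  by apply: contra bH => /lobe_block bB; rewrite finset.in_setU bB.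
have bu : b != u j.
  by apply: contra bH => /eqP ->; rewrite finset.in_setU (@pos_block _ _ _ _ u j 0).
have bv : b != p j m.+1.
  by apply: contra bH => /eqP ->; rewrite !inE eqxx !orbT.
have [kj|kj] := eqVneq k j.
  by rewrite kj upd_row // (negbTE bu) (negbTE bv) addr0.
have jjs : j \in js by move: jk; rewrite inE eq_sym (negbTE kj).
have [bk|bk] := boolP (b \in L k); first by rewrite (upd_other _ kj aL).
have ak : a \in L k = false.
  by apply/negP => /lobeS aS; rewrite (Sdisj (lobeS aL) aS) eqxx in kj.
rewrite /upd ak (negbTE bk) /= IH // => x xjs.
by apply: sJ; rewrite inE xjs orbT.
Qed.

(** The lobes are glued in one at a time. On the rows of a lobe not yet treated, the current matrix
    still agrees with the tour by [upds_row], so exactly one unit joins the lobe to [u j] and one to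
    the exit, as [glue_hk] requires. *)
Lemma upds_hk js : uniq js -> {subset js <= J} -> hk_sym (upds js).
Proof.
elim: js => [_ _|j js IH /= /andP[jjs Ujs] sJ].
  by apply: perm_adj_hk => //; lia.
have jJ : j \in J by apply: sJ; exact: mem_head.
have hX : hk_sym (upds js).
  by apply: IH => // x xjs; apply: sJ; rewrite inE xjs orbT.
have rowX a b : a \in L j -> upds js a b = X0 a b by exact: upds_row.
have sumu c : c \in L j -> \sum_(a in L j) (a == c)%:R = 1 :> R.
  move=> cL; rewrite (bigD1 c) //= eqxx big1 ?addr0 // => a /andP[_ /negbTE ->] //.
have uu := u_lobe j; have vv := exit_lobe j; have uv := u_exit j.
have sum1 : \sum_(a in L j) upd (upds js) j a (u j) = 1.
  rewrite -(sumu _ (eaL j)); apply: eq_bigr => a aL.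
  by rewrite upd_row // eqxx (negbTE uv) addr0.
have sum2 : \sum_(a in L j) upd (upds js) j a (p j m.+1) = 1.
  rewrite -(sumu _ (ebL j)); apply: eq_bigr => a aL.
  by rewrite upd_row // eqxx [_ == u j]eq_sym (negbTE uv) add0r.
apply: (@glue_hk _ _ (upds js) _ (L j) (u j) (p j m.+1)) => //.
- by move=> a b; apply: upd_sym; case: hX.
- move=> a; rewrite /upd andbb; case: (a \in L j); first exact: yd.
  by case: hX => _ Xd _ _ _; exact: Xd.
- move=> a b; rewrite /upd; case: ifP => _; first exact: y0.
  by do 2 (case: ifP => _; first by rewrite addr_ge0 ?ler0n); case: hX.
- by move=> a b aL bL; rewrite /upd (negbTE aL) (negbTE bL).
- by move=> a b aL bL bu bv; rewrite rowX // (@adj_row j).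
- by move=> a b aL bL bu bv; rewrite upd_row // (negbTE bu) (negbTE bv) addr0.
- by rewrite (eq_bigr (X0^~ (u j))) ?adj_lobe_u // => a /rowX ->.
- by rewrite (eq_bigr (X0^~ (p j m.+1))) ?adj_lobe_exit // => a /rowX ->.
- move=> a aL; rewrite -(ydeg aL) (bigID (mem (L j))) /= -addrA; congr (_ + _).
    by apply: eq_bigr => b bL; rewrite /upd aL bL.
  rewrite (bigD1 (u j)) //= (bigD1 (p j m.+1)) /=; last by rewrite vv eq_sym.
  rewrite !upd_row // !eqxx [p j m.+1 == u j]eq_sym (negbTE uv) /= addr0 add0r.
  rewrite big1 ?addr0 // => b /andP[/andP[bL bu] bv].
  by rewrite upd_row // (negbTE bu) (negbTE bv) addr0.
- move=> A A0 AL; apply: le_trans (ysub A0 AL).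
  rewrite le_eqVlt; apply/orP; left; apply/eqP.
  have AL' := fintype.subsetP AL.
  by apply: eq_bigr => a /AL' aL; apply: eq_bigr => b /AL' bL; rewrite /upd aL bL.
Qed.

Lemma upd_cost X j : j \in J -> hk_sym X -> (forall a b, a \in L j -> X a b = X0 a b) ->
  \sum_a \sum_b dd a b * upd X j a b <= \sum_a \sum_b dd a b * X a b - gamma *+ 2.
Proof.
move=> jJ [Xs _ _ _ _] rowX.
have usym a b : upd X j a b = upd X j b a.
  exact: upd_sym.
(* Isolates the pairs with an end in the lobe, the only ones whose entries change. *)
have dec (Z : 'I_n -> 'I_n -> R) : (forall a b, Z a b = Z b a) ->
    \sum_a \sum_b Z a b = \sum_(a in ~: L j) \sum_(b in ~: L j) Z a b +
      ((\sum_(a in L j) \sum_b Z a b) *+ 2 - \sum_(a in L j) \sum_(b in L j) Z a b).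
  move=> Zs; rewrite (bigID (mem (L j))) /=.
  have E : \sum_(a in L j) \sum_b Z a b = \sum_(a in L j) \sum_(b in L j) Z a b +
      \sum_(a in L j) \sum_(b in ~: L j) Z a b.
    rewrite -big_split /=; apply: eq_bigr => a _; rewrite (bigID (mem (L j))) /=.
    by congr (_ + _); apply: eq_bigl => b; rewrite finset.in_setC.
  have E' : \sum_(a | a \notin L j) \sum_b Z a b =
      \sum_(a in L j) \sum_(b in ~: L j) Z a b + \sum_(a in ~: L j) \sum_(b in ~: L j) Z a b.
    rewrite exchange_big /= (bigID (mem (L j))) /=; congr (_ + _).
      apply: eq_bigr => a _; under [RHS]eq_bigr do rewrite Zs.
      by apply: eq_bigl => b; rewrite finset.in_setC.
    rewrite (eq_bigl (mem (~: L j)%SET)); last by move=> a; rewrite !inE.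
    apply: eq_bigr => a _; under [RHS]eq_bigr do rewrite Zs.
    by apply: eq_bigl => b; rewrite finset.in_setC.
  rewrite E' E mulr2n; ring.
rewrite (dec (fun a b => dd a b * upd X j a b)); last by move=> a b; rewrite usym dsym.
rewrite (dec (fun a b => dd a b * X a b)); last by move=> a b; rewrite Xs dsym.
rewrite -[leRHS]addrA; apply: lerD.
  rewrite le_eqVlt; apply/orP; left; apply/eqP.
  apply: eq_bigr => a; rewrite finset.in_setC => aL.
  apply: eq_bigr => b; rewrite finset.in_setC => bL.
  by rewrite /upd (negbTE aL) (negbTE bL).
set c := \sum_(a in L j) \sum_(b in L j) dd a b * y j a b.
have uu := u_lobe j; have vv := exit_lobe j; have uv := u_exit j.
have c1 : \sum_(a in L j) \sum_(b in L j) dd a b * upd X j a b = c.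
  by apply: eq_bigr => a aL; apply: eq_bigr => b bL; rewrite /upd aL bL.
have sume (F : 'I_n -> R) e : e \in L j -> \sum_(a in L j) F a * (a == e)%:R = F e.
  move=> eL; rewrite (bigD1 e) //= eqxx mulr1 big1 ?addr0 // => a /andP[_ /negbTE ->].
  by rewrite mulr0.
have c2 : \sum_(a in L j) \sum_b dd a b * upd X j a b =
    c + dd (u j) (ea j) + dd (eb j) (p j m.+1).
  rewrite -c1 [dd (u j) _]dsym -(sume (dd^~ (u j)) _ (eaL j)).
  rewrite -(sume (dd^~ (p j m.+1)) _ (ebL j)) -!big_split /=.
  apply: eq_bigr => a aL; rewrite (bigID (mem (L j))) /= -addrA; congr (_ + _).
  rewrite (bigD1 (u j)) //= (bigD1 (p j m.+1)) /=; last by rewrite vv eq_sym.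
  rewrite !upd_row // !eqxx [p j m.+1 == u j]eq_sym (negbTE uv) /= addr0 add0r.
  rewrite big1 ?addr0 // => b /andP[/andP[bL bu] bv].
  by rewrite upd_row // (negbTE bu) (negbTE bv) addr0 mulr0.
pose d i := dd (p j i) (p j i.+1).
have bigE (F : nat -> R) : \sum_(i < m) F i = \sum_(i < m.-1) F i + F m.-1.
  have -> : \sum_(i < m) F i = \sum_(i < m.-1.+1) F i by rewrite prednK //; lia.
  by rewrite big_ord_recr.
have row a b : a \in L j -> dd a b * X a b = dd a b * (t a == b)%:R + dd a b * (t b == a)%:R.
  by move=> aL; rewrite rowX // mulrDr.
have c3 : \sum_(a in L j) \sum_b dd a b * X a b =
    \sum_(i < m) d i.+1 + \sum_(i < m) d i.
  rewrite sum_lobe -big_split /=; apply: eq_bigr => i _; have im := ltn_ord i.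
  have pL : p j i.+1 \in L j by rewrite lobe_mem; lia.
  under eq_bigr do rewrite row //.
  rewrite big_split /= sum_indic t_pos_hk //; congr (_ + _).
  rewrite (bigD1 (p j i)) //= t_pos_hk 1?ltnW // eqxx mulr1 big1 ?addr0 1?dsym // => b bp.
  rewrite -[X in _ == X](@t_pos_hk j i) 1?ltnW // (inj_eq perm_inj) (negbTE bp) mulr0 //.
have c4 : \sum_(a in L j) \sum_(b in L j) dd a b * X a b = (\sum_(i < m.-1) d i.+1) *+ 2.
  transitivity (\sum_(a in L j) \sum_(b in L j) dd a b * (t a == b)%:R +
      \sum_(a in L j) \sum_(b in L j) dd a b * (t b == a)%:R).
    by rewrite -big_split; apply: eq_bigr => a aL; rewrite -big_split; apply: eq_bigr => b _; rewrite row.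
  rewrite [X in _ + X]exchange_big /=.
  rewrite [X in _ + X](eq_bigr (fun a => \sum_(b in L j) dd a b * (t a == b)%:R)); last first.
    by move=> a _; apply: eq_bigr => b _; rewrite dsym.
  rewrite mulr2n.
  suff -> : \sum_(a in L j) \sum_(b in L j) dd a b * (t a == b)%:R = \sum_(i < m.-1) d i.+1 by [].
  rewrite sum_lobe (bigE (fun i => \sum_(b in L j) dd (p j i.+1) b * (t (p j i.+1) == b)%:R)).
  rewrite prednK ?t_pos_hk //; last by lia.
  rewrite [X in _ + X]big1 ?addr0 => [|b bL]; last first.
    by case: eqP => [bE|_]; [move: bL; rewrite -bE (negbTE vv)|rewrite mulr0].
  apply: eq_bigr => i _; have im := ltn_ord i.
  rewrite t_pos_hk //; last by lia.
  rewrite (bigD1 (p j i.+2)) /=; last by rewrite lobe_mem; lia.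
  by rewrite eqxx mulr1 big1 ?addr0 // => b /andP[_]; rewrite eq_sym => /negbTE ->; rewrite mulr0.
rewrite c1 c2 c3 c4.
have gj : dd (u j) (ea j) + dd (eb j) (p j m.+1) + c / 2 + gamma <=
  \sum_(i < m.+1) d i := gain j.
have e1 : \sum_(i < m.+1) d i = \sum_(i < m) d i + d m by rewrite big_ord_recr.
have e2 : \sum_(i < m) d i.+1 = \sum_(i < m.-1) d i.+1 + d m.
  by rewrite (bigE (fun i => d i.+1)) prednK //; lia.
rewrite e1 in gj; rewrite e2 !mulr2n.
set f := \sum_(i < m.-1) _; set h := \sum_(i < m) _ in gj *.
lra.
Qed.

Theorem HK_le_upds :
  (HK (edge_weight dd) I O <= (\sum_x dd x (t x) - gamma * #|J|%:R)%:E)%E.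
Proof.
have n2 : (2 < n)%N by lia.
set js := enum J.
have Ujs : uniq js := enum_uniq _.
have sJ : {subset js <= J} by move=> j; rewrite mem_enum.
have hX := upds_hk Ujs sJ.
have cost : \sum_a \sum_b dd a b * upds js a b <=
    (\sum_x dd x (t x) - gamma * (size js)%:R) *+ 2.
  elim: (js) Ujs sJ => [_ _|j r IH /= /andP[jr Ur] sJ].
    rewrite mulr0 subr0 le_eqVlt; apply/orP; left; apply/eqP.
    transitivity (\sum_a \sum_b dd a b * (t a == b)%:R + \sum_a \sum_b dd a b * (t b == a)%:R).
      by rewrite -big_split; apply: eq_bigr => a _; rewrite -big_split; apply: eq_bigr => b _; rewrite /= -mulrDr.
    rewrite [X in _ + X]exchange_big /= mulr2n; congr (_ + _); apply: eq_bigr => a _.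
      by rewrite sum_indic.
    by rewrite (eq_bigr (fun b => dd a b * (t a == b)%:R)) ?sum_indic // => b _; rewrite dsym.
  have jJ : j \in J by apply: sJ; exact: mem_head.
  have sJ' : {subset r <= J} by move=> x xr; apply: sJ; rewrite inE xr orbT.
  apply: le_trans (upd_cost jJ (upds_hk Ur sJ') _) _.
    by move=> a b aL; exact: (upds_row _ jJ).
  have := IH Ur sJ'; rewrite -natr1 !mulr2n; lra.
have feas : HK_feasible I O (fun e => upds js (src e) (tgt e)).
  have notouch e : (forall j, j \in J -> (src e \notin L j) && (tgt e \notin L j)) ->
      upds js (src e) (tgt e) = X0 (src e) (tgt e).
    by move=> h; apply: upds_out => j /sJ /h /andP[].
  case/andP: tIO => /fintype.subsetP It Ot.
  apply: hk_sym_feasible => // e eIO.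
    have eI := It e eIO.
    rewrite notouch => [|j jJ]; last first.
      have /andP[/forall_inP/(_ e eIO) + _] := Jfree jJ.
      by rewrite /touches => /norP[h1 h2]; rewrite (contra (@lobe_block j _) h1) (contra (@lobe_block j _) h2).
    (* The entry is 1 and not 2, since a tour on more than two points runs no edge in both
       directions. *)
    move: eI; rewrite inE /X0 /perm_adj => /orP[] /eqP <-.
      by rewrite eqxx (negbTE (one_cycle_neq2 _ n2 ht)) addr0.
    by rewrite eqxx (negbTE (one_cycle_neq2 _ n2 ht)) add0r.
  have [j /andP[jJ aL]|na] := pickP (fun j => (j \in J) && (src e \in L j)).
    have /andP[_ /forall_inP/(_ e eIO)] := Jfree jJ.
    rewrite /in_hull (lobe_block aL) /= => /norP[bH _].
    by apply: (@upds_in js j) => //; rewrite mem_enum.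
  have [j /andP[jJ aL]|nb] := pickP (fun j => (j \in J) && (tgt e \in L j)).
    have /andP[_ /forall_inP/(_ e eIO)] := Jfree jJ.
    rewrite /in_hull (lobe_block aL) /= => /norP[_ bH].
    case: hX => -> _ _ _ _.
    by apply: (@upds_in js j) => //; rewrite mem_enum.
  rewrite notouch; last by move=> j jJ; have := na j; have := nb j; rewrite jJ /= => -> ->.
  have : e \notin pedges t by rewrite (disjointFr Ot eIO).
  by rewrite inE /X0 /perm_adj => /norP[/negbTE -> /negbTE ->]; rewrite addr0.
apply: le_trans (hk_sym_cost dsym dxx hX feas) _.
have cJ : size js = #|J| by rewrite /js cardE.
rewrite cJ in cost; rewrite lee_fin ler_pdivrMr //.
by apply: le_trans cost _; rewrite -[leLHS]mulr_natr.
Qed.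

End HeldKarpBound.

(** * Gadgets *)

Section GadgetRun.
Variables (R : realType) (n : nat) (dd : 'I_n -> 'I_n -> R) (s : {perm 'I_n}).
Hypothesis dsym : forall x y, dd x y = dd y x.
Hypothesis hs : one_cycle s.
Hypothesis sopt : forall t, one_cycle t ->
  \sum_x dd x (s x) <= \sum_x dd x (t x).

Lemma opt_two_opt x y : x != y ->
  dd x (s x) + dd y (s y) <= dd x y + dd (s x) (s y).
Proof.
move=> xy; have [t ht E] := two_opt dsym hs xy.
have := sopt ht; lra.
Qed.

Variables (m : nat) (S : {set 'I_n}) (L : 'I_5 -> {set 'I_n}) (gamma : R).
Hypotheses (m0 : (0 < m)%N) (g0 : 0 < gamma).
Hypothesis LS : forall p, L p \subset S.
Hypothesis Ldisj : forall p q x, x \in L p -> x \in L q -> p = q.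
Hypothesis cardL : forall p, #|L p| = m.
Hypothesis iso : forall x1 x2 x3 a1 a2 a3,
  x1 \notin S -> x2 \notin S -> x3 \notin S -> a1 \in S -> a2 \in S -> a3 \in S ->
  dd x1 a1 + dd x2 a2 <= dd x1 x2 + dd a1 a2 ->
  dd x2 a2 + dd x3 a3 <= dd x2 x3 + dd a2 a3 ->
  dd x3 a3 + dd x1 a1 <= dd x3 x1 + dd a3 a1 -> False.
Hypothesis sep : forall p a b x y, a \in L p -> b \in L p ->
  x \in S -> y \in S -> x \notin L p -> y \notin L p ->
  dd x y + dd a b + gamma <= dd x a + dd y b.

(* At most two tour edges enter [S] and at most two leave it, so one of the
   five lobes is not met by them. *)
Lemma inner_lobe : exists p, (forall x, s x \in L p -> x \in S) /\
  (forall x, x \in L p -> s x \in S).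
Proof.
pose E := [set x | (x \notin S) && (s x \in S)]%SET.
pose X := [set x | (x \in S) && (s x \notin S)]%SET.
have E2 : (#|E| <= 2)%N.
  rewrite leqNgt; apply/negP => /card_gt2P[x [y [z [[+ + +] [xy yz zx]]]]].
  rewrite !inE => /andP[xS sxS] /andP[yS syS] /andP[zS szS].
  exact: (iso xS yS zS sxS syS szS (opt_two_opt xy) (opt_two_opt yz) (opt_two_opt zx)).
have X2 : (#|X| <= 2)%N.
  rewrite leqNgt; apply/negP => /card_gt2P[x [y [z [[+ + +] [xy yz zx]]]]].
  rewrite !inE => /andP[xS sxS] /andP[yS syS] /andP[zS szS].
  have sw a b : a != b -> dd (s a) a + dd (s b) b <= dd (s a) (s b) + dd a b.
    move=> ab; rewrite [dd (s a) a]dsym [dd (s b) b]dsym [leRHS]addrC.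
    exact: opt_two_opt.
  exact: (iso sxS syS szS xS yS zS (sw _ _ xy) (sw _ _ yz) (sw _ _ zx)).
pose lob x : 'I_5 := odflt ord0 [pick p | x \in L p].
have lobE p x : x \in L p -> lob x = p.
  move=> xp; rewrite /lob; case: pickP => [q xq|/(_ p)]; last by rewrite xp.
  exact: Ldisj xq xp.
pose touched := ([set lob (s x) | x in E] :|: [set lob x | x in X])%SET.
have cT : (#|touched| <= 4)%N.
  apply: leq_trans (leq_card_setU _ _) _.
  by apply: (@leq_add _ _ 2 2); apply: leq_trans (leq_imset_card _ _) _.
have [p pT] : exists p, p \notin touched.
  apply/existsP; rewrite -negb_forall; apply/negP => /forallP h.
  have : (#|'I_5| <= #|touched|)%N.
    by apply/subset_leq_card/fintype.subsetP => q _; exact: h.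
  by rewrite card_ord => h5; have := leq_trans h5 cT.
move: pT; rewrite finset.in_setU => /norP[pE pX].
have LS' q x : x \in L q -> x \in S by exact: fintype.subsetP (LS q) x.
exists p; split=> x xp; apply/negPn/negP => xS.
- case/negP: pE; apply/imsetP; exists x; last by rewrite (lobE p).
  by rewrite inE xS (LS' p).
- case/negP: pX; apply/imsetP; exists x; last by rewrite (lobE p).
  by rewrite inE xS (LS' p).
Qed.

Lemma gadget_run : exists p u, [/\ u \in S, u \notin L p,
  L p = [set x in traject s (s u) m]%SET & iter m.+1 s u \in S /\ iter m.+1 s u \notin L p].
Proof.
have [p [pin pout]] := inner_lobe.
have [x0 x0L] : exists x, x \in L p by apply/card_gt0P; rewrite cardL.
have [q qp] : exists q : 'I_5, q != p.
  by case: (eqVneq p ord0) => [->|h]; [exists ord_max | exists ord0; rewrite eq_sym].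
have [z0 z0L] : exists x, x \in L q by apply/card_gt0P; rewrite cardL.
have z0p : z0 \notin L p by apply/negP => h; rewrite (Ldisj z0L h) eqxx in qp.
(* If the tour entered the lobe twice, [sep] would make the 2-opt exchange of the two entries a gain
   of at least [gamma], against optimality. *)
have uni x y : x \notin L p -> y \notin L p -> s x \in L p -> s y \in L p -> x = y.
  move=> xp yp sx sy; apply/eqP/negPn/negP => xy.
  have := le_trans (sep sx sy (pin _ sx) (pin _ sy) xp yp) (opt_two_opt xy).
  by rewrite gerDl leNgt g0.
have [u [uL LE exL]] := unique_entry_run hs x0L z0p uni.
rewrite cardL in LE exL.
have in_run i : (i < m)%N -> iter i s (s u) \in L p.
  by move=> im; rewrite LE inE; apply/trajectP; exists i.
exists p, u; split=> //; first by apply: pin; exact: (in_run 0%N).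
split=> //; apply: pout.
by have := in_run m.-1; rewrite -iterSr prednK //; apply.
Qed.

End GadgetRun.

Section Prism.
Variable R : realType.

(* The half-integral point of the subtour polytope on two triangles {0, 1, 2},
   {3, 4, 5} joined by the spokes {0, 3}, {1, 4} and, through the outside, by
   a third spoke leaving from 2 and 5. *)
Definition prism (k l : nat) : R :=
  ((k != l) && (k %/ 3 == l %/ 3)%N)%:R / 2 +
  [&& k != l, k %% 3 == l %% 3 & (k %% 3 < 2)]%N%:R.

Lemma prism_sym k l : prism k l = prism l k.
Proof.
rewrite /prism eq_sym [(k %/ 3 == _)%N]eq_sym [(k %% 3 == _)%N]eq_sym.
by case: (l %% 3 =P k %% 3)%N => [->|]; rewrite ?andbF.
Qed.

Lemma prism_diag k : prism k k = 0.
Proof. by rewrite /prism eqxx mul0r addr0. Qed.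

Lemma prism_ge0 k l : 0 <= prism k l.
Proof. by rewrite addr_ge0 ?divr_ge0 ?ler0n. Qed.

Lemma prism_deg (k : 'I_6) :
  \sum_(l < 6) prism k l + (k == 2 :> nat)%:R + (k == 5 :> nat)%:R = 2.
Proof.
rewrite !big_ord_recr big_ord0 /prism.
by case: k => -[|[|[|[|[|[|]]]]]] //= _; lra.
Qed.

(** A check of all 63 non-empty subsets. *)
Lemma prism_sub (c : 'I_6 -> bool) : [exists k, c k] ->
  \sum_(k < 6 | c k) \sum_(l < 6 | c l) prism k l <= ((\sum_(k < 6) c k)%N%:R - 1) *+ 2.
Proof.
pose d k := c (inord k).
have cd k : c k = d k by rewrite /d inord_val.
move=> /existsP[k0 ck0].
have : [|| d 0%N, d 1%N, d 2%N, d 3%N, d 4%N | d 5%N].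
  by move: ck0; rewrite cd; case: k0 => -[|[|[|[|[|[|]]]]]] //= _ ->; rewrite ?orbT.
rewrite (eq_bigr (fun k : 'I_6 => \sum_(l < 6) (d l)%:R * prism k l)); last first.
  move=> k _; rewrite big_mkcond; apply: eq_bigr => l _; rewrite cd.
  by case: (d l); rewrite ?mul1r ?mul0r.
rewrite big_mkcond (eq_bigr (fun k : 'I_6 => (d k)%:R * \sum_(l < 6) (d l)%:R * prism k l)); last first.
  by move=> k _; rewrite cd; case: (d k); rewrite ?mul1r ?mul0r.
rewrite (eq_bigr (fun k : 'I_6 => d k : nat) (F1 := fun k => c k : nat)); last by move=> k _; rewrite cd.
have : (2%:R^-1 : R) + 2%:R^-1 = 1 by field.
rewrite !big_ord_recr !big_ord0 /prism; move: (2%:R^-1) => h hh.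
rewrite /= !natrD.
by case: (d 0%N); case: (d 1%N); case: (d 2%N); case: (d 3%N); case: (d 4%N);
  case: (d 5%N) => //= _; rewrite mulr2n; lra.
Qed.

End Prism.

Section Gadgets.
Variables (R : realType) (n m : nat) (dd : 'I_n -> 'I_n -> R).
Implicit Types (pt : 'I_5 -> 'I_m -> 'I_n) (gamma Delta : R).

Definition outside pt x := forall p k, x != pt p k.

(* Three tour edges leaving the gadget could be improved by 2-opt. *)
Definition isolated pt := forall x1 x2 x3 p1 k1 p2 k2 p3 k3,
  outside pt x1 -> outside pt x2 -> outside pt x3 ->
  let a1 := pt p1 k1 in let a2 := pt p2 k2 in let a3 := pt p3 k3 in
  dd x1 a1 + dd x2 a2 <= dd x1 x2 + dd a1 a2 ->
  dd x2 a2 + dd x3 a3 <= dd x2 x3 + dd a2 a3 ->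
  dd x3 a3 + dd x1 a1 <= dd x3 x1 + dd a3 a1 -> False.

(** Serves twice: as the 2-opt exchange that lets an optimal tour enter a lobe only once, and as the
    gain of the 2-factor that closes the run through [p] and joins its two outer neighbours. *)
Definition separated pt gamma := forall p k l q k' r l', q != p -> r != p ->
  dd (pt q k') (pt r l') + dd (pt p k) (pt p l) + gamma <=
  dd (pt q k') (pt p k) + dd (pt r l') (pt p l).

Definition bounded_by pt Delta := forall p k q l, dd (pt p k) (pt q l) <= Delta.

Record gadget pt gamma Delta : Prop := Gadget {
  gadget_inj : forall p k q l, pt p k = pt q l -> p = q /\ k = l;
  gadget_iso : isolated pt;
  gadget_sep : separated pt gamma;
  gadget_diam : bounded_by pt Delta }.

End Gadgets.

(* The prism, attached through its vertices 2 and 5, beats every Hamiltonian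
   path of the lobe between two given vertices of other lobes. *)
Definition prism_gain (R : realType) (V : Type) (dd : V -> V -> R)
    (pt : 'I_5 -> 'I_6 -> V) gamma := forall p q k r l, q != p -> r != p ->
  exists a b : 'I_6, ((a = 2 :> nat /\ b = 5 :> nat) \/ (a = 5 :> nat /\ b = 2 :> nat)) /\
  forall rho : 'I_6 -> 'I_6, injective rho ->
  dd (pt q k) (pt p a) + dd (pt p b) (pt r l) +
    (\sum_(i < 6) \sum_(j < 6) dd (pt p i) (pt p j) * prism R i j) / 2 + gamma <=
  dd (pt q k) (pt p (rho ord0)) +
    \sum_(i < 5) dd (pt p (rho (inord i))) (pt p (rho (inord i.+1))) +
    dd (pt p (rho ord_max)) (pt r l).

Section OptimalCycle.
Variables (R : realType) (n : nat) (dd : 'I_n -> 'I_n -> R).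
Hypothesis dsym : forall x y, dd x y = dd y x.
Hypothesis n2 : (2 < n)%N.
Variable t : labeled_tree n.
Hypothesis ht : branching_tree t.

Lemma optimal_cycle : exists2 s, one_cycle s & forall q, one_cycle q ->
  \sum_x dd x (s x) <= \sum_x dd x (q x).
Proof.
have [F0 hF0] : exists F : {set edge n}, F \in tours finset.set0 finset.set0.
  case: (ht) => _ [I0 O0] _ _ _; apply/set0Pn.
  by have := vertex_tours_neq0 ht (Defs.root t); rewrite /vertex_tours I0 O0.
have tF0 : is_tour F0 by move: hF0; rewrite inE => /andP[].
case: (@arg_minP _ _ _ F0 (@is_tour n) (total_weight (edge_weight dd)) tF0) => F tF Fmin.
have cw q : one_cycle q -> total_weight (edge_weight dd) (pedges q) = \sum_x dd x (q x).
  move=> hq; apply: total_weight_pedges => // x; last exact: one_cycle_neq2.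
  by apply: one_cycle_neq => //; exact: ltnW.
have [s hs FE] := tour_perm n2 tF; exists s => // q hq.
by rewrite -!cw // -FE; apply: Fmin; exact: perm_tour.
Qed.

End OptimalCycle.

Section GadgetLeaves.
Variables (R : realType) (n m : nat) (dd : 'I_n -> 'I_n -> R).
Hypothesis dsym : forall x y, dd x y = dd y x.
Hypothesis dtri : forall x y z, dd x z <= dd x y + dd y z.
Hypothesis dxx : forall x, dd x x = 0.
Variables (G : finType) (pt : G -> 'I_5 -> 'I_m -> 'I_n) (gamma Delta : R).
Hypotheses (m2 : (2 < m)%N) (mn : (m.+2 < n)%N) (g0 : 0 < gamma) (D0 : 0 <= Delta).
Hypothesis ptG : forall j, gadget dd (pt j) gamma Delta.
Hypothesis pt_disj : forall i j p k q l, pt i p k = pt j q l -> i = j.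

Variables (t : labeled_tree n).
Hypothesis ht : branching_tree t.
Variable H : {set edge n} -> {set edge n} -> {set edge n}.
Hypothesis hH : forall I O, tours I O != finset.set0 -> H I O \in tours I O.

Definition gadget_set j : {set 'I_n} := [set pt j a.1 a.2 | a in {: 'I_5 * 'I_m}]%SET.
Definition gadget_lobe j p : {set 'I_n} := [set pt j p k | k in 'I_m]%SET.

Lemma gadget_setP j x : reflect (exists p k, x = pt j p k) (x \in gadget_set j).
Proof.
apply: (iffP imsetP) => [[[p k] _ ->]|[p [k ->]]]; first by exists p, k.
by exists (p, k).
Qed.

Lemma gadget_lobeP j p x : reflect (exists k, x = pt j p k) (x \in gadget_lobe j p).
Proof. by apply: (iffP imsetP) => [[k _ ->]|[k ->]]; exists k. Qed.

Lemma gadget_set_disj j k x : x \in gadget_set j -> x \in gadget_set k -> j = k.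
Proof. by move=> /gadget_setP[p [a ->]] /gadget_setP[q [b]] /pt_disj. Qed.

Lemma card_gadget_lobe j p : #|gadget_lobe j p| = m.
Proof.
rewrite card_imset ?card_ord // => k l /(gadget_inj (ptG j))[] //.
Qed.

Lemma card_gadget_set j : #|gadget_set j| = (5 * m)%N.
Proof.
rewrite card_imset ?card_prod ?card_ord // => -[p k] [q l] /= /(gadget_inj (ptG j)).
by case=> -> ->.
Qed.

Lemma gadget_runs s : one_cycle s ->
  (forall q, one_cycle q -> \sum_x dd x (s x) <= \sum_x dd x (q x)) ->
  exists p : G -> 'I_5, exists u : G -> 'I_n, forall j,
  [/\ lobe m s u j = gadget_lobe j (p j), u j \in gadget_set j /\ u j \notin gadget_lobe j (p j),
      pos s u j m.+1 \in gadget_set j /\ pos s u j m.+1 \notin gadget_lobe j (p j)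
    & forall i, (i <= m.+1)%N -> pos s u j i \in gadget_set j].
Proof.
move=> hs sopt.
have run j : exists a : 'I_5 * 'I_n, [/\ a.2 \in gadget_set j, a.2 \notin gadget_lobe j a.1,
    gadget_lobe j a.1 = [set x in traject s (s a.2) m]%SET &
    iter m.+1 s a.2 \in gadget_set j /\ iter m.+1 s a.2 \notin gadget_lobe j a.1].
  have [|||||||p [u hu]] := @gadget_run R n dd s dsym hs sopt m (gadget_set j) (gadget_lobe j) gamma.
  - exact: leq_trans m2.
  - by [].
  - move=> p; apply/fintype.subsetP => x /gadget_lobeP[k ->].
    by apply/gadget_setP; exists p, k.
  - by move=> p q x /gadget_lobeP[k ->] /gadget_lobeP[l /(gadget_inj (ptG j))[]].
  - exact: card_gadget_lobe.
  - have out x : x \notin gadget_set j -> outside (pt j) x.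
      move=> xS p k; apply: contra xS => /eqP ->.
      by apply/gadget_setP; exists p, k.
    move=> x1 x2 x3 a1 a2 a3 /out o1 /out o2 /out o3.
    move=> /gadget_setP[p1 [k1 ->]] /gadget_setP[p2 [k2 ->]] /gadget_setP[p3 [k3 ->]].
    exact: (gadget_iso (ptG j) o1 o2 o3).
  - move=> p a b x y /gadget_lobeP[k ->] /gadget_lobeP[l ->].
    move=> /gadget_setP[q [k' ->]] /gadget_setP[r [l' ->]] hq hr.
    apply: (gadget_sep (ptG j)).
      by apply: contra hq => /eqP ->; apply/gadget_lobeP; exists k'.
    by apply: contra hr => /eqP ->; apply/gadget_lobeP; exists l'.
  by exists (p, u).
have [f fP] := fin_all_exists run.
exists (fun j => (f j).1), (fun j => (f j).2) => j.
have [uS uL LE [vS vL]] := fP j.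
split=> // -[|i] im; first exact: uS.
move: im; rewrite ltnS leq_eqVlt => /orP[/eqP -> //|im].
have : pos s (fun j => (f j).2) j i.+1 \in gadget_lobe j (f j).1.
  by rewrite LE inE /pos iterSr; apply/trajectP; exists i.
by case/gadget_lobeP => k ->; apply/gadget_setP; exists (f j).1, k.
Qed.

Let rate := gamma / ((m.+1)%:R * Delta *+ 2 + gamma) / (m.+1)`!%:R.

Lemma gadget_diamS j x y : x \in gadget_set j -> y \in gadget_set j -> dd x y <= Delta.
Proof.
by move=> /gadget_setP[p [k ->]] /gadget_setP[q [l ->]]; exact: (gadget_diam (ptG j)).
Qed.

Theorem leaves_TF g (D : {set vertex t}) : (g <= m)%N ->
  pruned_tree (edge_weight dd) H (TF (edge_weight dd) g) D ->
  expR (rate * #|G|%:R) <= #|leaves D|%:R.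
Proof.
move=> gm hD; have n2 : (2 < n)%N by exact: ltn_trans m2 (ltnW (ltnW mn)).
have [s hs sopt] := optimal_cycle dsym n2 ht.
have [p [u hu]] := gadget_runs hs sopt.
have posS j i : (i <= m.+1)%N -> pos s u j i \in gadget_set j by case: (hu j) => _ _ _; apply.
apply: (leaves_ge m2 mn hs gadget_set_disj posS dsym dtri dxx gadget_diamS sopt D0 g0 _ ht hH hD).
move=> I O q J hq run Jfree qIO.
apply: (TF_le_cut m2 mn hs gm gadget_set_disj posS _ dsym _ hq run Jfree qIO).
  by move=> j; rewrite card_gadget_set leq_mul2r orbT.
move=> j; have [LE [uS uL] [vS vL] _] := hu j.
have inL i : (0 < i <= m)%N -> pos s u j i \in gadget_lobe j (p j).
  by case: i => // i im; rewrite -LE; apply/lobeP; exists i.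
have /gadget_lobeP[k kE] := inL 1%N ltac:(lia).
have /gadget_lobeP[l lE] := inL m ltac:(lia).
move: uS uL vS vL => /gadget_setP[a [k' ->]] aL /gadget_setP[b [l' ->]] bL.
have ap : a != p j by apply: contra aL => /eqP ->; apply/gadget_lobeP; exists k'.
have bp : b != p j by apply: contra bL => /eqP ->; apply/gadget_lobeP; exists l'.
rewrite kE lE [dd (pt j (p j) l) (pt j (p j) k)]dsym [dd (pt j (p j) l) (pt j b l')]dsym.
exact: (gadget_sep (ptG j)).
Qed.

End GadgetLeaves.

Section PrismLeaves.
Variables (R : realType) (n : nat) (dd : 'I_n -> 'I_n -> R).
Hypothesis dsym : forall x y, dd x y = dd y x.
Hypothesis dtri : forall x y z, dd x z <= dd x y + dd y z.
Hypothesis dxx : forall x, dd x x = 0.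
Variables (G : finType) (pt : G -> 'I_5 -> 'I_6 -> 'I_n) (gamma Delta : R).
Hypotheses (mn : (8 < n)%N) (g0 : 0 < gamma) (D0 : 0 <= Delta).
Hypothesis ptG : forall j, gadget dd (pt j) gamma Delta.
Hypothesis pt_disj : forall i j p k q l, pt i p k = pt j q l -> i = j.
Hypothesis ptP : forall j, prism_gain dd (pt j) gamma.

Variables (t : labeled_tree n).
Hypothesis ht : branching_tree t.
Variable H : {set edge n} -> {set edge n} -> {set edge n}.
Hypothesis hH : forall I O, tours I O != finset.set0 -> H I O \in tours I O.

Let m2 : (2 < 6)%N. Proof. by []. Qed.

Theorem leaves_HK (D : {set vertex t}) :
  pruned_tree (edge_weight dd) H (HK (edge_weight dd)) D ->
  expR (gamma / (7%:R * Delta *+ 2 + gamma) / (7`!)%:R * #|G|%:R) <= #|leaves D|%:R.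
Proof.
move=> hD; have n2 : (2 < n)%N by exact: leq_trans mn.
have [s hs sopt] := optimal_cycle dsym n2 ht.
have [p [u hu]] := gadget_runs dsym m2 g0 ptG hs sopt.
have posS j i : (i <= 7)%N -> pos s u j i \in gadget_set pt j by case: (hu j) => _ _ _; apply.
have disj := gadget_set_disj pt_disj.
have inj j q k l : pt j q k = pt j q l -> k = l by move=> /(gadget_inj (ptG j))[].
pose lb j := lobe 6 s u j.
have lbP j x : reflect (exists k, x = pt j (p j) k) (x \in lb j).
  by rewrite /lb; case: (hu j) => -> _ _ _; exact: gadget_lobeP.
pose sl j x : 'I_6 := odflt ord0 [pick k | pt j (p j) k == x].
have slE j k : sl j (pt j (p j) k) = k.
  by rewrite /sl; case: pickP => [l /eqP /inj //|/(_ k)]; rewrite eqxx.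
have slK j x : x \in lb j -> pt j (p j) (sl j x) = x by case/lbP => k ->; rewrite slE.
pose y j a b : R := if (a \in lb j) && (b \in lb j) then prism R (sl j a) (sl j b) else 0.
have sumL j (F : 'I_n -> R) : \sum_(x in lb j) F x = \sum_(k < 6) F (pt j (p j) k).
  have -> : lb j = [set pt j (p j) k | k in 'I_6]%SET.
    by apply/setP => x; apply/lbP/imsetP => [[k ->]|[k _ ->]]; exists k.
  by rewrite big_imset //= => k l _ _ /inj.
have ptL j k : pt j (p j) k \in lb j by apply/lbP; exists k.
have run_mem j (i : 'I_6) : pos s u j i.+1 \in lb j.
  by apply/lobeP; exists (val i); rewrite ?ltn_ord.
(* Whether vertex 2 or vertex 5 of the prism is attached to [u j] depends on the places of [u j] and
   of the exit in the gadget. *)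
have [f fP] : exists f : G -> 'I_6 * 'I_6, forall j, let a := (f j).1 in let b := (f j).2 in
    ((a = 2 :> nat /\ b = 5 :> nat) \/ (a = 5 :> nat /\ b = 2 :> nat)) /\
    dd (u j) (pt j (p j) a) + dd (pt j (p j) b) (pos s u j 7) +
      (\sum_(c in lb j) \sum_(e in lb j) dd c e * y j c e) / 2 + gamma <=
    \sum_(i < 7) dd (pos s u j i) (pos s u j i.+1).
  apply: (fin_all_exists (P := fun j (ab : 'I_6 * 'I_6) => let a := ab.1 in let b := ab.2 in
    ((a = 2 :> nat /\ b = 5 :> nat) \/ (a = 5 :> nat /\ b = 2 :> nat)) /\
    dd (u j) (pt j (p j) a) + dd (pt j (p j) b) (pos s u j 7) +
      (\sum_(c in lb j) \sum_(e in lb j) dd c e * y j c e) / 2 + gamma <=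
    \sum_(i < 7) dd (pos s u j i) (pos s u j i.+1))) => j.
  have [LE [uS uL] [vS vL] _] := hu j.
  move: uS uL vS vL => /gadget_setP[q [k uE]] uL /gadget_setP[r [l vE]] vL.
  have qp : q != p j.
    by apply: contra uL => /eqP <-; apply/gadget_lobeP; exists k.
  have rp : r != p j.
    by apply: contra vL => /eqP <-; apply/gadget_lobeP; exists l.
  have [a [b [ab gain]]] := @ptP j (p j) q k r l qp rp; exists (a, b); split=> //=.
  pose rho (i : 'I_6) := sl j (pos s u j i.+1).
  have rhoE i : pt j (p j) (rho i) = pos s u j i.+1 by rewrite slK.
  have rinj : injective rho.
    move=> i i' /(congr1 (pt j (p j))); rewrite !rhoE => /eqP.
    have := ltn_ord i; have := ltn_ord i' => h h'.
    by rewrite pos_eq //; [move=> /eqP [] /val_inj|lia|lia].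
  have := gain rho rinj; rewrite !rhoE -uE -vE.
  rewrite sumL.
  have -> : \sum_(c < 6) \sum_(e in lb j) dd (pt j (p j) c) e * y j (pt j (p j) c) e =
      \sum_(c < 6) \sum_(e < 6) dd (pt j (p j) c) (pt j (p j) e) * prism R c e.
    apply: eq_bigr => c _; rewrite sumL; apply: eq_bigr => e _.
    by rewrite /y !ptL /= !slE.
  have -> : \sum_(i < 7) dd (pos s u j i) (pos s u j i.+1) =
      dd (u j) (pos s u j 1) + \sum_(i < 5) dd (pos s u j i.+1) (pos s u j i.+2) +
      dd (pos s u j 6) (pos s u j 7).
    by rewrite big_ord_recr big_ord_recl.
  rewrite (eq_bigr (fun i : 'I_5 => dd (pos s u j i.+1) (pos s u j i.+2))) // => i _.
  have i5 := ltn_ord i; have i6 : (i < 6)%N by lia.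
  have i6' : (i.+1 < 6)%N by lia.
  by rewrite !rhoE (inordK i6) (inordK i6').
have y1 j a b : y j a b = y j b a by rewrite /y andbC prism_sym.
have y2 j a : y j a a = 0 by rewrite /y prism_diag if_same.
have y3 j a b : 0 <= y j a b by rewrite /y; case: ifP => // _; exact: prism_ge0.
have y4 j a : a \in lobe 6 s u j -> \sum_(b in lobe 6 s u j) y j a b +
    (a == pt j (p j) (f j).1)%:R + (a == pt j (p j) (f j).2)%:R = 2.
  move=> aL; have [k ->] := lbP _ _ aL; rewrite -/(lb j) sumL.
  have eqk l : (pt j (p j) k == pt j (p j) l) = (k == l).
    by apply/eqP/eqP => [/inj|->].
  rewrite !eqk -[RHS](prism_deg R k).
  have -> : \sum_(l < 6) y j (pt j (p j) k) (pt j (p j) l) = \sum_(l < 6) prism R k l.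
    by apply: eq_bigr => l _; rewrite /y !ptL /= !slE.
  case: (fP j) => -[[a2 b5]|[a5 b2]] _; rewrite -!val_eqE /=.
    by rewrite a2 b5.
  by rewrite a5 b2 addrAC.
have y5 j A : A != finset.set0 -> A \subset lobe 6 s u j ->
    msum (y j) A A <= (#|A|%:R - 1) *+ 2.
  move=> A0 /fintype.subsetP AL.
  pose c (k : 'I_6) := pt j (p j) k \in A.
  have sumA (F : 'I_n -> R) : \sum_(x in A) F x = \sum_(k < 6 | c k) F (pt j (p j) k).
    have -> : A = [set pt j (p j) k | k in c]%SET.
      apply/setP => x; apply/idP/imsetP => [xA|[k kc ->] //].
      have [k xE] := lbP _ _ (AL x xA); exists k => //.
      by rewrite unfold_in /c -xE.
    by rewrite big_imset //= => k l _ _ /inj.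
  have cA : #|A| = (\sum_(k < 6) c k)%N.
    have -> : A = [set pt j (p j) k | k in c]%SET.
      apply/setP => x; apply/idP/imsetP => [xA|[k kc ->] //].
      have [k xE] := lbP _ _ (AL x xA); exists k => //.
      by rewrite unfold_in /c -xE.
    rewrite card_in_imset => [|k l _ _ /inj //].
    rewrite -sum1_card big_mkcond /=; apply: eq_bigr => k _.
    by rewrite (_ : (k \in c) = c k) //; case: (c k).
  rewrite cA /msum sumA.
  apply: le_trans (prism_sub R (c := c) _); last first.
    have [x xA] : exists x, x \in A by exact/set0Pn.
    have [k xE] := lbP _ _ (AL x xA); apply/existsP; exists k.
    by rewrite /c -xE.
  rewrite le_eqVlt; apply/orP; left; apply/eqP; apply: eq_bigr => k _.
  by rewrite sumA; apply: eq_bigr => l _; rewrite /y !ptL /= !slE.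
apply: (leaves_ge m2 mn hs disj posS dsym dtri dxx (gadget_diamS ptG) sopt D0 g0 _ ht hH hD).
move=> I O q J hq run Jfree qIO.
apply: (HK_le_upds m2 mn hs disj posS dsym dxx y1 y2 y3 _ _ y4 y5 _ hq run Jfree qIO).
- by move=> j; exact: ptL.
- by move=> j; exact: ptL.
- by move=> j; case: (fP j).
Qed.

End PrismLeaves.

(** * Euclidean gadgets *)

Section EuclideanNorm.
Variables (R : realType) (d : nat).
Implicit Types (f g : 'I_d -> R) (x y z : d.-tuple R).

Definition dot f g : R := \sum_k f k * g k.
Definition nrm f : R := Num.sqrt (\sum_k f k ^+ 2).

Lemma nrm_ge0 f : 0 <= nrm f. Proof. exact: sqrtr_ge0. Qed.

Lemma nrm_sqr f : nrm f ^+ 2 = \sum_k f k ^+ 2.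
Proof. by rewrite sqr_sqrtr // sumr_ge0 // => k _; exact: sqr_ge0. Qed.

Lemma eq_nrm f g : f =1 g -> nrm f = nrm g.
Proof. by move=> fg; congr Num.sqrt; apply: eq_bigr => k _; rewrite fg. Qed.

Lemma nrmZ a f : 0 <= a -> nrm (fun k => a * f k) = a * nrm f.
Proof.
move=> a0; rewrite /nrm.
under eq_bigr do rewrite exprMn.
by rewrite -mulr_sumr sqrtrM ?sqr_ge0 // sqrtr_sqr ger0_norm.
Qed.

Lemma nrmN f : nrm (fun k => - f k) = nrm f.
Proof. by congr Num.sqrt; apply: eq_bigr => k _; rewrite sqrrN. Qed.

Lemma nrm_lincomb f g a b : nrm (fun k => a * f k + b * g k) ^+ 2 =
  a ^+ 2 * nrm f ^+ 2 + b ^+ 2 * nrm g ^+ 2 + 2 * (a * b * dot f g).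
Proof.
rewrite !nrm_sqr /dot !mulr_sumr -!big_split /=; apply: eq_bigr => k _; ring.
Qed.

Lemma dot_le f g : dot f g <= nrm f * nrm g.
Proof.
have [f0|f0] := eqVneq (nrm f) 0.
  have fk k : f k = 0.
    have : \sum_k f k ^+ 2 = 0 by rewrite -nrm_sqr f0 expr0n.
    by move/psumr_eq0P => /(_ (fun i _ => sqr_ge0 _) k isT) /eqP; rewrite sqrf_eq0 => /eqP.
  by rewrite /dot big1 ?mulr_ge0 ?nrm_ge0 // => k _; rewrite fk mul0r.
have [g0|g0] := eqVneq (nrm g) 0.
  have gk k : g k = 0.
    have : \sum_k g k ^+ 2 = 0 by rewrite -nrm_sqr g0 expr0n.
    by move/psumr_eq0P => /(_ (fun i _ => sqr_ge0 _) k isT) /eqP; rewrite sqrf_eq0 => /eqP.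
  by rewrite /dot big1 ?mulr_ge0 ?nrm_ge0 // => k _; rewrite gk mulr0.
have fp : 0 < nrm f by rewrite lt_def f0 nrm_ge0.
have gp : 0 < nrm g by rewrite lt_def g0 nrm_ge0.
have := sqr_ge0 (nrm (fun k => nrm g * f k + (- nrm f) * g k)).
rewrite nrm_lincomb.
rewrite (_ : _ + _ = (2 * (nrm f * nrm g)) * (nrm f * nrm g - dot f g)); last by ring.
by rewrite pmulr_rge0 ?subr_ge0 // mulr_gt0 // mulr_gt0.
Qed.

Lemma nrmD f g : nrm (fun k => f k + g k) <= nrm f + nrm g.
Proof.
rewrite -(ler_pXn2r (n := 2)) ?nnegrE ?addr_ge0 ?nrm_ge0 //.
have -> : nrm (fun k => f k + g k) ^+ 2 = nrm f ^+ 2 + nrm g ^+ 2 + 2 * dot f g.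
  rewrite !nrm_sqr /dot mulr_sumr -!big_split /=; apply: eq_bigr => k _; ring.
have := dot_le f g; rewrite sqrrD; lra.
Qed.

Lemma nrm_coord f k : `|f k| <= nrm f.
Proof.
rewrite -(ler_pXn2r (n := 2)) ?nnegrE ?nrm_ge0 // nrm_sqr real_normK ?num_real //.
by rewrite (bigD1 k) //= lerDl sumr_ge0 // => i _; exact: sqr_ge0.
Qed.

Lemma nrm_le_sum f : nrm f <= \sum_k `|f k|.
Proof.
have s0 : 0 <= \sum_k `|f k| by apply: sumr_ge0.
rewrite -(ler_pXn2r (n := 2)) ?nnegrE ?nrm_ge0 // nrm_sqr expr2 mulr_suml.
apply: ler_sum => k _; rewrite -[f k ^+ 2]real_normK ?num_real // expr2.
by rewrite ler_wpM2l // (bigD1 k) //= lerDl sumr_ge0.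
Qed.

Lemma euclidean_distE x y : euclidean_dist x y = nrm (fun k => tnth x k - tnth y k).
Proof. by []. Qed.

Lemma euclidean_dist_sym x y : euclidean_dist x y = euclidean_dist y x.
Proof.
rewrite !euclidean_distE -nrmN; apply: eq_nrm => k; exact: opprB.
Qed.

Lemma euclidean_dist_tri x y z :
  euclidean_dist x z <= euclidean_dist x y + euclidean_dist y z.
Proof.
rewrite !euclidean_distE; apply: le_trans (nrmD _ _).
by rewrite le_eqVlt; apply/orP; left; apply/eqP/eq_nrm => k; rewrite addrA subrK.
Qed.

Lemma euclidean_dist_xx x : euclidean_dist x x = 0.
Proof.
by rewrite euclidean_distE /nrm big1 ?sqrtr0 // => k _; rewrite subrr expr0n.
Qed.

(* Three unit vectors cannot be pairwise almost opposite. *)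
Lemma three_directions f1 f2 f3 (D e : R) : 0 <= e -> 4 * e < D ->
  D <= nrm f1 -> D <= nrm f2 -> D <= nrm f3 ->
  nrm f1 + nrm f2 <= nrm (fun k => f1 k - f2 k) + e ->
  nrm f2 + nrm f3 <= nrm (fun k => f2 k - f3 k) + e ->
  nrm f3 + nrm f1 <= nrm (fun k => f3 k - f1 k) + e -> False.
Proof.
move=> e0 eD h1 h2 h3 h12 h23 h31.
have D0 : 0 < D by lra.
pose sc f k := D / nrm f * f k.
(* Shortening both vectors to length [D] takes [nrm f + nrm g - 2 D] off the sum of their lengths
   and, by the triangle inequality, at most as much off the length of the difference; so the error
   [e] does not grow. *)
have key f g : D <= nrm f -> D <= nrm g ->
    nrm f + nrm g <= nrm (fun k => f k - g k) + e ->
    2 * D - e <= nrm (fun k => sc f k - sc g k).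
  move=> hf hg hfg.
  have fp : 0 < nrm f by lra.
  have gp : 0 < nrm g by lra.
  have E w : D <= nrm w -> nrm (fun k => (1 - D / nrm w) * w k) = nrm w - D.
    move=> hw; have wp : 0 < nrm w by lra.
    rewrite nrmZ; first by rewrite mulrBl mul1r divfK // gt_eqF.
    by rewrite subr_ge0 ler_pdivrMr // mul1r.
  have : nrm (fun k => f k - g k) <= nrm (fun k => (1 - D / nrm f) * f k) +
      (nrm (fun k => sc f k - sc g k) + nrm (fun k => (1 - D / nrm g) * g k)).
    rewrite -[X in _ <= _ + (_ + X)]nrmN.
    apply: le_trans (_ : nrm (fun k => (1 - D / nrm f) * f k +
      ((sc f k - sc g k) + - ((1 - D / nrm g) * g k))) <= _).
      by rewrite le_eqVlt; apply/orP; left; apply/eqP/eq_nrm => k; rewrite /sc; ring.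
    by apply: le_trans (nrmD _ _) _; rewrite lerD2l; exact: nrmD.
  rewrite !E //; lra.
have scD f : D <= nrm f -> nrm (sc f) = D.
  move=> hf; have fp : 0 < nrm f by lra.
  by rewrite nrmZ ?divfK ?gt_eqF // divr_ge0 // ltW.
have k12 := key _ _ h1 h2 h12; have k23 := key _ _ h2 h3 h23; have k31 := key _ _ h3 h1 h31.
have sq a : 2 * D - e <= a -> 3 * D ^+ 2 < a ^+ 2.
  move=> ha; have : (7 / 4 * D) ^+ 2 <= a ^+ 2.
    by rewrite ler_pXn2r ?nnegrE //; lra.
  have : 0 < D ^+ 2 by rewrite exprn_gt0.
  rewrite exprMn; lra.
(* For vectors of length [D] the right-hand side is [9 D^2], but each of the first three squares
   exceeds [3 D^2], because [2 D - e > 7/4 D] and [(7/4)^2 > 3]. *)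
have : nrm (fun k => sc f1 k - sc f2 k) ^+ 2 + nrm (fun k => sc f2 k - sc f3 k) ^+ 2 +
   nrm (fun k => sc f3 k - sc f1 k) ^+ 2 + nrm (fun k => sc f1 k + sc f2 k + sc f3 k) ^+ 2 =
   3 * (nrm (sc f1) ^+ 2 + nrm (sc f2) ^+ 2 + nrm (sc f3) ^+ 2).
  rewrite !nrm_sqr -!big_split /= mulr_sumr; apply: eq_bigr => k _; ring.
rewrite !scD //.
have := sq _ k12; have := sq _ k23; have := sq _ k31.
have := sqr_ge0 (nrm (fun k => sc f1 k + sc f2 k + sc f3 k)); lra.
Qed.

End EuclideanNorm.

Lemma box_end b a c e : (a < c - e)%N -> (e + (b + a).+1 <= b + c)%N.
Proof. lia. Qed.

Section Template.
Variables (R : realType) (d m : nat) (zx zy : 'I_5 -> 'I_m -> nat).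
Hypothesis hd : (2 <= d)%N.

Definition ideal_dist p k q l : R :=
  Num.sqrt (((zx p k)%:R - (zx q l)%:R) ^+ 2 + ((zy p k)%:R - (zy q l)%:R) ^+ 2).

(** [lo] and [hi] bound the distances between lobes and [cc] the diameter of a lobe; the last
    inequality yields [separated] with gain [eta] for the ideal points. *)
Definition ideal_separated (lo hi cc eta : R) : Prop :=
  [/\ forall p k q l, q != p -> lo <= ideal_dist p k q l <= hi,
      forall p k l, ideal_dist p k p l <= cc, cc <= hi, 0 < eta & hi + cc + eta <= lo *+ 2].

Variables (lam mg W0 : nat).

(* The template is scaled by [lam]; the shift by [k] puts the points of a lobe
   in distinct boxes, and [mg] is the width of the empty margin. *)
Definition slot_box p k (c : 'I_d) : nat :=
  (mg + (if c == 0 :> nat then lam * zx p k + k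
         else if c == 1 :> nat then lam * zy p k else 0))%N.

Definition cell_size : nat := (2 * mg + (lam * W0 + m) + 1)%N.

Hypothesis zxW : forall p k, (zx p k <= W0)%N.
Hypothesis zyW : forall p k, (zy p k <= W0)%N.

Lemma slot_box_le p k c : (slot_box p k c < cell_size - mg)%N.
Proof.
rewrite /slot_box /cell_size.
have hx : (lam * zx p k <= lam * W0)%N by rewrite leq_mul2l zxW orbT.
have hy : (lam * zy p k <= lam * W0)%N by rewrite leq_mul2l zyW orbT.
have := ltn_ord k; case: ifP => _; [|case: ifP => _]; lia.
Qed.

(** In units of a box, each difference of coordinates is off by at most 1 because of the places
    within the boxes, and the first one by up to [m - 1] more because of the shifts by [k]. The sum
    over the coordinates bounds the error of a distance. *)
Definition err : R := (m + d)%:R.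

Variables (h lo hi cc eta : R) (base : 'I_d -> nat).
Hypothesis h0 : 0 < h.
Hypothesis sepZ : ideal_separated lo hi cc eta.
(** Half of the ideal gain [lam * eta] is kept as [gad_gamma]; the other half has to cover 4 times
    [err] in the separation and 15 times [err] in the prism inequality, hence 32. The factor 13
    makes the margin exceed [4 * 3] gadget diameters, as [three_directions] demands for
    [e = 3 * gad_delta]. *)
Hypotheses (lam_eta : 32 * err <= lam%:R * eta) (lam_m : (m < lam)%N).
Hypothesis mg_big : (13 * (lam * (2 * W0) + (m + d)) <= mg)%N.

Variables (n : nat) (x : 'I_n -> d.-tuple R) (pt : 'I_5 -> 'I_m -> 'I_n).
Hypothesis ptP : forall p k c,
  h * (base c + slot_box p k c)%:R <= tnth (x (pt p k)) c < h * (base c + slot_box p k c).+1%:R.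
Hypothesis outP : forall i, outside pt i -> exists c,
  (tnth (x i) c < h * (base c)%:R) \/ (h * (base c + cell_size)%:R <= tnth (x i) c).

Notation dd := (fun i j => euclidean_dist (x i) (x j)).

Let c0 : 'I_d := Ordinal (ltnW hd).
Let c1 : 'I_d := Ordinal hd.

Lemma dist_ideal p k q l :
  h * (lam%:R * ideal_dist p k q l - err) <= dd (pt p k) (pt q l) <=
  h * (lam%:R * ideal_dist p k q l + err).
Proof.
pose Z (c : 'I_d) : R := if c == 0 :> nat then (zx p k)%:R - (zx q l)%:R
  else if c == 1 :> nat then (zy p k)%:R - (zy q l)%:R else 0.
have ZE : nrm Z = ideal_dist p k q l.
  congr Num.sqrt; rewrite (bigD1 c0) //= (bigD1 c1) //= big1 ?addr0 //.
  move=> c /andP[cc0 cc1]; rewrite /Z; case: eqP => [e|_].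
    by move: cc0; rewrite -val_eqE /= e.
  case: eqP => [e|_]; last by rewrite expr0n.
  by move: cc1; rewrite -val_eqE /= e.
pose v c := tnth (x (pt p k)) c - tnth (x (pt q l)) c.
pose r c := v c / h - lam%:R * Z c.
have rb c : `|r c| <= (c == c0)%:R * m%:R + 1.
  have sc (a b z : R) : h * a <= z < h * b -> a <= z / h < b.
    by rewrite ler_pdivlMr // ltr_pdivrMr // ![_ * h]mulrC.
  move: (sc _ _ _ (ptP p k c)) (sc _ _ _ (ptP q l c)).
  rewrite /r /v mulrBl -!natr1 !natrD; move: (_ / h) (_ / h) => a b.
  have kl : `|k%:R - l%:R| <= m%:R - 1 :> R.
    have hk : k%:R <= m%:R - 1 :> R.
      by rewrite lerBrDr natr1 ler_nat.
    have hl : l%:R <= m%:R - 1 :> R.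
      by rewrite lerBrDr natr1 ler_nat.
    have k0 : 0 <= k%:R :> R by [].
    have l0 : 0 <= l%:R :> R by [].
    rewrite ler_norml; lra.
  move: kl; rewrite !ler_norml /slot_box /Z -val_eqE /=.
  have [_|_] := eqVneq (val c) 0%N.
    rewrite !natrD !natrM => /andP[kl1 kl2] /andP[h1 h2] /andP[h3 h4]; rewrite (_ : true%:R = 1 :> R) // mul1r; lra.
  have m1 : 1 <= m%:R :> R by rewrite ler1n (leq_ltn_trans _ (ltn_ord k)).
  have [_|_] := eqVneq (val c) 1%N;
    rewrite ?addn0 ?natrD ?natrM => _ /andP[h1 h2] /andP[h3 h4]; rewrite (_ : false%:R = 0 :> R) // mul0r; lra.
have rn : nrm r <= err.
  apply: le_trans (nrm_le_sum r) _.
  apply: le_trans (ler_sum _ (fun c _ => rb c)) _.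
  have s1 : \sum_c (c == c0)%:R = 1 :> R.
    rewrite (bigD1 c0) // eqxx big1 /= ?addr0 // => c /negbTE cc0.
    by rewrite -[c == c0]/(c == c0 :> 'I_d) cc0.
  by rewrite big_split /= sumr_const card_ord -mulr_suml s1 mul1r /err natrD.
have vE : dd (pt p k) (pt q l) = h * nrm (fun c => lam%:R * Z c + r c).
  rewrite -nrmZ ?(ltW h0) //; apply: eq_nrm => c.
  by rewrite /r addrCA subrr addr0 mulrCA divff ?mulr1 // gt_eqF.
have lZ : nrm (fun c => lam%:R * Z c) = lam%:R * ideal_dist p k q l.
  by rewrite nrmZ ?ZE.
rewrite vE !ler_pM2l //; apply/andP; split.
  have : nrm (fun c => lam%:R * Z c) <= nrm (fun c => lam%:R * Z c + r c) + nrm r.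
    rewrite -[nrm r]nrmN; apply: le_trans (nrmD _ _).
    by rewrite le_eqVlt; apply/orP; left; apply/eqP/eq_nrm => c; rewrite addrK.
  rewrite lZ; lra.
apply: le_trans (nrmD _ _) _; rewrite lZ; lra.
Qed.

Lemma ideal_dist_le p k q l : ideal_dist p k q l <= (2 * W0)%:R.
Proof.
have b (a e : nat) : (a <= W0)%N -> (e <= W0)%N -> (a%:R - e%:R) ^+ 2 <= W0%:R ^+ 2 :> R.
  move=> ha he; rewrite -[leLHS]real_normK ?num_real // ler_pXn2r ?nnegrE // ler_norml.
  have h1 : a%:R <= W0%:R :> R by rewrite ler_nat.
  have h2 : e%:R <= W0%:R :> R by rewrite ler_nat.
  have h3 : 0 <= a%:R :> R by [].
  have h4 : 0 <= e%:R :> R by [].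
  lra.
rewrite -[leRHS](ger0_norm (ler0n _ _)) -sqrtr_sqr; apply: ler_wsqrtr.
apply: le_trans (lerD (b _ _ (zxW p k) (zxW q l)) (b _ _ (zyW p k) (zyW q l))) _.
have : 0 <= W0%:R ^+ 2 :> R by apply: sqr_ge0.
rewrite natrM exprMn; lra.
Qed.

Definition gad_gamma : R := h * (lam%:R * eta / 2).
Definition gad_delta : R := h * (lam * (2 * W0) + (m + d))%:R.

Lemma err_ge0 : 0 <= err. Proof. exact: ler0n. Qed.

Lemma err_gt0 : 0 < err. Proof. by rewrite ltr0n addn_gt0 (ltnW hd) orbT. Qed.

Lemma template_gadget : gadget dd pt gad_gamma gad_delta.
Proof.
case: sepZ => Zlo Zcc cchi eta0 Zsum.
have e0 := err_gt0.
have diam p k q l : dd (pt p k) (pt q l) <= gad_delta.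
  have /andP[_ h2] := dist_ideal p k q l; apply: le_trans h2 _.
  rewrite /gad_delta ler_pM2l // natrD natrM lerD // ler_wpM2l //.
  exact: ideal_dist_le.
split.
- move=> p k q l E.
  have pq : p = q.
    apply/eqP/negPn/negP => pq.
    have /andP[+ _] := dist_ideal p k q l; rewrite E euclidean_dist_xx.
    rewrite pmulr_rle0 // => h1.
    have /andP[z1 z2] := Zlo p k q l ltac:(by rewrite eq_sym).
    have cc0 : 0 <= cc by apply: le_trans (Zcc p k k); exact: sqrtr_ge0.
    have : lam%:R * eta <= lam%:R * lo by apply: ler_wpM2l => //; lra.
    have : lam%:R * lo <= lam%:R * ideal_dist p k q l by apply: ler_wpM2l.
    move: lam_eta h1 e0; rewrite subr_le0 => le1 h1 e0 le2 le3; lra.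
  split=> //; subst q.
  have := ptP p k c0; have := ptP p l c0; rewrite E => /andP[h1 h2] /andP[h3 h4].
  have := le_lt_trans h1 h4; have := le_lt_trans h3 h2.
  rewrite !ltr_pM2l // !ltr_nat !ltnS !leq_add2l /slot_box /= ?leq_add2l => h5 h6.
  have h7 : (lam * zx p k + k)%N = (lam * zx p l + l)%N.
    by apply/eqP; rewrite eqn_leq h5 h6.
  apply/val_inj => /=; have := congr1 (modn^~ lam) h7.
  rewrite /= ![(lam * _)%N]mulnC !modnMDl !modn_small //.
    exact: ltn_trans (ltn_ord l) lam_m.
  exact: ltn_trans (ltn_ord k) lam_m.
- move=> x1 x2 x3 p1 k1 p2 k2 p3 k3 o1 o2 o3 a1 a2 a3 h12 h23 h31.
  (* All three directions are taken from [a1]: replacing [a2] and [a3] by [a1] and dropping the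
     distance inside the gadget costs at most [3 * gad_delta]. *)
  pose f (i : 'I_n) c := tnth (x i) c - tnth (x a1) c.
  have fE i j : nrm (fun c => f i c - f j c) = dd i j.
    by apply: eq_nrm => c; rewrite /f opprB addrA subrK.
  have far i : outside pt i -> h * mg%:R <= nrm (f i).
    move=> oi; have [c hc] := outP oi.
    apply: le_trans (nrm_coord (f i) c); rewrite /f.
    have /andP[b1 b2] := ptP p1 k1 c.
    have sb := slot_box_le p1 k1 c.
    have mgb : (mg <= slot_box p1 k1 c)%N by rewrite leq_addr.
    case: hc => hc.
      rewrite distrC; apply: le_trans (ler_norm _).
      have : h * (base c + mg)%:R <= h * (base c + slot_box p1 k1 c)%:R.
        by rewrite ler_pM2l // ler_nat leq_add2l.
      rewrite natrD mulrDr; lra.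
    apply: le_trans (ler_norm _).
    have : h * (mg + (base c + slot_box p1 k1 c).+1)%:R <= h * (base c + cell_size)%:R.
      by rewrite ler_pM2l // ler_nat; exact: box_end.
    rewrite natrD mulrDr; lra.
  have tri i j k : dd i k <= dd i j + dd j k by exact: euclidean_dist_tri.
  have sym i j : dd i j = dd j i by exact: euclidean_dist_sym.
  have t2 := tri x2 a2 a1; have t3 := tri x3 a3 a1.
  have d12 : dd a1 a2 <= gad_delta by exact: diam.
  have d21 : dd a2 a1 <= gad_delta by exact: diam.
  have d31 : dd a3 a1 <= gad_delta by exact: diam.
  have d23 : dd a2 a3 <= gad_delta by exact: diam.
  have nE i : nrm (f i) = dd i a1 by [].
  have gd0 : 0 <= gad_delta by apply: mulr_ge0; [exact: ltW|exact: ler0n].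
  apply: (@three_directions R d (f x1) (f x2) (f x3) (h * mg%:R) (3 * gad_delta)).
  - by rewrite mulr_ge0.
  - rewrite /gad_delta !mulrA [4 * 3 * h]mulrC -mulrA ltr_pM2l //.
    have : (13 * (lam * (2 * W0) + (m + d)))%:R <= mg%:R :> R by rewrite ler_nat.
    have : 0 < (lam * (2 * W0) + (m + d))%:R :> R.
      by rewrite ltr0n !addn_gt0 (ltnW hd) !orbT.
    rewrite natrM; lra.
  - exact: far.
  - exact: far.
  - exact: far.
  - by rewrite fE !nE; lra.
  - by rewrite fE !nE; lra.
  - by rewrite fE !nE; lra.
- move=> p k l q k' r l' qp rp.
  have /andP[_ u1] := dist_ideal q k' r l'; have /andP[_ u2] := dist_ideal p k p l.
  have /andP[v1 _] := dist_ideal q k' p k; have /andP[v2 _] := dist_ideal r l' p l.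
  have hi1 : ideal_dist q k' r l' <= hi.
    have [<-|qr] := eqVneq q r; first exact: le_trans (Zcc _ _ _) cchi.
    by have /andP[] := Zlo q k' r l' ltac:(by rewrite eq_sym).
  have cc1 := Zcc p k l.
  have /andP[lo1 _] := Zlo q k' p k ltac:(by rewrite eq_sym).
  have /andP[lo2 _] := Zlo r l' p l ltac:(by rewrite eq_sym).
  apply: le_trans (_ : h * (lam%:R * hi + err) + h * (lam%:R * cc + err) + gad_gamma <= _).
    rewrite lerD2r lerD //.
      by apply: le_trans u1 _; rewrite ler_pM2l // lerD2r ler_wpM2l.
    by apply: le_trans u2 _; rewrite ler_pM2l // lerD2r ler_wpM2l.
  apply: le_trans (_ : h * (lam%:R * lo - err) + h * (lam%:R * lo - err) <= _); last first.
    rewrite lerD //.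
      by apply: le_trans _ v1; rewrite ler_pM2l // lerD2r ler_wpM2l.
    by apply: le_trans _ v2; rewrite ler_pM2l // lerD2r ler_wpM2l.
  rewrite /gad_gamma -!mulrDr ler_pM2l //.
  have : lam%:R * (hi + cc + eta) <= lam%:R * (lo *+ 2) by rewrite ler_wpM2l.
  have := lam_eta; have := err_ge0; lra.
- by move=> p k q l; exact: diam.
Qed.


End Template.

Section TemplatePrism.
Variables (R : realType) (d : nat) (zx zy : 'I_5 -> 'I_6 -> nat).
Hypothesis hd : (2 <= d)%N.
Variables (lam mg W0 : nat) (h eta : R) (base : 'I_d -> nat).
Hypothesis h0 : 0 < h.
Hypothesis lam_eta : 32 * err R d 6 <= lam%:R * eta.
Variables (n : nat) (x : 'I_n -> d.-tuple R) (pt : 'I_5 -> 'I_6 -> 'I_n).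
Hypothesis ptP : forall p k c,
  h * (base c + slot_box zx zy lam mg p k c)%:R <= tnth (x (pt p k)) c
    < h * (base c + slot_box zx zy lam mg p k c).+1%:R.

Lemma template_prism :
  prism_gain (fun a b : 'I_5 * 'I_6 => ideal_dist R zx zy a.1 a.2 b.1 b.2)
    (fun p k => (p, k)) eta ->
  prism_gain (fun i j => euclidean_dist (x i) (x j)) pt (gad_gamma lam h eta).
Proof.
move=> ideal p q k r l qp rp; have [a [b [ab gain]]] := ideal p q k r l qp rp.
exists a, b; split=> // rho rinj; have := gain rho rinj => /=.
set A := ideal_dist _ _ _ q k p a; set B := ideal_dist _ _ _ p b r l.
set C := \sum_(i < 6) \sum_(j < 6) _.
set A' := ideal_dist _ _ _ q k p (rho ord0); set B' := ideal_dist _ _ _ p _ r l.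
set P := \sum_(i < 5) _ => hideal.
have D p' k' q' l' := dist_ideal hd h0 ptP p' k' q' l'.
have /andP[_ uA] := D q k p a; have /andP[_ uB] := D p b r l.
have /andP[vA _] := D q k p (rho ord0); have /andP[vB _] := D p (rho ord_max) r l.
(* The 12 bounds the total weight of the prism: six rows, each with sum at most 2. *)
have uC : \sum_(i < 6) \sum_(j < 6) euclidean_dist (x (pt p i)) (x (pt p j)) * prism R i j <=
    h * (lam%:R * C + 12 * err R d 6).
  apply: le_trans (_ : \sum_(i < 6) \sum_(j < 6)
      h * (lam%:R * ideal_dist R zx zy p i p j + err R d 6) * prism R i j <= _).
    apply: ler_sum => i _; apply: ler_sum => j _; apply: ler_wpM2r; first exact: prism_ge0.
    by case/andP: (D p i p j).
  have -> : \sum_(i < 6) \sum_(j < 6)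
      h * (lam%:R * ideal_dist R zx zy p i p j + err R d 6) * prism R i j =
      h * (lam%:R * C + err R d 6 * \sum_(i < 6) \sum_(j < 6) prism R i j).
    rewrite /C !mulr_sumr -big_split mulr_sumr; apply: eq_bigr => i _ /=.
    rewrite !mulr_sumr -big_split mulr_sumr; apply: eq_bigr => j _ /=; ring.
  rewrite ler_pM2l // lerD2l [12 * _]mulrC ler_wpM2l ?err_ge0 //.
  apply: le_trans (_ : \sum_(i < 6) 2 <= _).
    apply: ler_sum => i _; rewrite -(prism_deg R i) -addrA lerDl.
    by rewrite addr_ge0 ?ler0n.
  by rewrite sumr_const card_ord -mulr_natr; lra.
have vP : h * (lam%:R * P - 5 * err R d 6) <=
    \sum_(i < 5) euclidean_dist (x (pt p (rho (inord i)))) (x (pt p (rho (inord i.+1)))).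
  apply: le_trans (_ : \sum_(i < 5)
     h * (lam%:R * ideal_dist R zx zy p (rho (inord i)) p (rho (inord i.+1)) - err R d 6) <= _).
    rewrite -mulr_sumr ler_pM2l // big_split /= sumr_const card_ord -mulr_sumr.
    by rewrite lerD2l mulNrn [5 * _]mulr_natl.
  by apply: ler_sum => i _; case/andP: (D p (rho (inord i)) p (rho (inord i.+1))).
set U1 := euclidean_dist _ _ in uA *; set U2 := euclidean_dist _ _ in uB *.
set U3 := \sum_(i < 6) _ in uC *; set V1 := euclidean_dist _ _ in vA *.
set V2 := \sum_(i < 5) _ in vP *; set V3 := euclidean_dist _ _ in vB *.
have hl : h * (lam%:R * (A + B + C / 2 + eta)) <= h * (lam%:R * (A' + P + B')).
  by rewrite ler_pM2l // ler_wpM2l.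
have he : h * (32 * err R d 6) <= h * (lam%:R * eta) by rewrite ler_pM2l.
have e0 : 0 <= h * err R d 6 by rewrite mulr_ge0 ?err_ge0 // ltW.
rewrite -/A in uA; rewrite -/B in uB; rewrite -/A' in vA; rewrite -/B' in vB.
move: uA uB uC vA vP vB hl he e0; rewrite /gad_gamma; move: (lam%:R) (err R d 6) => la e.
lra.
Qed.

End TemplatePrism.

(** * The two templates: pentagon of points and pentagon of prisms *)

Section PentagonTemplate.
Variable R : realType.

(* The points (25, 0), (7, 24), (-20, 15), (-20, -15), (7, -24) of the circle
   of radius 25, translated by (25, 25). *)
Definition pentagon_x (p : nat) : nat := nth 0%N [:: 50; 32; 5; 5; 32]%N p.
Definition pentagon_y (p : nat) : nat := nth 0%N [:: 25; 49; 40; 10; 1]%N p.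

Lemma sqrt_between (a b v : R) : 0 <= a -> 0 <= b -> a ^+ 2 <= v <= b ^+ 2 ->
  a <= Num.sqrt v <= b.
Proof.
move=> a0 b0 /andP[av vb]; rewrite -[X in X <= _](ger0_norm a0) -sqrtr_sqr.
by rewrite -[X in _ && (_ <= X)](ger0_norm b0) -sqrtr_sqr !ler_wsqrtr.
Qed.

(** The squared sides are 810 and 900, the squared diagonals 2250 and 2304; [28^2 = 784],
    [48^2 = 2304] and [48 + 8 = 2 * 28]. All points of a lobe share one ideal point, hence the
    diameter 0. *)
Lemma pentagon_separated m :
  ideal_separated (fun p (_ : 'I_m) => pentagon_x p) (fun p _ => pentagon_y p)
    (28%:R : R) 48%:R 0 8%:R.
Proof.
split; rewrite ?ler0n ?ltr0n //.
- move=> p k q l qp; apply: sqrt_between; rewrite ?ler0n //.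
  move: qp; rewrite -val_eqE; move: p q.
  by case=> -[|[|[|[|[|p]]]]] hp // [[|[|[|[|[|q]]]]] hq] //= _;
    rewrite /pentagon_x /pentagon_y /=; lra.
- by move=> p k l; rewrite /ideal_dist !subrr !expr0n addr0 sqrtr0.
- by rewrite addr0 -natrD -mulrnA ler_nat.
Qed.

Lemma pentagon_le p : (pentagon_x p <= 50)%N /\ (pentagon_y p <= 50)%N.
Proof. by case: p => [|[|[|[|[|p]]]]] //; rewrite /pentagon_x /pentagon_y !nth_default. Qed.

End PentagonTemplate.

Section PrismTemplate.
Variable R : realType.
Local Open Scope Z_scope.

(* Slot [k] of lobe [p] is at [1000 * E + a * E + b * E'], where [E] is the
   pentagon vertex [p], [E'] is [E] turned by a right angle and [(a, b)] is the
   vertex [k] of a planar prism; all is translated by (27000, 27000). *)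
Definition vertex_x (p : nat) : Z := nth 0 [:: 25; 7; -20; -20; 7] p.
Definition vertex_y (p : nat) : Z := nth 0 [:: 0; 24; 15; -15; -24] p.
Definition prism_x (k : nat) : Z := nth 0 [:: 31; 18; 0; 31; 18; 0] k.
Definition prism_y (k : nat) : Z := nth 0 [:: 10; 2; 20; -10; -2; -20] k.

Definition slot_x (p k : nat) : N := Z.to_N
  (27000 + (1000 + prism_x k) * vertex_x p - prism_y k * vertex_y p).
Definition slot_y (p k : nat) : N := Z.to_N
  (27000 + (1000 + prism_x k) * vertex_y p + prism_y k * vertex_x p).

Local Open Scope N_scope.

(* Rounding distances down to integers loses less than 1, and makes the
   inequalities of the template decidable by computation in [N]. *)
Definition floor_dist (p k q l : nat) : N :=
  let a := (slot_x p k - slot_x q l) + (slot_x q l - slot_x p k) in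
  let b := (slot_y p k - slot_y q l) + (slot_y q l - slot_y p k) in
  N.sqrt (a * a + b * b).

Definition pathlen (p : nat) (s : seq nat) : N :=
  foldr N.add 0 (pairmap (fun k l => floor_dist p k p l) (head 0%nat s) (behead s)).

Definition permlens (p : nat) : seq (nat * nat * N) :=
  [seq (head 0%nat s, last 0%nat s, pathlen p s) | s <- permutations (iota 0 6)].

(** Only the ends of a path through the lobe meet the outside, so the 720 paths are reduced to the
    shortest one for each pair of ends. The default 1000000 remains for equal ends, which no path
    has. *)
Definition min_table (p : nat) : seq (nat * nat * N) :=
  let T := permlens p in
  [seq (x, y, foldr N.min 1000000 [seq c.2 | c <- T & c.1 == (x, y)])
    | x <- iota 0 6, y <- iota 0 6].

(** Twice the cost of the prism, rounded up: the triangle edges of weight 1/2 count once, the two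
    spokes of weight 1 count twice. *)
Definition prism_cost2 (p : nat) : N :=
  let D k l := floor_dist p k p l + 1 in
  D 0%nat 1%nat + D 1%nat 2%nat + D 0%nat 2%nat + D 3%nat 4%nat + D 4%nat 5%nat + D 3%nat 5%nat
  + 2 * (D 0%nat 3%nat + D 1%nat 4%nat).

(** The inequality of [prism_gain], doubled to clear the halves: distances are rounded up on the
    prism side and down on the path side, and the last [+ 2] is twice the gain 1. The attachment
    [ab] is chosen before the path [c]. *)
Definition prism_check (p : nat) : bool :=
  let T := min_table p in let Y := prism_cost2 p in
  all (fun q => (q == p) || all (fun k =>
    let U := [seq floor_dist q k p x | x <- iota 0 6] in
    all (fun r => (r == p) || all (fun l =>
      let V := [seq floor_dist p x r l | x <- iota 0 6] in
      has (fun ab : nat * nat =>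
        let rhs := 2 * (nth 0 U ab.1 + 1 + (nth 0 V ab.2 + 1)) + Y + 2 in
        all (fun c => (rhs <=? 2 * (nth 0 U c.1.1 + c.2 + nth 0 V c.1.2))) T)
        [:: (2, 5); (5, 2)]%nat) (iota 0 6)) (iota 0 5)) (iota 0 6)) (iota 0 5).

Definition prism_shape_check : bool :=
  all (fun p => prism_check p && all (fun k =>
    [&& slot_x p k <=? 60000, slot_y p k <=? 60000 & all (fun q => all (fun l =>
      let D := floor_dist p k q l in
      if q == p then D + 1 <=? 1079 else (27500 <=? D) && (D + 1 <=? 50000))
    (iota 0 6)) (iota 0 5)]) (iota 0 6)) (iota 0 5).

Lemma prism_shape_ok : prism_shape_check.
Proof. by vm_compute. Qed.

Local Close Scope N_scope.
Local Close Scope Z_scope.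
Local Open Scope ring_scope.

Definition rN (a : N) : R := (N.to_nat a)%:R.

Lemma rN_add a b : rN (a + b)%num = rN a + rN b.
Proof. by rewrite /rN N2Nat.inj_add natrD. Qed.

Lemma rN_mul a b : rN (a * b)%num = rN a * rN b.
Proof. by rewrite /rN N2Nat.inj_mul natrM. Qed.

Lemma rN_le a b : (a <=? b)%num -> rN a <= rN b.
Proof. by move/N.leb_le => h; rewrite /rN ler_nat; lia. Qed.

Lemma rN1 : rN 1 = 1. Proof. by []. Qed.

Lemma rN_ge0 a : 0 <= rN a. Proof. exact: ler0n. Qed.

Lemma rN_absdiff_sqr a b :
  (rN a - rN b) ^+ 2 = rN ((a - b + (b - a)) * (a - b + (b - a)))%num.
Proof.
rewrite rN_mul rN_add.
have [ab|ba] := N.le_ge_cases a b.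
  have -> : (a - b = 0)%num by lia.
  have -> : rN (b - a)%num = rN b - rN a.
    have {2}-> : b = (b - a + a)%num by lia.
    by rewrite rN_add addrK.
  rewrite [rN 0](_ : _ = 0) //; ring.
have -> : (b - a = 0)%num by lia.
have -> : rN (a - b)%num = rN a - rN b.
  have {2}-> : a = (a - b + b)%num by lia.
  by rewrite rN_add addrK.
rewrite [rN 0](_ : _ = 0) //; ring.
Qed.

Definition slot_dist (p k q l : nat) : R :=
  Num.sqrt ((rN (slot_x p k) - rN (slot_x q l)) ^+ 2 + (rN (slot_y p k) - rN (slot_y q l)) ^+ 2).

Lemma slot_dist_sym p k q l : slot_dist p k q l = slot_dist q l p k.
Proof.
by congr (Num.sqrt (_ + _)); rewrite -[RHS]sqrrN opprB.
Qed.

Lemma slot_dist_floor p k q l :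
  rN (floor_dist p k q l) <= slot_dist p k q l <= rN (floor_dist p k q l) + 1.
Proof.
apply: sqrt_between; rewrite ?addr_ge0 ?rN_ge0 //.
rewrite !rN_absdiff_sqr -rN_add /floor_dist.
move: (_ + _)%num => D; have [h1 h2] := N.sqrt_spec D (N.le_0_l D).
apply/andP; split; first by rewrite expr2 -rN_mul; apply: rN_le; exact/N.leb_le.
have -> : rN (N.sqrt D) + 1 = rN (N.succ (N.sqrt D)).
  by rewrite -N.add_1_r rN_add.
by rewrite expr2 -rN_mul; apply: rN_le; apply/N.leb_le; apply: N.lt_le_incl.
Qed.

Definition prism_zx (p : 'I_5) (k : 'I_6) : nat := N.to_nat (slot_x p k).
Definition prism_zy (p : 'I_5) (k : 'I_6) : nat := N.to_nat (slot_y p k).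

Lemma prism_ideal_dist p k q l :
  ideal_dist R prism_zx prism_zy p k q l = slot_dist p k q l.
Proof. by []. Qed.

Lemma ord_iota n (i : 'I_n) : (i : nat) \in iota 0 n.
Proof. by rewrite mem_iota ltn_ord. Qed.

Lemma prism_zle (p : 'I_5) (k : 'I_6) :
  (prism_zx p k <= N.to_nat 60000)%N /\ (prism_zy p k <= N.to_nat 60000)%N.
Proof.
have /allP/(_ _ (ord_iota p))/andP[_ /allP/(_ _ (ord_iota k))] := prism_shape_ok.
case/and3P => /N.leb_le hx /N.leb_le hy _; rewrite /prism_zx /prism_zy; split.
  by move: (slot_x p k) hx => a; lia.
by move: (slot_y p k) hy => a; lia.
Qed.

Lemma prism_separated : ideal_separated prism_zx prism_zy
  (rN 27500) (rN 50000) (rN 1079) 1.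
Proof.
have D (p : 'I_5) (k : 'I_6) (q : 'I_5) (l : 'I_6) :
    if q == p then (floor_dist p k q l + 1 <=? 1079)%num
    else ((27500 <=? floor_dist p k q l)%num && (floor_dist p k q l + 1 <=? 50000)%num).
  have /allP/(_ _ (ord_iota p))/andP[_ /allP/(_ _ (ord_iota k))] := prism_shape_ok.
  by case/and3P => _ _ /allP/(_ _ (ord_iota q))/allP/(_ _ (ord_iota l)).
split=> //.
- move=> p k q l /negbTE qp; rewrite prism_ideal_dist.
  have /andP[s1 s2] := slot_dist_floor p k q l.
  have := D p k q l; rewrite qp => /andP[/rN_le h1 /rN_le]; rewrite rN_add rN1 => h2.
  by rewrite (le_trans h1 s1) (le_trans s2 h2).
- move=> p k l; rewrite prism_ideal_dist.
  have /andP[s1 s2] := slot_dist_floor p k p l.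
  have := D p k p l; rewrite eqxx => /rN_le; rewrite rN_add rN1; exact: le_trans.
- by apply: rN_le.
- have : rN (50000 + 1079 + 1)%num <= rN (27500 + 27500)%num by apply: rN_le.
  by rewrite !rN_add rN1 mulr2n.
Qed.

Lemma foldr_min_le z s (v : N) : v \in s -> (foldr N.min z s <= v)%num.
Proof.
elim: s => //= w s IH; rewrite inE => /orP[/eqP ->|/IH h]; first exact: N.le_min_l.
by apply: N.le_trans h; exact: N.le_min_r.
Qed.

Lemma prism_template_gain :
  prism_gain (fun a b : 'I_5 * 'I_6 => ideal_dist R prism_zx prism_zy a.1 a.2 b.1 b.2)
    (fun p k => (p, k)) 1.
Proof.
move=> p q k r l qp rp.
have /allP/(_ _ (ord_iota p))/andP[+ _] := prism_shape_ok.
have [T TE] : exists T, T = min_table p by exists (min_table p).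
rewrite /prism_check -TE.
move=> /allP/(_ _ (ord_iota q)); rewrite val_eqE (negbTE qp) orFb.
move=> /allP/(_ _ (ord_iota k))/allP/(_ _ (ord_iota r)); rewrite val_eqE (negbTE rp).
rewrite orFb => /allP/(_ _ (ord_iota l))/hasP[ab abin /allP hT].
have ab25 : (ab.1 = 2%N /\ ab.2 = 5) \/ (ab.1 = 5 /\ ab.2 = 2%N).
  by move: abin; rewrite !inE => /orP[] /eqP ->; [left|right].
have [a6 b6] : (ab.1 < 6)%N /\ (ab.2 < 6)%N by case: ab25 => -[-> ->].
exists (Ordinal a6), (Ordinal b6); split=> //.
move=> rho rinj; rewrite !prism_ideal_dist /=.
pose f i : nat := rho (inord i).
have fI : {in iota 0 6 &, injective f}.
  move=> i j; rewrite !mem_iota /= => hi hj /val_inj /rinj /(congr1 val).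
  by rewrite /= !inordK.
pose ks := map f (iota 0 6).
have Uks : uniq ks by rewrite map_inj_in_uniq // iota_uniq.
have pks : perm_eq ks (iota 0 6).
  have sub : {subset ks <= iota 0 6}.
    by move=> x /mapP[i _ ->]; exact: ord_iota.
  have [_ eqm] := uniq_min_size Uks sub ltac:(by rewrite size_map).
  by apply: uniq_perm; rewrite ?iota_uniq.
have f6 i : (f i < 6)%N by exact: ltn_ord.
set M := foldr N.min 1000000%num [seq c.2 | c <- permlens p & c.1 == (f 0%N, f 5)].
have MT : (f 0%N, f 5, M) \in T.
  rewrite TE /min_table; apply: (allpairs_f (fun x y =>
    (x, y, foldr N.min 1000000%num [seq c.2 | c <- permlens p & c.1 == (x, y)])));
    by rewrite mem_iota f6.
have Mle : (M <= pathlen p ks)%num.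
  apply: foldr_min_le; apply/mapP; exists (f 0%N, f 5, pathlen p ks) => //.
  rewrite mem_filter /= eqxx /=; apply/mapP; exists ks => //.
  by rewrite mem_permutations.
have := rN_le (hT _ MT).
have tabE (F : nat -> N) i : (i < 6)%N -> nth 0%num [seq F x | x <- iota 0 6] i = F i.
  by move=> h; rewrite (nth_map 0%N) ?size_iota // nth_iota.
rewrite (tabE (floor_dist q k p)) // (tabE (fun y => floor_dist p y r l)) //.
rewrite (tabE (floor_dist q k p)) ?f6 // (tabE (fun y => floor_dist p y r l)) ?f6 //.
have [Y YE] : exists Y, Y = prism_cost2 p by exists (prism_cost2 p).
rewrite -YE !(rN_add, rN_mul).
have rM : rN M <= rN (pathlen p ks) by apply: rN_le; exact/N.leb_le.
have pathE : rN (pathlen p ks) <= \sum_(i < 5) slot_dist p (rho (inord i)) p (rho (inord i.+1)).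
  rewrite !big_ord_recr big_ord0 /pathlen /= !rN_add.
  have D i j : rN (floor_dist p (f i) p (f j)) <= slot_dist p (f i) p (f j).
    by case/andP: (slot_dist_floor p (f i) p (f j)).
  have := D 0%N 1%N; have := D 1%N 2%N; have := D 2%N 3%N; have := D 3%N 4%N.
  have := D 4%N 5%N; rewrite /f [rN 0](_ : _ = 0) //; lra.
have pathE' : rN (pathlen p ks) <= \sum_(i < 5) ideal_dist R prism_zx prism_zy
    p (rho (inord i)) p (rho (inord i.+1)) := pathE.
have costE : \sum_(i < 6) \sum_(j < 6) slot_dist p i p j * prism R i j <= rN Y.
  have U i j : slot_dist p i p j <= rN (floor_dist p i p j) + 1.
    by case/andP: (slot_dist_floor p i p j).
  have := U 0%N 1%N; have := U 1%N 2%N; have := U 0%N 2%N; have := U 3%N 4%N.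
  have := U 4%N 5%N; have := U 3%N 5%N; have := U 0%N 3%N; have := U 1%N 4%N.
  have : (2%:R^-1 : R) + 2%:R^-1 = 1 by field.
  have S i j := slot_dist_sym p i p j.
  rewrite YE /prism_cost2 !(rN_add, rN_mul) rN1 [rN 2](_ : _ = 2%:R) //.
  rewrite !big_ord_recr !big_ord0 /prism; move: (2%:R^-1) => h hh /=.
  rewrite (S 1%N 0%N) (S 2%N 0%N) (S 2%N 1%N) (S 4%N 3%N) (S 5%N 3%N) (S 5%N 4%N) (S 3%N 0%N) (S 4%N 1%N).
  move: hh; clear; nra.
have /andP[_ u1] := slot_dist_floor q k p ab.1.
have /andP[_ u2] := slot_dist_floor p ab.2 r l.
have /andP[v1 _] := slot_dist_floor q k p (f 0%N).
have /andP[v2 _] := slot_dist_floor p (f 5) r l.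
have f0 : slot_dist q k p (f 0%N) = slot_dist q k p (rho ord0).
  by rewrite /f (_ : inord 0 = ord0) //; apply: val_inj; rewrite /= inordK.
have f5 : slot_dist p (f 5) r l = slot_dist p (rho ord_max) r l.
  by rewrite /f (_ : inord 5 = ord_max) //; apply: val_inj; rewrite /= inordK.
rewrite -f0 -f5 rN1 [rN 2](_ : _ = 2%:R) //=.
move: u1 u2 v1 v2 costE pathE' rM.
set s1 := \sum_(i < 6) _; lra.
Qed.

End PrismTemplate.

(** * Good cells *)

Section BoundedDifferences.
Variables (R : realType) (L : finType).
Hypothesis L0 : (0 < #|L|)%N.
Let q : R := #|L|%:R.

Lemma sum_tuple_cons n (F : n.+1.-tuple L -> R) :
  \sum_t F t = \sum_a \sum_(t : n.-tuple L) F [tuple of a :: t].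
Proof.
rewrite pair_big /= (reindex (fun p : L * n.-tuple L => [tuple of p.1 :: p.2])) //=.
exists (fun t => (thead t, [tuple of behead t])) => [[a t] _|t _].
  by congr pair; apply: val_inj.
by rewrite -tuple_eta.
Qed.

(** Goes through [exp x <= 1 / (1 - x)], which is at most the quadratic for [x <= 1/2]. *)
Lemma expR_le_quadratic (x : R) : `|x| <= 2^-1 -> expR x <= 1 + x + 2 * x ^+ 2.
Proof.
rewrite ler_norml => /andP[x1 x2].
have h := expR_ge1Dx (- x).
have x3 : 0 < 1 - x by lra.
have : expR x <= (1 - x)^-1.
  by rewrite -[expR x]invrK -expRN lef_pV2 ?posrE ?expR_gt0.
move=> /le_trans; apply.
rewrite -div1r ler_pdivrMr //.
have : 0 <= x ^+ 2 * (1 - 2 * x) by rewrite mulr_ge0 ?sqr_ge0 //; lra.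
rewrite (_ : (1 + x + 2 * x ^+ 2) * (1 - x) = 1 + x ^+ 2 * (1 - 2 * x)); last by ring.
lra.
Qed.

Definition differ_once n (t t' : n.-tuple L) :=
  exists i, forall j, j != i -> tnth t j = tnth t' j.

Definition tuple_mean n (F : n.-tuple L -> R) : R := (\sum_t F t) / q ^+ n.

Variables (c th : R).
Hypotheses (th0 : 0 <= th) (cth : th * c <= 2^-1).

Let q0 : 0 < q. Proof. by rewrite ltr0n. Qed.

(* Revealing the coordinates one at a time, each moves the conditional mean of
   [F] by at most [c]. *)
Lemma exp_deviation n (F : n.-tuple L -> R) :
  (forall t t', differ_once t t' -> `|F t - F t'| <= c) ->
  \sum_t expR (th * (tuple_mean F - F t)) <= q ^+ n * expR (2 * (th * c) ^+ 2 * n%:R).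
Proof.
elim: n F => [|n IH] F hF.
  have E (t : 0.-tuple L) : t = [tuple] by exact: tuple0.
  have sum0 (H : 0.-tuple L -> R) : \sum_t H t = H [tuple].
    rewrite (bigD1 [tuple]) //= big1 ?addr0 // => t.
    by move=> /negP[]; apply/eqP; exact: E.
  by rewrite /tuple_mean !sum0 expr0 divr1 subrr !mulr0 expR0 mulr1.
pose mu a := tuple_mean (fun t : n.-tuple L => F [tuple of a :: t]).
have qn0 : 0 < q ^+ n by rewrite exprn_gt0.
have meanE : tuple_mean F = (\sum_a mu a) / q.
  rewrite /tuple_mean sum_tuple_cons /mu /tuple_mean -mulr_suml.
  by rewrite exprS invfM mulrA [in RHS]mulrAC.
have mu_c a b : `|mu a - mu b| <= c.
  rewrite /mu /tuple_mean -mulrBl -sumrB normrM (@ger0_norm _ (_ ^-1)); last first.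
    by rewrite invr_ge0 ltW.
  rewrite ler_pdivrMr //; apply: le_trans (ler_norm_sum _ _ _) _.
  apply: le_trans (_ : \sum_(t : n.-tuple L) c <= _).
    apply: ler_sum => t _; apply: hF; exists ord0 => j.
    by case: (unliftP ord0 j) => [i ->|->]; rewrite ?eqxx // !tnthS.
  by rewrite sumr_const card_tuple -mulr_natr natrX.
have dev a : `|tuple_mean F - mu a| <= c.
  have -> : tuple_mean F - mu a = (\sum_b (mu b - mu a)) / q.
    by rewrite sumrB sumr_const mulrBl -meanE -mulr_natr mulfK // gt_eqF.
  rewrite normrM (@ger0_norm _ (_ ^-1)); last by rewrite invr_ge0 ltW.
  rewrite ler_pdivrMr //; apply: le_trans (ler_norm_sum _ _ _) _.
  apply: le_trans (_ : \sum_(b : L) c <= _); last by rewrite sumr_const -mulr_natr.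
  by apply: ler_sum => b _.
have c0 : 0 <= c.
  have /card_gt0P[a _] := L0.
  by apply: le_trans (mu_c a a); exact: normr_ge0.
have sumx : \sum_a expR (th * (tuple_mean F - mu a)) <= q * expR (2 * (th * c) ^+ 2).
  apply: le_trans (_ : \sum_a (1 + th * (tuple_mean F - mu a) + 2 * (th * c) ^+ 2) <= _).
    apply: ler_sum => a _.
    have xle : `|th * (tuple_mean F - mu a)| <= th * c.
      by rewrite normrM (ger0_norm th0) ler_wpM2l.
    apply: le_trans (expR_le_quadratic (le_trans xle cth)) _.
    rewrite lerD2l ler_pM2l // -[X in X <= _]real_normK ?num_real //.
    by rewrite ler_pXn2r ?nnegrE ?mulr_ge0.
  have sumC (y : R) : \sum_(a : L) y = q * y by rewrite sumr_const -mulr_natl.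
  rewrite !big_split /= -mulr_sumr sumrB !sumC meanE [q * (_ / q)]mulrC divfK ?gt_eqF //.
  rewrite subrr mulr0 addr0 -mulrDr.
  by rewrite ler_pM2l // expR_ge1Dx.
rewrite sum_tuple_cons.
apply: le_trans (_ : \sum_a expR (th * (tuple_mean F - mu a)) *
    (q ^+ n * expR (2 * (th * c) ^+ 2 * n%:R)) <= _).
  apply: ler_sum => a _.
  apply: le_trans (_ : expR (th * (tuple_mean F - mu a)) *
      \sum_(t : n.-tuple L) expR (th * (mu a - F [tuple of a :: t])) <= _).
    rewrite mulr_sumr; apply: ler_sum => t _.
    by rewrite -expRD -mulrDr addrA subrK.
  rewrite ler_pM2l ?expR_gt0 //; apply: IH => t t' [i hi].
  apply: hF; exists (lift ord0 i) => j.
  case: (unliftP ord0 j) => [k ->|-> //].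
  by rewrite (inj_eq lift_inj) => ki; rewrite !tnthS hi.
rewrite -mulr_suml.
apply: le_trans (ler_wpM2r _ sumx) _; first by rewrite mulr_ge0 ?expR_ge0 // ltW.
rewrite -[n.+1%:R]natr1 [2 * _ * (_ + 1)]mulrDr mulr1 expRD [q ^+ n.+1]exprS.
by rewrite mulrACA [expR _ * expR _]mulrC.
Qed.

(** Markov's inequality for the exponential moment: where [F t <= b], the mean exceeds [F t] by at
    least [b]. *)
Lemma lower_tail n (F : n.-tuple L -> R) b :
  (forall t t', differ_once t t' -> `|F t - F t'| <= c) -> b *+ 2 <= tuple_mean F ->
  #|[set t : n.-tuple L | F t <= b]%SET|%:R <=
    q ^+ n * expR (2 * (th * c) ^+ 2 * n%:R - th * b).
Proof.
move=> hF hb.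
rewrite expRD mulrA expRN ler_pdivlMr ?expR_gt0 //.
apply: le_trans (exp_deviation hF).
rewrite mulr_natl -sumr_const [leRHS](bigID (mem [set t | F t <= b]%SET)) /=.
apply: le_trans (_ : \sum_(t in [set t | F t <= b]%SET) expR (th * (tuple_mean F - F t)) <= _).
  apply: ler_sum => t; rewrite finset.inE => Ft; rewrite ler_expR ler_wpM2l //; lra.
by rewrite lerDl sumr_ge0 // => t _; exact: expR_ge0.
Qed.

End BoundedDifferences.

Lemma le_double_sub K n c i : (K * 2 <= n -> i < K -> c <= n -> c <= (n - i) * 2)%N.
Proof. lia. Qed.

Section GoodCells.
(* [L] is the set of boxes of a fine grid and [C] that of its cells; [slot k s]
   is the box reserved in cell [k] for the point [s] of a gadget. *)
Variables (R : realType) (L C S : finType) (cell : L -> C) (slot : C -> S -> L) (V : nat).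
Hypotheses (V0 : (0 < V)%N) (cardL : #|L| = (V * #|C|)%N).
Hypothesis cellV : forall k, (#|[set l | cell l == k]%SET| <= V)%N.
Hypothesis cell_slot : forall k s, cell (slot k s) = k.
Hypothesis slot_inj : forall k, injective (slot k).

Definition fits n (t : n.-tuple L) k (pos : {ffun S -> 'I_n}) : bool :=
  [forall s, tnth t (pos s) == slot k s] &&
  [forall i, (i \in codom pos) || (cell (tnth t i) != k)].

Definition good_cell n (t : n.-tuple L) k : bool := [exists pos, fits t k pos].

Definition good_cells n (t : n.-tuple L) : {set C} := [set k | good_cell t k]%SET.

Lemma good_cell_differ_once n (t t' : n.-tuple L) i k :
  (forall j, j != i -> tnth t j = tnth t' j) ->
  cell (tnth t i) != k -> cell (tnth t' i) != k -> good_cell t k -> good_cell t' k.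
Proof.
move=> tt' ti t'i /existsP[pos /andP[/forallP h1 /forallP h2]].
have ne s : pos s != i.
  by apply: contraNneq ti => <-; rewrite (eqP (h1 s)) cell_slot.
apply/existsP; exists pos; apply/andP; split; [apply/forallP => s|apply/forallP => j].
  by rewrite -tt'.
by have [->|ji] := eqVneq j i; [rewrite t'i orbT|rewrite -tt'].
Qed.

(** Changing one label affects only the cell that the point leaves and the cell that it enters. *)
Lemma good_cells_differ_once n (t t' : n.-tuple L) :
  differ_once t t' -> `|#|good_cells t|%:R - #|good_cells t'|%:R| <= 2 :> R.
Proof.
have half (u u' : n.-tuple L) : differ_once u u' ->
    (#|good_cells u| <= #|good_cells u'| + 2)%N.
  move=> [i ui].
  apply: leq_trans (_ : #|good_cells u' :|: [set cell (tnth u i); cell (tnth u' i)]| <= _)%N.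
    apply/subset_leq_card/fintype.subsetP => k; rewrite !finset.inE => gk.
    have [e|e] := eqVneq (cell (tnth u i)) k; first by rewrite orbT.
    have [e'|e'] := eqVneq (cell (tnth u' i)) k; first by rewrite !orbT.
    by rewrite (good_cell_differ_once ui).
  apply: leq_trans (leq_card_setU _ _) _; rewrite leq_add2l cards2.
  by case: eqP.
move=> tt'; have t't : differ_once t' t.
  by case: tt' => i h; exists i => j /h.
have := half _ _ tt'; have := half _ _ t't.
rewrite -!(ler_nat R) !natrD ler_norml; lra.
Qed.

Lemma card_tuple_family n (F : 'I_n -> pred L) :
  #|[set t : n.-tuple L | [forall i, F i (tnth t i)]]%SET| = (\prod_(i < n) #|F i|)%N.
Proof.
pose enc (t : n.-tuple L) : {ffun 'I_n -> L} := [ffun i => tnth t i].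
have enc_inj : injective enc.
  by move=> t t' /ffunP e; apply: eq_from_tnth => i; have := e i; rewrite !ffunE.
have -> : (\prod_(i < n) #|F i| = #|family F|)%N.
  by rewrite card_family /image_mem foldrE big_map big_enum.
rewrite -(fintype.card_image enc_inj); apply: eq_card => f.
apply/fintype.imageP/familyP => [[t]|fF].
  by rewrite finset.inE => /forallP h -> i; rewrite ffunE; apply: h.
exists [tuple f i | i < n]; last by apply/ffunP => i; rewrite ffunE tnth_mktuple.
by rewrite finset.inE; apply/forallP => i; rewrite tnth_mktuple; apply: fF.
Qed.

(** All points of the cell are in the image of [pos] and the slots are distinct, so the labels
    determine [pos]. In [card_good_cell], the label tuples of different placements can thus be
    counted without overlap. *)
Lemma fits_inj n (t : n.-tuple L) k pos pos' :
  fits t k pos -> fits t k pos' -> pos = pos'.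
Proof.
move=> /andP[/forallP h1 /forallP h2] /andP[/forallP h1' /forallP h2'].
apply/ffunP => s; have := h2' (pos s).
rewrite (eqP (h1 s)) cell_slot eqxx orbF => /codomP[s' e].
rewrite e; congr (pos' _); apply: (@slot_inj k).
by rewrite -(eqP (h1 s)) e (eqP (h1' s')).
Qed.

Lemma card_fits n k (pos : {ffun S -> 'I_n}) : injectiveb pos ->
  ((#|L| - V) ^ (n - #|S|) <= #|[set t : n.-tuple L | fits t k pos]%SET|)%N.
Proof.
move=> /injectiveP ipos.
pose F (i : 'I_n) : pred L := fun l =>
  [forall s, (pos s == i) ==> (l == slot k s)] && ((i \in codom pos) || (cell l != k)).
have -> : [set t : n.-tuple L | fits t k pos]%SET =
    [set t : n.-tuple L | [forall i, F i (tnth t i)]]%SET.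
  apply/setP => t; rewrite !finset.inE; apply/andP/forallP => [[/forallP h1 /forallP h2] i|h].
    by rewrite /F h2 andbT; apply/forallP => s; apply/implyP => /eqP <-.
  split; [apply/forallP => s|apply/forallP => i]; last by case/andP: (h i).
  by have /andP[/forallP/(_ s)] := h (pos s); rewrite eqxx.
rewrite card_tuple_family (bigID (mem (codom pos))) /=.
rewrite [X in (X * _)%N](_ : _ = 1%N) ?mul1n; last first.
  apply: big1 => i /codomP[s ->]; rewrite -[RHS](card1 (slot k s)); apply: eq_card => l.
  rewrite -[LHS]/(F (pos s) l) -[RHS]/(l == slot k s) /F codom_f orTb andbT; apply/forallP/eqP => [/(_ s)|-> s'].
    by rewrite eqxx => /eqP.
  by apply/implyP => /eqP/ipos ->.
apply: leq_trans (_ : \prod_(i < n | i \notin codom pos) (#|L| - V) <= _)%N.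
  rewrite prod_nat_const leq_eqVlt; apply/orP; left; apply/eqP; congr (_ ^ _)%N.
  rewrite -[n in LHS](card_ord n) -(card_codom ipos) -(cardC (mem (codom pos))) addKn.
  by apply: eq_card => i; rewrite !inE.
apply: leq_prod => i ipos'.
have -> : #|F i| = #|~: [set l | cell l == k]%SET|.
  apply: eq_card => l; rewrite !finset.inE -[LHS]/(F i l) /F (negbTE ipos') orFb.
  rewrite andb_idl // => _; apply/forallP => s; apply/implyP => /eqP e.
  by rewrite -e codom_f in ipos'.
by rewrite cardsCs finset.setCK leq_sub2l.
Qed.

Lemma card_good_cell n k :
  (n ^_ #|S| * (#|L| - V) ^ (n - #|S|) <= #|[set t : n.-tuple L | good_cell t k]%SET|)%N.
Proof.
have -> : [set t : n.-tuple L | good_cell t k]%SET =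
    (\bigcup_(pos : {ffun S -> 'I_n}) [set t | fits t k pos])%SET.
  apply/setP => t; rewrite finset.inE; apply/existsP/bigcupP => [[pos h]|[pos _]].
    by exists pos; rewrite ?finset.inE.
  by rewrite finset.inE => h; exists pos.
rewrite -sum1_card partition_disjoint_bigcup /=; last first.
  move=> p p' pp'; apply/pred0P => t /=; rewrite !finset.inE.
  by apply/negbTE/negP => /andP[h /(fits_inj h) e]; rewrite e eqxx in pp'.
rewrite -[X in (X ^_ _)%N](card_ord n) -card_inj_ffuns -sum_nat_const.
rewrite [leqRHS](bigID (mem [set f : {ffun S -> 'I_n} | injectiveb f]%SET)) /=.
apply: leq_trans (leq_addr _ _); apply: leq_sum => p; rewrite finset.inE => ip.
by rewrite sum1_card card_fits.
Qed.

(** With [M] cells and [K] slots, a cell is good for a fraction of at least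
    [(M/2)^K (1 - 1/M)^(n-K) / (V M)^K] of the labellings: there are at least [(M/2)^K] placements,
    and the other points avoid the cell. As [n <= a M], this is at least [exp (- 2 a) / (2 V)^K],
    and there are [M >= n/a] cells. *)
Definition good_density (a : nat) : R := expR (- (2 * a%:R)) / (a%:R * (2 * V%:R) ^+ #|S|).

Variables (a n : nat).
Hypotheses (hS : (#|S| * 2 <= n)%N) (hC : (2 <= #|C|)%N) (Cn : (#|C| <= n)%N)
  (nC : (n <= a * #|C|)%N).

Lemma a_gt0 : (0 < a)%N.
Proof. by case: a nC => // h; move: hC Cn; lia. Qed.

Lemma good_density_gt0 : 0 < good_density a.
Proof.
by rewrite /good_density divr_gt0 ?expR_gt0 // mulr_gt0 ?exprn_gt0 ?mulr_gt0 // ltr0n // a_gt0.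
Qed.

Lemma mean_good_cells :
  good_density a * n%:R <= tuple_mean (fun t : n.-tuple L => #|good_cells t|%:R).
Proof.
pose M : R := #|C|%:R; pose v : R := V%:R; pose K := #|S|.
have M0 : 0 < M by rewrite ltr0n ltnW.
have v0 : 0 < v by rewrite ltr0n.
have a0 : 0 < a%:R :> R by rewrite ltr0n a_gt0.
have qE : #|L|%:R = v * M :> R by rewrite cardL natrM.
have q0 : 0 < #|L|%:R :> R by rewrite qE mulr_gt0.
have sumE : \sum_(t : n.-tuple L) #|good_cells t|%:R =
    (\sum_k #|[set t : n.-tuple L | good_cell t k]%SET|)%:R :> R.
  rewrite -natr_sum; congr (_%:R).
  rewrite (eq_bigr (fun t => \sum_(k | good_cell t k) 1%N)); last first.
    by move=> t _; rewrite -sum1_card; apply: eq_bigl => k; rewrite finset.inE.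
  rewrite (exchange_big_dep xpredT) //=; apply: eq_bigr => k _.
  by rewrite -sum1_card; apply: eq_bigl => t; rewrite finset.inE.
have fall : (M / 2) ^+ K <= (n ^_ K)%:R.
  rewrite expr_div_n ler_pdivrMr ?exprn_gt0 // -!natrX -natrM ler_nat.
  have constE x : (\prod_(i < K) x = x ^ K)%N by rewrite prod_nat_const card_ord.
  rewrite ffact_prod -!constE -big_split /=; apply: leq_prod => i _.
  have iK := ltn_ord i; have Kn : (K * 2 <= n)%N := hS.
  exact: le_double_sub Kn iK Cn.
have ret : expR (- (2 * a%:R)) <= (1 - M^-1) ^+ (n - K).
  have M2 : M^-1 <= 2^-1 by rewrite lef_pV2 ?posrE // ler_nat.
  have Mi0 : 0 < M^-1 by rewrite invr_gt0.
  apply: le_trans (_ : expR (- (2 * M^-1)) ^+ (n - K) <= _); last first.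
    rewrite lerXn2r ?nnegrE ?expR_ge0 //; first lra.
    have h := expR_ge1Dx (2 * M^-1).
    rewrite expRN -[leRHS]invrK lef_pV2 ?posrE ?invr_gt0 ?expR_gt0 //; last lra.
    apply: le_trans h; rewrite -div1r ler_pdivrMr; last lra.
    have : 0 <= M^-1 * (1 - 2 * M^-1) by rewrite mulr_ge0 //; lra.
    lra.
  rewrite -expRM_natl ler_expR mulrN lerN2 mulrCA ler_pM2l // -ler_pdivlMr // invrK.
  by rewrite -natrM ler_nat (leq_trans (leq_subr _ _)).
rewrite /tuple_mean ler_pdivlMr ?exprn_gt0 // sumE.
apply: le_trans (_ : M * ((n ^_ K)%:R * ((v * M) ^+ (n - K) * (1 - M^-1) ^+ (n - K))) <= _); last first.
  rewrite -exprMn mulrBr mulr1 mulfK ?gt_eqF // -qE -natrB; last first.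
    by rewrite cardL leq_pmulr // ltnW.
  rewrite -natrX -!natrM ler_nat -sum_nat_const; apply: leq_sum => k _.
  exact: card_good_cell.
have Kn : (K <= n)%N by move: hS; rewrite -/K; clear; lia.
apply: le_trans (_ : M * ((M / 2) ^+ K * ((v * M) ^+ (n - K) * expR (- (2 * a%:R)))) <= _); last first.
  have vM : 0 <= (v * M) ^+ (n - K) by rewrite exprn_ge0 // mulr_ge0 // ltW.
  rewrite ler_pM2l //; apply: ler_pM fall _.
  - by rewrite exprn_ge0 // divr_ge0 // ltW.
  - by rewrite mulr_ge0 ?expR_ge0.
  - by rewrite ler_wpM2l.
have -> : M * ((M / 2) ^+ K * ((v * M) ^+ (n - K) * expR (- (2 * a%:R)))) =
    good_density a * (a%:R * M) * #|L|%:R ^+ n.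
  rewrite qE -{2}(subnKC Kn) exprD /good_density -/K -/v expr_div_n !exprMn.
  by field; rewrite !expf_neq0 ?gt_eqF.
rewrite ler_pM2r ?exprn_gt0 // ler_wpM2l ?(ltW good_density_gt0) //.
by rewrite -natrM ler_nat.
Qed.

Lemma few_good_cells :
  #|[set t : n.-tuple L | #|good_cells t|%:R <= good_density a / 2 * n%:R]%SET|%:R <=
    #|L|%:R ^+ n * expR (- (good_density a ^+ 2 / 128 * n%:R)) :> R.
Proof.
have a0 : 1 <= a%:R :> R by rewrite ler1n a_gt0.
have p0 := good_density_gt0.
have p1 : good_density a <= 1.
  rewrite /good_density ler_pdivrMr; last first.
    by rewrite mulr_gt0 ?exprn_gt0 ?mulr_gt0 ?ltr0n ?a_gt0.
  rewrite mul1r; apply: le_trans (_ : 1 <= _).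
    by rewrite -[leRHS]expR0 ler_expR oppr_le0 mulr_ge0.
  rewrite -[leLHS]mulr1 ler_pM // exprn_ege1 //.
  have : 1 <= V%:R :> R by rewrite ler1n.
  lra.
have L0 : (0 < #|L|)%N by rewrite cardL muln_gt0 V0 (ltnW hC).
(* With [c = 2] and [th = good_density / 32], the exponent per point is
   [good_density^2 (1/128 - 1/64)]. *)
have := @lower_tail R L L0 2 (good_density a / 32) _ _ n
  (fun t => #|good_cells t|%:R) (good_density a / 2 * n%:R).
have -> : good_density a / 2 * n%:R *+ 2 = good_density a * n%:R by rewrite -mulr_natl; field.
move=> h; apply: le_trans (h _ _ _ mean_good_cells) _; [lra|lra|exact: good_cells_differ_once|].
rewrite le_eqVlt; apply/orP; left; apply/eqP; congr (_ * expR _).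
by field.
Qed.

End GoodCells.

(** * Random points *)

Section RandomLabels.
Local Open Scope classical_set_scope.
Local Open Scope ring_scope.
Variables (R : realType) (disp : measure_display) (T : measurableType disp).
Variables (P : probability T R) (d : nat) (X : nat -> {RV P >-> d.-tuple R}).
Hypotheses (hindep : mutually_independent X) (hunif : forall i, uniform_on_cube (X i)).

Lemma uniform_prob_itv (a b : R) : 0 <= a -> a < b -> b <= 1 ->
  uniform_prob (@ltr01 R) `[a, b[ = (b - a)%:E.
Proof.
move=> a0 ab b1; rewrite /uniform_prob (eq_integral (fun=> 1%:E)); last first.
  move=> x; rewrite inE /= in_itv /= => /andP[ax xb]; rewrite /uniform_pdf subr0 invr1.
  by rewrite (le_trans a0 ax) (le_trans (ltW xb) b1).
by rewrite integral_cst //= mul1e lebesgue_measure_itv /= lte_fin ab -EFinD.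
Qed.

Definition box G (l : {ffun 'I_d -> 'I_G}) : set (d.-tuple R) :=
  [set x | forall c, (l c)%:R / G%:R <= tnth x c < (l c).+1%:R / G%:R].

Lemma box_rect G (l : {ffun 'I_d -> 'I_G}) :
  box l = [set x | forall c, [set` `[(l c)%:R / G%:R, (l c).+1%:R / G%:R[] (tnth x c)].
Proof. by apply/seteqP; split=> x h c; have := h c; rewrite /= in_itv. Qed.

Lemma measurable_rect (A : 'I_d -> set R) : (forall c, measurable (A c)) ->
  measurable [set x : d.-tuple R | forall c, A c (tnth x c)].
Proof.
move=> mA.
rewrite (_ : mkset _ = \bigcap_(c in [set: 'I_d]) ((fun x => tnth x c) @^-1` A c)); last first.
  by apply/seteqP; split=> [x h c _|x h c]; [exact: h|exact: (h c)].
apply: fin_bigcap_measurable => [|c _]; first exact: finite_finset.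
by rewrite -[X in measurable X]setTI; apply: measurable_tnth.
Qed.

Lemma measurable_box G (l : {ffun 'I_d -> 'I_G}) : measurable (box l).
Proof. by rewrite box_rect; exact: (measurable_rect (fun c => measurable_itv _)). Qed.

Lemma measurable_in_box i G (l : {ffun 'I_d -> 'I_G}) : measurable (X i @^-1` box l).
Proof. by apply: measurable_funPTI => //; exact: measurable_box. Qed.

Lemma prob_box i G (l : {ffun 'I_d -> 'I_G}) : P (X i @^-1` box l) = (G%:R^-1 ^+ d)%:E.
Proof.
have := @hunif i (fun c => [set` `[(l c)%:R / G%:R, (l c).+1%:R / G%:R[]) (fun c => measurable_itv _).
rewrite /distribution /pushforward -box_rect => ->.
rewrite (eq_bigr (fun=> (G%:R^-1)%:E)) => [|c _]; last first.
  have G0 : 0 < G%:R :> R by rewrite ltr0n (leq_ltn_trans _ (ltn_ord (l c))).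
  rewrite uniform_prob_itv.
  - by rewrite -mulrBl -natr1 addrAC subrr add0r mul1r.
  - by rewrite divr_ge0 // ltW.
  - by rewrite ltr_pM2r ?invr_gt0 // ltr_nat.
  - by rewrite ler_pdivrMr // mul1r ler_nat.
by rewrite prodEFin prodr_const card_ord.
Qed.

Definition labels n G (t : n.-tuple {ffun 'I_d -> 'I_G}) : set T :=
  [set x | forall i : 'I_n, box (tnth t i) (X i x)].

Let first n : {fset nat} := seq_fset tt (iota 0 n).

Let side n G (t : n.-tuple {ffun 'I_d -> 'I_G}) (j : nat) : set (d.-tuple R) :=
  if insub j is Some i then box (tnth t i) else setT.

Let measurable_side n G (t : n.-tuple {ffun 'I_d -> 'I_G}) j : measurable (side t j).
Proof. by rewrite /side; case: insub => [i|]; [exact: measurable_box|exact: measurableT]. Qed.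

Lemma labels_bigcap n G (t : n.-tuple {ffun 'I_d -> 'I_G}) :
  labels t = \bigcap_(j in [set` first n]) (X j @^-1` side t j).
Proof.
apply/seteqP; split=> [x h j|x h i].
  rewrite /= seq_fsetE mem_iota /= add0n => jn.
  by rewrite /side (insubT (fun j => (j < n)%N) jn); exact: (h (Ordinal jn)).
have := h i; rewrite /= seq_fsetE mem_iota /= add0n ltn_ord => /(_ isT).
by rewrite /side valK.
Qed.

Lemma measurable_labels n G (t : n.-tuple {ffun 'I_d -> 'I_G}) : measurable (labels t).
Proof.
rewrite labels_bigcap; apply: fin_bigcap_measurable => [|j _]; first exact: finite_fset.
by apply: measurable_funPTI => //; exact: measurable_side.
Qed.

Lemma prob_labels n G (t : n.-tuple {ffun 'I_d -> 'I_G}) :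
  P (labels t) = ((G%:R ^+ d) ^- n)%:E.
Proof.
rewrite labels_bigcap (hindep _ (measurable_side t)) big_seq.
rewrite (eq_bigr (fun=> (G%:R^-1 ^+ d)%:E)) => [|j]; last first.
  rewrite seq_fsetE mem_iota /= add0n => jn.
  by rewrite /side (insubT (fun j => (j < n)%N) jn) prob_box.
rewrite -big_seq prodEFin big_const_seq count_predT size_seq_fset undup_id ?iota_uniq //.
by rewrite size_iota iter_mulr_1 !exprVn.
Qed.

Lemma prob_some_labels n G (B : {set n.-tuple {ffun 'I_d -> 'I_G}}) :
  (P (\bigcup_(t in [set` B]) labels t) <= (#|B|%:R / (G%:R ^+ d) ^+ n)%:E)%E.
Proof.
have -> : [set` B] = [set` enum B].
  by apply/seteqP; split=> t /=; rewrite mem_enum.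
rewrite bigcup_seq cardE; elim: (enum B) => [|t r IH].
  by rewrite big_nil measure0 mul0r.
have mr : measurable (\big[setU/set0]_(u <- r) labels u).
  by apply: bigsetU_measurable => u _; exact: measurable_labels.
rewrite big_cons; apply: (le_trans (measureU2 P (measurable_labels t) mr)).
rewrite /= -natr1 mulrDl mul1r addrC EFinD; apply: leeD => //.
by rewrite prob_labels.
Qed.

(** The only box of the grid with one box: the half-open unit cube. Points in it have labels in
    every grid, and the faces it misses are negligible. *)
Definition cube0 : {ffun 'I_d -> 'I_1} := [ffun=> ord0].

Lemma in_cube_ae i : P.-negligible (~` (X i @^-1` box cube0)).
Proof.
have mE := measurable_in_box i cube0.
apply/negligibleP; first exact: measurableC.
by have := probability_setC P mE; rewrite prob_box invr1 expr1n subee.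
Qed.

Lemma labels_exist n G x : (0 < G)%N -> (forall i, box cube0 (X i x)) ->
  exists t : n.-tuple {ffun 'I_d -> 'I_G}, labels t x.
Proof.
move=> G0 hx.
have GR : 0 < G%:R :> R by rewrite ltr0n.
have ex (i : 'I_n) (c : 'I_d) : exists k : 'I_G,
    k%:R / G%:R <= tnth (X i x) c < k.+1%:R / G%:R.
  have := hx i c; rewrite ffunE !divr1 => /andP[x0 x1].
  have /andP[k1 k2] := truncn_itv (mulr_ge0 x0 (ltW GR)).
  have kG : (Num.truncn (tnth (X i x) c * G%:R) < G)%N.
    by rewrite -(ltr_nat R) (le_lt_trans k1) // -[ltRHS]mul1r ltr_pM2r.
  by exists (Ordinal kG); rewrite ler_pdivrMr // ltr_pdivlMr // k1.
exists [tuple [ffun c => sval (cid (ex i c))] | i < n] => i c.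
by rewrite tnth_mktuple ffunE; exact: svalP (cid (ex i c)).
Qed.

Lemma ae_labels (G : nat -> nat) (B : forall n, {set n.-tuple {ffun 'I_d -> 'I_(G n)}})
    (k : R) (n1 : nat) : 0 < k ->
  (forall n, (n1 <= n)%N -> (0 < G n)%N) ->
  (forall n, (n1 <= n)%N -> #|B n|%:R <= ((G n)%:R ^+ d) ^+ n * expR (- (k * n%:R))) ->
  {ae P, forall x, exists n0, forall n, (n0 <= n)%N -> exists2 t, t \notin B n & labels t x}.
Proof.
move=> k0 G0 hB.
pose E n : set T := if (n1 <= n)%N then \bigcup_(t in [set` B n]) labels t else set0.
have mE n : measurable (E n).
  rewrite /E; case: ifP => // _; apply: fin_bigcup_measurable => [|t _].
    exact: finite_finset.
  exact: measurable_labels.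
pose z := expR (- k).
have z0 : 0 < z by exact: expR_gt0.
have z1 : z < 1 by rewrite /z -[ltRHS]expR0 ltr_expR oppr_lt0.
have PE n : (P (E n) <= (z ^+ n)%:E)%E.
  rewrite /E; case: ifP => [h|_]; last by rewrite measure0 lee_fin exprn_ge0 // ltW.
  apply: le_trans (prob_some_labels _) _; rewrite lee_fin.
  rewrite ler_pdivrMr ?exprn_gt0 ?ltr0n ?G0 // mulrC.
  by rewrite /z -expRM_natl mulrN [n%:R * k]mulrC hB.
have sE : (\sum_(n <oo) P (E n) < +oo)%E.
  apply: le_lt_trans (ltry (1 - z)^-1).
  apply: lime_le; first exact: is_cvg_nneseries.
  apply: nearW => n; apply: le_trans (_ : (\sum_(0 <= i < n) (z ^+ i)%:E)%E <= _)%E.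
    by apply: lee_sum => i _.
  rewrite sumEFin lee_fin.
  have := @geometric_le_lim R n 1 z ler01 z0; rewrite gtr0_norm // mul1r => /(_ z1).
  by rewrite /series /= (eq_bigr (fun i => z ^+ i)) // => i _; rewrite mul1r.
have nE : P.-negligible (lim_sup_set E).
  apply/negligibleP; last exact: lim_sup_set_cvg0.
  by apply: bigcap_measurable => // i _; apply: bigcup_measurable.
apply: negligibleS (negligibleU nE (negligible_bigcup in_cube_ae)) => x /= nx.
apply: contrapT => /not_orP[h1 h2]; apply: nx.
have hx i : box cube0 (X i x).
  by apply: contrapT => h; apply: h2; exists i.
have [n0 h0] : exists n0, forall n, (n0 <= n)%N -> ~ E n x.
  apply: contrapT => /forallNP h; apply: h1 => n _.
  have /existsNP[j /not_implyP[nj /contrapT Ej]] := h n.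
  by exists j.
exists (maxn n0 n1) => n; rewrite geq_max => /andP[n0n n1n].
have [t ht] := labels_exist n (G0 n n1n) hx.
exists t => //; apply/negP => tB; apply: (h0 n n0n).
by rewrite /E n1n; exists t.
Qed.

End RandomLabels.

(** * From labels to gadgets *)

Section Grid.
Variables (R : realType) (d m : nat) (zx zy : 'I_5 -> 'I_m -> nat).
Hypothesis hd : (2 <= d)%N.
Variables (lam mg W0 : nat).
Hypothesis zxW : forall p k, (zx p k <= W0)%N.
Hypothesis zyW : forall p k, (zy p k <= W0)%N.
Variables (lo hi cc eta : R).
Hypothesis sepZ : ideal_separated zx zy lo hi cc eta.
Hypotheses (lam_eta : 32 * err R d m <= lam%:R * eta) (lam_m : (m < lam)%N).
Hypothesis mg_big : (13 * (lam * (2 * W0) + (m + d)) <= mg)%N.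

Notation Q := (cell_size m lam mg W0).
Notation sbox := (@slot_box d m zx zy lam mg).

Lemma cell_size_gt0 : (0 < Q)%N. Proof. by rewrite /cell_size addn1. Qed.

Lemma slot_box_lt p k c : (sbox p k c < Q)%N.
Proof. exact: leq_trans (slot_box_le hd lam mg zxW zyW p k c) (leq_subr _ _). Qed.

(** Modulo [lam], the first coordinate determines the slot, as [k < m < lam]; then both coordinates
    determine the ideal point. Two lobes sharing an ideal point would be at distance 0, against
    [sepZ]. *)
Lemma slot_box_inj p k q l : sbox p k =1 sbox q l -> p = q /\ k = l.
Proof.
move=> e; have := e (Ordinal (ltnW hd)); have := e (Ordinal hd).
rewrite /slot_box /= => /addnI/eqP; rewrite eqn_pmul2l ?(leq_ltn_trans _ lam_m) //.
move=> /eqP ey /addnI ex.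
have kl : k = l.
  apply: val_inj; have := congr1 (modn^~ lam) ex.
  by rewrite ![(lam * _)%N]mulnC !modnMDl !modn_small // (ltn_trans _ lam_m).
move: ex; rewrite kl => /addIn/eqP; rewrite eqn_pmul2l ?(leq_ltn_trans _ lam_m) //.
move=> /eqP ex; split=> //; apply/eqP; rewrite eq_sym; apply: contraT => pq.
case: sepZ => h1 h2 _ eta0 h3.
have := h1 p k q l pq; have := h2 p k k.
rewrite kl in ey *; rewrite /ideal_dist ex ey !subrr expr0n /= addr0 sqrtr0; lra.
Qed.

Variable N : nat.
Notation Lab := {ffun 'I_d -> 'I_(N * Q)}.
Notation Cell := {ffun 'I_d -> 'I_N}.

Lemma label_cell_proof (l : Lab) c : (l c %/ Q < N)%N.
Proof. by rewrite ltn_divLR ?cell_size_gt0 // ltn_ord. Qed.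

Definition label_cell (l : Lab) : Cell := [ffun c => Ordinal (label_cell_proof l c)].

Lemma slot_label_proof (k : Cell) (s : 'I_5 * 'I_m) c :
  (k c * Q + sbox s.1 s.2 c < N * Q)%N.
Proof.
apply: (@leq_trans ((k c).+1 * Q)); first by rewrite mulSnr ltn_add2l slot_box_lt.
by rewrite leq_mul2r ltn_ord orbT.
Qed.

Definition slot_label (k : Cell) (s : 'I_5 * 'I_m) : Lab :=
  [ffun c => Ordinal (slot_label_proof k s c)].

Lemma label_cell_slot k s : label_cell (slot_label k s) = k.
Proof.
apply/ffunP => c; apply: val_inj; rewrite !ffunE /= ffunE /=.
by rewrite divnMDl ?cell_size_gt0 // divn_small ?addn0 // slot_box_lt.
Qed.

Lemma slot_label_inj k : injective (slot_label k).
Proof.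
move=> [p i] [q j] /ffunP e; suff [-> ->] : p = q /\ i = j by [].
apply: slot_box_inj => c; have := congr1 val (e c).
by rewrite !ffunE /= => /addnI.
Qed.

Lemma card_label_cell k : (#|[set l | label_cell l == k]%SET| <= Q ^ d)%N.
Proof.
pose r (l : Lab) : {ffun 'I_d -> 'I_Q} := [ffun c => Ordinal (ltn_pmod (l c) cell_size_gt0)].
have ri : {in [set l | label_cell l == k]%SET &, injective r}.
  move=> l l'; rewrite !finset.inE => /eqP lk /eqP l'k /ffunP e.
  apply/ffunP => c; apply: val_inj => /=.
  have := congr1 val (e c); rewrite !ffunE /= => em.
  have := congr1 (fun k : Cell => val (k c)) (etrans lk (esym l'k)).
  by rewrite !ffunE /= => ed; rewrite (divn_eq (l c) Q) ed em -divn_eq.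
rewrite -(card_in_imset ri); apply: leq_trans (max_card _) _.
by rewrite card_ffun !card_ord.
Qed.

Lemma card_labels : #|{: Lab}| = (Q ^ d * #|{: Cell}|)%N.
Proof. by rewrite !card_ffun !card_ord mulnC expnMn. Qed.

Notation goods := (good_cells label_cell slot_label).

Variables (n : nat) (x : nat -> d.-tuple R) (t : n.-tuple Lab).
Hypothesis xt : forall i : 'I_n, box (tnth t i) (x i).
Hypothesis N0 : (0 < N)%N.

Let G : finType := {k : Cell | k \in goods t}.
Let h : R := (N * Q)%:R^-1.

Lemma grid_gadgets : exists pt : G -> 'I_5 -> 'I_m -> 'I_n,
  [/\ forall j, gadget (fun i i' : 'I_n => euclidean_dist (x i) (x i')) (pt j)
        (gad_gamma lam h eta) (gad_delta d m lam W0 h),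
      forall i j p k q l, pt i p k = pt j q l -> i = j
    & forall j, exists base : 'I_d -> nat, forall p k c,
        h * (base c + sbox p k c)%:R <= tnth (x (pt j p k)) c <
        h * (base c + sbox p k c).+1%:R].
Proof.
have h0 : 0 < h by rewrite invr_gt0 ltr0n muln_gt0 N0 cell_size_gt0.
pose cl (j : G) : Cell := val j.
have ex (j : G) : exists pos, fits label_cell slot_label t (cl j) pos.
  by have := valP j; rewrite finset.inE => /existsP.
pose pos j := sval (cid (ex j)).
have fitsP j : fits label_cell slot_label t (cl j) (pos j) := svalP (cid (ex j)).
have tpos j p k : tnth t (pos j (p, k)) = slot_label (cl j) (p, k).
  by have /andP[/forallP/(_ (p, k))/eqP] := fitsP j.
have ptP j p k c : h * (cl j c * Q + sbox p k c)%:R <= tnth (x (pos j (p, k))) c <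
    h * (cl j c * Q + sbox p k c).+1%:R.
  have := xt (pos j (p, k)); rewrite tpos => /(_ c).
  by rewrite !ffunE /= ![_ / _]mulrC.
exists (fun j p k => pos j (p, k)); split.
- move=> j; apply: (template_gadget hd zxW zyW (base := fun c => (cl j c * Q)%N) h0 sepZ
      lam_eta lam_m mg_big (x := fun i : 'I_n => x i) (ptP j)) => i iout.
  have /andP[_ /forallP/(_ i)] := fitsP j.
  have -> : (i \in codom (pos j)) = false.
    by apply/negP => /codomP[[p k] e]; have := iout p k; rewrite e eqxx.
  move=> /= ne.
  have /existsP[c hc] : [exists c, label_cell (tnth t i) c != cl j c].
    rewrite -negb_forall; apply: contra ne => /forallP e.
    by apply/eqP/ffunP => c; apply/eqP.
  exists c; have := xt i c; rewrite ![_ / _]mulrC -/h => /andP[b1 b2].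
  move: hc; rewrite ffunE -val_eqE /= neq_ltn => /orP[lt|gt].
    left; apply: lt_le_trans b2 _; rewrite ler_pM2l // ler_nat.
    by rewrite -ltn_divLR ?cell_size_gt0.
  right; apply: le_trans b1; rewrite ler_pM2l // ler_nat -mulSnr.
  by rewrite -leq_divRL ?cell_size_gt0.
- move=> i j p k q l /(congr1 (tnth t)); rewrite !tpos => /(congr1 label_cell).
  by rewrite !label_cell_slot => /val_inj.
- by move=> j; exists (fun c => (cl j c * Q)%N) => p k c; exact: ptP.
Qed.

Lemma card_grid : #|G| = #|goods t|.
Proof. by rewrite card_sig; apply: eq_card => k. Qed.

End Grid.

(** [N] is the integer part of the [d]-th root of [n], and [N + 1 <= 2 N]. So a grid of [N^d] cells
    has between [n / 2^d] and [n] of them. *)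
Lemma root_bound d n : (0 < d)%N -> (0 < n)%N ->
  exists2 N, (0 < N)%N & (N ^ d <= n <= 2 ^ d * N ^ d)%N.
Proof.
move=> d0 n0; have ex : exists N, (N ^ d <= n)%N by exists 1; rewrite exp1n.
have ub N : (N ^ d <= n)%N -> (N <= n)%N.
  by apply: leq_trans; case: N => // N; rewrite -{1}[N.+1]expn1 leq_pexp2l.
case: (ex_maxnP ex ub) => N hN mN.
have N0 : (0 < N)%N by apply: mN; rewrite exp1n.
exists N => //; rewrite hN /= -expnMn.
have : ~~ (N.+1 ^ d <= n)%N by apply/negP => /mN; rewrite ltnn.
rewrite -ltnNge => /ltnW/leq_trans; apply; rewrite leq_exp2r //.
by rewrite mul2n -addnn -addn1 leq_add2l.
Qed.

Lemma expR1_le4 (R : realType) : expR 1 <= 4 :> R.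
Proof.
have h : expR 2^-1 <= 2 :> R.
  apply: le_trans (expR_le_quadratic _) _; last lra.
  by rewrite ger0_norm.
rewrite (_ : 1 = 2^-1 + 2^-1); last by lra.
rewrite expRD; apply: le_trans (ler_pM _ _ h h) _; rewrite ?expR_ge0 //; lra.
Qed.

(** [ln n >= 1] for [n >= 4], so dividing by a power of it only weakens the bound [e^(c n)]. *)
Lemma div_ln_le (R : realType) (c : R) n k : 0 <= c -> (4 <= n)%N ->
  c * n%:R / ln n%:R ^+ k <= c * n%:R.
Proof.
move=> c0 n4; have l1 : 1 <= ln n%:R :> R.
  rewrite -ler_expR lnK ?posrE ?ltr0n ?(leq_trans _ n4) //.
  by apply: le_trans (expR1_le4 R) _; rewrite ler_nat.
have : 1 <= ln n%:R ^+ k :> R by rewrite exprn_ege1.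
move=> h; rewrite ler_pdivrMr ?(lt_le_trans ltr01) // ler_peMr // mulr_ge0 //.
Qed.

Section RandomGadgets.
Local Open Scope classical_set_scope.
Local Open Scope ring_scope.
Variables (R : realType) (disp : measure_display) (T : measurableType disp).
Variables (P : probability T R) (d : nat) (X : nat -> {RV P >-> d.-tuple R}).
Hypotheses (hindep : mutually_independent X) (hunif : forall i, uniform_on_cube (X i)).
Hypothesis hd : (2 <= d)%N.
Variables (m : nat) (zx zy : 'I_5 -> 'I_m -> nat) (lam mg W0 : nat).
Hypothesis zxW : forall p k, (zx p k <= W0)%N.
Hypothesis zyW : forall p k, (zy p k <= W0)%N.
Variables (lo hi cc eta : R).
Hypothesis sepZ : ideal_separated zx zy lo hi cc eta.
Hypotheses (lam_eta : 32 * err R d m <= lam%:R * eta) (lam_m : (m < lam)%N).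
Hypothesis mg_big : (13 * (lam * (2 * W0) + (m + d)) <= mg)%N.

Notation Q := (cell_size m lam mg W0).
Notation label_cell := (@label_cell d m lam mg W0 _).
Notation slot_label := (@slot_label d m zx zy hd lam mg W0 zxW zyW _).

Lemma ae_many_good_cells : exists2 delta : R, 0 < delta &
  {ae P, forall x, exists n0, forall n, (n0 <= n)%N ->
    exists N (t : n.-tuple {ffun 'I_d -> 'I_(N * Q)}),
    [/\ (0 < N)%N, labels X t x & delta * n%:R <= #|good_cells label_cell slot_label t|%:R]}.
Proof.
have exN n : exists N, (0 < n)%N -> (0 < N)%N && (N ^ d <= n <= 2 ^ d * N ^ d)%N.
  case: (posnP n) => [->|n0]; first by exists 0%N.
  by have [N N0 h] := root_bound (ltnW hd) n0; exists N; rewrite N0 h.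
pose Nf n := sval (cid (exN n)).
have NfP n : (0 < n)%N -> (0 < Nf n)%N && (Nf n ^ d <= n <= 2 ^ d * Nf n ^ d)%N.
  exact: svalP (cid (exN n)).
pose S : finType := ('I_5 * 'I_m)%type.
pose dens := good_density R S (Q ^ d) (2 ^ d).
have Q0 : (0 < Q ^ d)%N by rewrite expn_gt0 cell_size_gt0.
have n1P n : (2 * 2 ^ d + #|S| * 2 <= n)%N -> (0 < n)%N.
  by apply: leq_trans; rewrite addn_gt0 muln_gt0 expn_gt0.
have dens0 : 0 < dens.
  rewrite /dens /good_density divr_gt0 ?expR_gt0 // mulr_gt0 ?exprn_gt0 ?mulr_gt0 ?ltr0n //.
  by rewrite expn_gt0.
exists (dens / 2); first by rewrite divr_gt0.
pose B n : {set n.-tuple {ffun 'I_d -> 'I_(Nf n * Q)}} :=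
  [set t | #|good_cells label_cell slot_label t|%:R <= dens / 2 * n%:R]%SET.
apply: filterS (@ae_labels _ _ _ _ _ _ hindep hunif _ B (dens ^+ 2 / 128)
    (2 * 2 ^ d + #|S| * 2) _ _ _) => [x [n0 hn0]||n|n hn].
- exists (maxn n0 1) => n; rewrite geq_max => /andP[n0n n1n].
  have [t tB xt] := hn0 n n0n; exists (Nf n), t; split=> //.
    by case/andP: (NfP n n1n).
  by move: tB; rewrite finset.inE -ltNge => /ltW.
- by rewrite divr_gt0 ?exprn_gt0.
- by move=> /n1P/NfP/andP[N0 _]; rewrite muln_gt0 N0 cell_size_gt0.
- have /andP[N0 /andP[Nn nN]] := NfP n (n1P n hn).
  have CE : #|{: {ffun 'I_d -> 'I_(Nf n)}}| = (Nf n ^ d)%N by rewrite card_ffun !card_ord.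
  have C2 : (1 < Nf n ^ d)%N.
    have p0 : (0 < 2 ^ d)%N by rewrite expn_gt0.
    rewrite -(ltn_pmul2l p0) muln1; apply: leq_trans nN; apply: leq_trans hn.
    by apply: leq_trans (leq_addr _ _); rewrite ltn_Pmull.
  have := few_good_cells R Q0 (card_labels d m lam mg W0 (Nf n))
    (@card_label_cell d m lam mg W0 (Nf n))
    (@label_cell_slot d m zx zy hd lam mg W0 zxW zyW (Nf n))
    (@slot_label_inj R d m zx zy hd lam mg W0 zxW zyW lo hi cc eta sepZ lam_m (Nf n)) (a := 2 ^ d).
  move=> /(_ n); rewrite CE card_labels CE -[(Q ^ d * _)%N]expnMn natrX [(Q * _)%N]mulnC.
  by apply => //; apply: leq_trans hn; rewrite leq_addl.
Qed.

Definition leaf_rate (h : R) : R :=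
  gad_gamma lam h eta / (m.+1%:R * gad_delta d m lam W0 h *+ 2 + gad_gamma lam h eta) /
  (m.+1)`!%:R.

Let lam0 : 0 < lam%:R :> R. Proof. by rewrite ltr0n (leq_ltn_trans _ lam_m). Qed.
Let eta0 : 0 < eta. Proof. by case: sepZ. Qed.

Lemma gad_gamma_gt0 h : 0 < h -> 0 < gad_gamma lam h eta.
Proof. by move=> h0; rewrite /gad_gamma !mulr_gt0. Qed.

Lemma gad_delta_ge0 (h : R) : 0 < h -> 0 <= gad_delta d m lam W0 h.
Proof. by move=> h0; rewrite /gad_delta mulr_ge0 // ltW. Qed.

(** [gamma] and [Delta] are both proportional to the box side [h], which shrinks as [n] grows. It
    cancels, which makes the final constant independent of [n]. *)
Lemma leaf_rate_scale h : 0 < h -> leaf_rate h = leaf_rate 1.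
Proof.
move=> h0; rewrite /leaf_rate /gad_gamma /gad_delta !mul1r; congr (_ / _).
set g := _ / 2; set D := (_ + _)%:R.
rewrite (_ : m.+1%:R * (h * D) *+ 2 + h * g = h * (m.+1%:R * D *+ 2 + g)); last by ring.
by rewrite -mulf_div divff ?gt_eqF // mul1r.
Qed.

Lemma leaf_rate_gt0 : 0 < leaf_rate 1.
Proof.
have g0 := gad_gamma_gt0 ltr01; have D0 := gad_delta_ge0 ltr01.
rewrite /leaf_rate !divr_gt0 ?ltr0n ?fact_gt0 //.
by rewrite ltr_wpDl // mulrn_wge0 // mulr_ge0.
Qed.

Variables (H : forall n, (edge n -> R) -> {set edge n} -> {set edge n} -> {set edge n})
  (S : forall n, (edge n -> R) -> labeled_tree n) (LB : lower_bound R).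

(** What remains to be shown for each lower bound. The boxes of the points are part of the data
    because the prism inequality is transferred from the template to the points. *)
Hypothesis leaves_LB : forall n (x : nat -> d.-tuple R) (G : finType)
    (pt : G -> 'I_5 -> 'I_m -> 'I_n) (h : R),
  (m.+2 < n)%N -> 0 < h ->
  (forall j, gadget (fun i i' : 'I_n => euclidean_dist (x i) (x i')) (pt j)
    (gad_gamma lam h eta) (gad_delta d m lam W0 h)) ->
  (forall i j p k q l, pt i p k = pt j q l -> i = j) ->
  (forall j, exists base : 'I_d -> nat, forall p k c,
    h * (base c + slot_box zx zy lam mg p k c)%:R <= tnth (x (pt j p k)) c <
    h * (base c + slot_box zx zy lam mg p k c).+1%:R) ->
  let w := @euclidean_weight R d x n in
  forall D : {set vertex (S w)}, pruned_tree w (H w) (LB w) D ->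
  expR (leaf_rate h * #|G|%:R) <= #|leaves D|%:R.

Lemma ae_many_leaves : exists c : R, 0 < c /\
  {ae P, forall t : T, exists n0 : nat, forall n : nat, (n0 <= n)%N ->
    let w := @euclidean_weight R d (fun i => X i t) n in
    forall D : {set vertex (S w)}, pruned_tree w (H w) (LB w) D ->
    expR (c * n%:R / ln (n%:R) ^+ 6) <= #|leaves D|%:R}.
Proof.
have [delta delta0 ae] := ae_many_good_cells.
exists (leaf_rate 1 * delta); split; first by rewrite mulr_gt0 // leaf_rate_gt0.
apply: filterS ae => x [n0 hn0]; exists (maxn n0 (m + 4)) => n.
rewrite geq_max => /andP[/hn0[N [t [N0 xt many]]] mn] D hD.
have [pt [ptG pt_disj ptP]] := grid_gadgets hd zxW zyW sepZ lam_eta lam_m mg_big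
  (x := fun i => X i x) xt N0.
have h0 : 0 < (N * Q)%:R^-1 :> R by rewrite invr_gt0 ltr0n muln_gt0 N0 cell_size_gt0.
have mn2 : (m.+2 < n)%N by move: mn; rewrite addn4 => /ltnW.
apply: le_trans (leaves_LB mn2 h0 ptG pt_disj ptP hD).
rewrite (leaf_rate_scale h0) card_grid ler_expR.
have r0 := leaf_rate_gt0.
apply: le_trans (div_ln_le _ _ _) _; first by rewrite mulr_ge0 // ltW.
  by rewrite (leq_trans _ mn) // leq_addl.
by rewrite -mulrA ler_pM2l.
Qed.

End RandomGadgets.

Local Open Scope classical_set_scope.
Local Open Scope ring_scope.

Theorem theorem1p9 (R : realType) (disp : measure_display)
  (T : measurableType disp) (P : probability T R)
  (d : nat) (hd : (2 <= d)%N)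
  (X : nat -> {RV P >-> d.-tuple R})
  (hindep : mutually_independent X)
  (hunif : forall i : nat, uniform_on_cube (X i))
  (H : forall n : nat,
     (edge n -> R) -> {set edge n} -> {set edge n} -> {set edge n})
  (hH : tsp_heuristic H)
  (S : forall n : nat, (edge n -> R) -> labeled_tree n)
  (hS : branching_strategy S)
  (LB : lower_bound R)
  (hLB : (exists2 g : nat, (3 <= g)%N & LB = @LB_TF R g) \/ LB = @LB_HK R) :
  exists c : R, 0 < c /\
    {ae P, forall t : T, exists n0 : nat, forall n : nat, (n0 <= n)%N ->
      let w := @euclidean_weight R d (fun i => X i t) n in
      forall D : {set vertex (S n w)},
        pruned_tree w (H n w) (LB n w) D ->
        expR (c * n%:R / ln (n%:R) ^+ 6) <= #|leaves D|%:R}.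
Proof.
case: hLB => [[g g3 ->]|->].
(* The lobes have [m = g] points, so that they close into admissible cycles. The pentagon has
   [eta = 8], and [32 (g + d) <= 8 lam] holds for this [lam]. *)
- have lam_m : (g < (4 * (g + d)).+1)%N by rewrite ltnS mulSn -addnA leq_addr.
  have lam_eta : 32 * err R d g <= (4 * (g + d)).+1%:R * 8.
    by rewrite /err -!natrM ler_nat; lia.
  apply: (ae_many_leaves hindep hunif hd (W0 := 50)
    (mg := 13 * ((4 * (g + d)).+1 * (2 * 50) + (g + d))) _ _ (pentagon_separated R g)
    lam_eta lam_m _).
  + by move=> p k; case: (pentagon_le p).
  + by move=> p k; case: (pentagon_le p).
  + exact: leqnn.
  move=> n x G pt h gn h0 ptG pt_disj _ w D hD.
  have gam0 := gad_gamma_gt0 (pentagon_separated R g) lam_m h0.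
  have del0 : 0 <= gad_delta d g (4 * (g + d)).+1 50 h by exact: gad_delta_ge0.
  have tr : branching_tree (S n (euclidean_weight x (n := n))).
    by apply: hS; rewrite (ltn_trans _ gn) // !ltnS (ltn_trans _ g3).
  exact (leaves_TF (dd := fun i j : 'I_n => euclidean_dist (x i) (x j))
    (fun i j => euclidean_dist_sym _ _) (fun i j k => euclidean_dist_tri _ _ _)
    (fun i => euclidean_dist_xx _) g3 gn gam0 del0 ptG pt_disj tr (hH n _) (leqnn g) hD).
(* The prism has [m = 6] points per lobe and [eta = 1], whence [lam = 32 (6 + d)]. *)
have lam_m : (6 < 32 * (6 + d))%N by lia.
have lam_eta : 32 * err R d 6 <= (32 * (6 + d))%:R * 1 by rewrite /err -natrM mulr1.
have [W WP] : exists W, forall p k, (prism_zx p k <= W)%N /\ (prism_zy p k <= W)%N.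
  by exists (N.to_nat 60000); exact: prism_zle.
apply: (ae_many_leaves hindep hunif hd (W0 := W)
  (mg := 13 * (32 * (6 + d) * (2 * W) + (6 + d))) _ _ (prism_separated R) lam_eta lam_m _).
- by move=> p k; case: (WP p k).
- by move=> p k; case: (WP p k).
- exact: leqnn.
move=> n x G pt h gn h0 ptG pt_disj ptP w D hD.
have gam0 := gad_gamma_gt0 (prism_separated R) lam_m h0.
have del0 : 0 <= gad_delta d 6 (32 * (6 + d)) W h by exact: gad_delta_ge0.
have tr : branching_tree (S n (euclidean_weight x (n := n))) by apply: hS; exact: ltn_trans gn.
have gain j : prism_gain (fun i j : 'I_n => euclidean_dist (x i) (x j)) (pt j)
    (gad_gamma (32 * (6 + d)) h 1).
  have [base hb] := ptP j.
  exact: (template_prism hd h0 lam_eta (x := fun i : 'I_n => x i) hb (@prism_template_gain R)).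
exact (leaves_HK (dd := fun i j : 'I_n => euclidean_dist (x i) (x j))
  (fun i j => euclidean_dist_sym _ _) (fun i j k => euclidean_dist_tri _ _ _)
  (fun i => euclidean_dist_xx _) gn gam0 del0 ptG pt_disj gain tr (hH n _) hD).
Qed.
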